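(* Let $\beta:\mathbb R\to\mathbb R$ be a Lipschitz periodic function, let $u_0$ be an admissible initial datum with support $(a_0,b_0)$, and for $\varepsilon>0$ let $u^\varepsilon$ be a solution of the sliding drop problem with coefficient $\beta_\varepsilon(x)=\beta(x/\varepsilon)$ and initial datum $u_0$. When $\varepsilon$ goes to zero, $u^\varepsilon$ converges uniformly to a function $u(x,t)$ which is a solution of the homogenized problem with initial datum $u_0$; that is, there are Lipschitz functions $a(t),b(t)$ on $[0,\infty)$ with $a(0)=a_0$, $b(0)=b_0$ such that for all $t\ge0$ $$\{x:u(x,t)>0\}=(a(t),b(t)),\qquad u(\cdot,t)=\mathrm{argmin}\Big\{\mathcal F(v): v\in H^1_0(a(t),b(t)),\ v\ge0,\ \int_{a(t)}^{b(t)}v\,dx=V_0\Big\},$$ and for a.e. $t\ge0$ $$\min\{a'(t)+r(\tfrac12|u_x(a(t),t)|^2),\ |u_x(a(t),t)|\}=0,$$ $$\min\{-b'(t)+r(\tfrac12|u_x(b(t),t)|^2),\ |u_x(b(t),t)|\}=0 .$$ Furthermore, there is at most one solution $u$ of the homogenized problem with given initial datum $u_0$.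
   Context: Fix constants $V_0>0$ (volume), $\kappa>0$ and $0<\alpha<\pi/2$. Functions in $H^1_0(a,b)$ are extended by $0$ to $\mathbb R$. Set $$\mathcal F(v)=\int_{\mathbb R}\frac12|v_x|^2+\frac{v^2}{2}\kappa\cos\alpha-v\,x\,\kappa\sin\alpha\,dx .$$ Admissible initial datum: a function $u_0$ for which there are $a_0<b_0$ with $\{u_0>0\}=(a_0,b_0)$ and $u_0=\mathrm{argmin}\{\mathcal F(v): v\in H^1_0(a_0,b_0),\ v\ge 0,\ \int v\,dx=V_0\}$. Solution of the sliding drop problem with coefficient $\gamma$ (a Lipschitz function) and initial datum $u_0$: a function $u(x,t)$, $t\ge0$, for which there exist Lipschitz functions $a(t),b(t)$ on $[0,\infty)$ with $a(0)=a_0$, $b(0)=b_0$ such that, for all $t\ge 0$, $\{x: u(x,t)>0\}=(a(t),b(t))$ and $u(\cdot,t)=\mathrm{argmin}\{\mathcal F(v): v\in H^1_0(a(t),b(t)),\ v\ge0,\ \int_{a(t)}^{b(t)} v\,dx=V_0\}$, and, for a.e. $t\ge0$, $$\min\{a'(t)+\tfrac12|u_x(a(t),t)|^2-\gamma(a(t)),\ |u_x(a(t),t)|\}=0,$$ $$\min\{-b'(t)+\tfrac12|u_x(b(t),t)|^2-\gamma(b(t)),\ |u_x(b(t),t)|\}=0.$$ All derivatives $u_x(a(t),t)$, $u_x(b(t),t)$ are one-sided, taken from inside $(a(t),b(t))$. For $q\in\mathbb R$, $r(q)$ denotes the effective speed $r(q)=\lim_{t\to\infty}\frac{x(t)-x(0)}{t}$,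 where $x$ is any solution of $x'(t)=q-\beta(x(t))$ (the limit exists and does not depend on the choice of the solution).
   Formalization: ''Converges uniformly'' is proved uniformly in x on the whole line and in t on every bounded interval [0,T]; uniformity over all t≥0 fails in general, since at the pinning threshold the ε-drop can drift to infinity while the homogenized drop stays at rest. *)

(* Defs.v *)
From HB Require Import structures.
From mathcomp Require Import all_boot all_order all_algebra.
From mathcomp Require Import all_classical all_reals all_analysis.
Import Order.TTheory GRing.Theory Num.Theory.
Import numFieldNormedType.Exports.

Set Implicit Arguments.
Unset Strict Implicit.
Unset Printing Implicit Defensive.

Local Open Scope classical_set_scope.
Local Open Scope ring_scope.

Section SlidingDrop.
Context {R : realType}.
Implicit Types (v w g x beta : R -> R) (u : R -> R -> R).

Local Notation mu := (@lebesgue_measure R).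

(* On the line, v has weak derivative g in L^2 iff (the continuous
   representative of) v is a primitive of g. *)
Definition weak_derivative v g : Prop :=
  g \in Lfun mu 2%:E /\
  forall y z, y <= z -> v z - v y = \int[mu]_(s in `[y, z]) g s.

(* A representative of v_x; it is determined up to a null set. *)
Definition wderiv v : R -> R := xget (cst 0) [set g | weak_derivative v g].

(* H^1_0(a, b), extended by 0 to the line. *)
Definition H10 (a b : R) v : Prop :=
  (exists g, weak_derivative v g) /\ (forall y, y \notin `]a, b[ -> v y = 0).

Definition energy (kappa alpha : R) v : R :=
  \int[mu]_y (2^-1 * (`|wderiv v y| ^+ 2)
              + v y ^+ 2 / 2 * (kappa * cos alpha)
              - v y * y * (kappa * sin alpha)).

Definition profile_class (V0 a b : R) : set (R -> R) :=
  [set v | [/\ H10 a b v, (forall y, 0 <= v y) & \int[mu]_y v y = V0]].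

(* {v > 0} = (a, b) and v = argmin of the energy on profile_class V0 a b
   (the energy is strictly convex, so that a minimizer is unique). *)
Definition drop_profile (kappa alpha V0 a b : R) v : Prop :=
  [/\ [set y | 0 < v y] = `]a, b[%classic,
      profile_class V0 a b v &
      forall w, profile_class V0 a b w ->
        energy kappa alpha v <= energy kappa alpha w].

Definition right_derivative v (y p : R) : Prop :=
  h^-1 * (v (y + h) - v y) @[h --> 0^'+] --> p.

Definition left_derivative v (y p : R) : Prop :=
  h^-1 * (v (y + h) - v y) @[h --> 0^'-] --> p.

(* The two contact point conditions share the form
     min (a' + F (a, |u_x|^2 / 2), |u_x|) = 0,
     min (- b' + F (b, |u_x|^2 / 2), |u_x|) = 0.
   Only the values u y t with t >= 0 are meaningful. *)
Definition drop_solution (F : R -> R -> R) (kappa alpha V0 a0 b0 : R) u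
    : Prop :=
  exists a b : R -> R,
  [/\ [lipschitz a t | t in `[0, +oo[%classic] /\
      [lipschitz b t | t in `[0, +oo[%classic],
      a 0 = a0 /\ b 0 = b0,
      forall t : R, 0 <= t ->
        drop_profile kappa alpha V0 (a t) (b t) (fun y => u y t),
      {ae mu, forall t : R, 0 <= t ->
        exists da p : R,
        [/\ is_derive t (1 : R) a da,
            right_derivative (fun y => u y t) (a t) p &
            Num.min (da + F (a t) (2^-1 * `|p| ^+ 2)) `|p| = 0]} &
      {ae mu, forall t : R, 0 <= t ->
        exists db p : R,
        [/\ is_derive t (1 : R) b db,
            left_derivative (fun y => u y t) (b t) p &
            Num.min (- db + F (b t) (2^-1 * `|p| ^+ 2)) `|p| = 0]}].

Definition sliding_drop (gamma : R -> R) : R -> R -> R -> R -> R ->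
    (R -> R -> R) -> Prop :=
  drop_solution (fun y q => q - gamma y).

(* The l such that (x t - x 0) / t --> l for every solution of
   x' = q - beta x. *)
Definition effective_speed beta (q : R) : R :=
  xget 0 [set l : R | forall x,
    (forall t : R, is_derive t (1 : R) x (q - beta (x t))) ->
    (x t - x 0) / t @[t --> +oo] --> l].

Definition homogenized_drop beta : R -> R -> R -> R -> R ->
    (R -> R -> R) -> Prop :=
  drop_solution (fun _ q => effective_speed beta q).

End SlidingDrop.

(* Main.v *)
Require Import Defs.
From HB Require Import structures.
From mathcomp Require Import all_boot all_order all_algebra.
From mathcomp Require Import all_classical all_reals all_analysis.
From mathcomp Require Import measurable_realfun ring lra.
Import Order.TTheory GRing.Theory Num.Theory.
Import numFieldNormedType.Exports.

(** * Homogenization of a sliding drop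

   The profile of a drop of given mass on a given interval is explicit, up to the
   translation of the interval: it solves a linear equation of second order with constant
   coefficients and an affine right-hand side. By convexity of the energy it is the unique
   minimizer as long as its slope at the left end is nonnegative (sessile_minimal,
   obstacle_unique). This fails for intervals longer than a critical length; there the
   minimizer leaves a part of the interval dry, so that no drop fills such an interval
   (drop_profileP). Hence a solution u is nothing but the motion of its contact points
   a, b, and the contact point conditions become the system
     b' = F (b, rforce (b - a)),   a' >= - F (a, lforce (b - a)),
   with equality in the second relation below the critical length (edge_motion).

   Half the squared slopes, rforce and lforce, are nonincreasing functions of the length:
   the slopes are A / om + B om and A / om - B om for an increasing function om of the
   length, and the sum of two positive terms with constant product decreases as long as
   the decreasing term is the larger one, which is the sign condition on the left slope.
   For the homogenized problem, F is the effective speed r, a continuous and nondecreasing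
   function. So the length of a homogenized drop solves l' = f l with f nonincreasing, with
   a reflection at the critical length, and is unique although r need not be Lipschitz
   (edge_motion_unique).

   For the convergence, the contact points at scale e are Lipschitz uniformly in e, because
   short drops spread (length_bounded_below, edges_equilipschitz), so that they converge
   pointwise along every ultrafilter finer than the right neighborhoods of 0. On a short
   time interval the forces are nearly constant, and a point that moves with x' <= q - beta
   (x / e) advances at most at speed r q up to O(e), which is seen by measuring its
   position with the travel time, a primitive of 1 / (q - beta) (displacement_unpinned).
   Hence every limit moves with the effective speed (limit_edge_motion). By uniqueness
   there is only one limit, and the contact points, then the profiles, converge uniformly
   on bounded time intervals (profiles_cvg). *)

Set Implicit Arguments.
Unset Strict Implicit.
Unset Printing Implicit Defensive.

Local Open Scope classical_set_scope.
Local Open Scope ring_scope.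

(** * Monotonicity from derivatives *)

(** Real induction, which needs no continuity of h: a supremum of times t with
   h c <= h t is again such a time, and one can move on to the right of it. *)
Lemma local_ndecr (R : realType) (h : R -> R) (c d : R) : c <= d ->
  (forall t, c <= t <= d -> \forall s \near t, c <= s <= d ->
     (s <= t -> h s <= h t) /\ (t <= s -> h t <= h s)) ->
  h c <= h d.
Proof.
move=> cd loc.
pose S := [set t | c <= t <= d /\ h c <= h t].
have Sc : S c by split=> //; rewrite lexx cd.
have Sub : ubound S d by move=> t [/andP[_ ?] _].
have supS : has_sup S by split; [exists c | exists d].
set t0 := sup S.
have ct0 : c <= t0 by apply: (sup_upper_bound supS).
have t0d : t0 <= d by apply: ge_sup => //; exists c.
have /loc : c <= t0 <= d by rewrite ct0 t0d.
move=> /nbhs_ballP[e /= e0 be].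
have [s [/andP[cs sd] hs] ts] := @sup_adherent _ S e e0 supS.
have st0 : s <= t0 by apply: (sup_upper_bound supS); split => //; rewrite cs sd.
have ht0 : h c <= h t0.
  have [||H _] := be s; last 1 first.
  - by apply: le_trans hs (H _).
  - rewrite /ball /= ger0_norm ?subr_ge0//; rewrite -/t0 in ts; lra.
  - by rewrite cs sd.
have [->//|nt0d] := eqVneq d t0.
have lt0d : t0 < d by rewrite lt_neqAle eq_sym nt0d.
pose s1 := Num.min d (t0 + e / 2).
have ts1 : t0 < s1 by rewrite lt_min lt0d/=; lra.
have s1d : s1 <= d by rewrite ge_min lexx.
have s1e : s1 <= t0 + e / 2 by rewrite ge_min lexx orbT.
have : S s1.
  split; first by rewrite s1d andbT; lra.
  apply: le_trans ht0 _; have [||_ H] := be s1; last exact/H/ltW.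
  - by rewrite /ball /= ler0_norm; lra.
  - by rewrite s1d andbT; lra.
by move=> /(sup_upper_bound supS); rewrite -/t0 leNgt ts1.
Qed.

Lemma negligible_open_cover (R : realType) (A : set R) (e : R) :
  (@lebesgue_measure R).-negligible A -> 0 < e ->
  exists U : set R, [/\ open U, A `<=` U & (lebesgue_measure U <= e%:E)%E].
Proof.
move=> [N [mN N0 AN]] e0.
have muNlt : (lebesgue_measure N < +oo)%E by rewrite N0.
have [U [oU NU /ltW UNe]] := lebesgue_regularity_outer mN muNlt e0.
exists U; split => //; first exact: subset_trans NU.
have mU : measurable U by apply: open_measurable.
have UE : U = (U `\` N) `|` N by rewrite setUC setDUK.
rewrite {1}UE (le_trans (measureU2 _ _ _))//; first exact: measurableD.
by apply: (@le_trans _ _ (e%:E + 0)%E); [apply: leeD => //; rewrite le_eqVlt; apply/orP; left; apply/eqP; exact: N0 | rewrite adde0].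
Qed.

(** What f may lose on the exceptional set is absorbed by L times the measure of an
   open cover U of that set: f t + e t + L m t, where m t is the measure of the part
   of U in [c, t], is locally nondecreasing at every point t. *)
Lemma ae_ndecr (R : realType) (f : R -> R) (L c d : R) :
  (forall s t, c <= s <= d -> c <= t <= d -> `|f s - f t| <= L * `|s - t|) ->
  {ae (@lebesgue_measure R), forall t, c < t < d ->
     exists2 df, is_derive t (1 : R) f df & 0 <= df} ->
  c <= d -> f c <= f d.
Proof.
move=> lipf aef cd.
have [->//|ncd] := eqVneq c d.
have ltcd : c < d by rewrite lt_neqAle ncd.
have L0 : 0 <= L.
  have := lipf c d; rewrite !lexx cd => /(_ isT isT) h.
  have := le_trans (normr_ge0 _) h.
  by rewrite pmulr_lge0// normr_gt0; lra.
apply/ler_addgt0Pr => e0 e00.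
pose e := e0 / (d - c + L + 1).
have e_gt0 : 0 < e by rewrite divr_gt0//; lra.
have neN : (@lebesgue_measure R).-negligible
    ((~` [set t | c < t < d -> exists2 df, is_derive t (1 : R) f df & 0 <= df])
     `|` ([set c] `|` [set d])).
  apply: negligibleU => //.
  by apply: negligibleU; apply/negligibleP => //; exact: lebesgue_measure_set1.
have [U [oU subU muU]] := negligible_open_cover neN e_gt0.
have mU : measurable U by apply: open_measurable.
clear neN aef.
pose m (t : R) := fine (lebesgue_measure (U `&` `[c, t]%classic)).
have mfin (A : set R) : measurable A ->
    fine (lebesgue_measure (U `&` A)) <= e /\
    lebesgue_measure (U `&` A) \is a fin_num.
  move=> mA.
  have lee : (lebesgue_measure (U `&` A) <= e%:E)%E.
    by apply: le_trans muU; rewrite le_measure ?inE//; exact: measurableI.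
  have fnum : lebesgue_measure (U `&` A) \is a fin_num.
    by rewrite ge0_fin_numE// (le_lt_trans lee)// ltry.
  by split => //; rewrite -lee_fin fineK.
have mB (s t : R) : c <= s -> s <= t ->
    m t = m s + fine (lebesgue_measure (U `&` `]s, t]%classic)).
  move=> cs st; rewrite /m -fineD; last 2 first.
  - exact: (mfin _ _).2.
  - exact: (mfin _ _).2.
  congr fine; rewrite -measureU//; last 3 first.
  - exact: measurableI.
  - exact: measurableI.
  - rewrite setIACA -subset0 => x [_ [/=]]; rewrite !in_itv/= => /andP[_ xs].
    by move=> /andP[sx _]; move: (lt_le_trans sx xs); rewrite ltxx.
  by rewrite -setIUr -itv_bndbnd_setU// bnd_simp.
have mup (s t : R) : c <= s -> s <= t -> m s <= m t.
  by move=> cs st; rewrite (mB s t)// lerDl fine_ge0.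
pose h t := f t + e * t + L * m t.
have : h c <= h d.
  apply: local_ndecr cd _ => t /[dup] ctd /andP[ct td].
  have [Ut|nUt] := pselect (U t).
  - have /nbhs_ballP[r /= r0 rU] := open_nbhs_nbhs (conj oU Ut).
    apply/nbhs_ballP; exists r => //= s ts /[dup] csd /andP[cs sd].
    have key (x y : R) : c <= x -> y <= d -> x <= y ->
        (forall z, x <= z <= y -> U z) -> h x <= h y.
      move=> cx yd xy Uxy.
      have := lipf x y; rewrite cx yd (le_trans cx xy) (le_trans xy yd)/=.
      move=> /(_ isT isT); rewrite (ler0_norm (_ : x - y <= 0)); last lra.
      rewrite /h (mB x y)// (_ : U `&` _ = `]x, y]%classic); last first.
        apply/seteqP; split => z; first by case.
        rewrite /= in_itv/= => /andP[xz zy]; split; last by rewrite xz zy.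
        by apply: Uxy; rewrite (ltW xz) zy.
      rewrite lebesgue_measure_itv/= lte_fin.
      move: (xy); rewrite le_eqVlt => /orP[/eqP->|xlty].
        by rewrite ltxx/=; lra.
      rewrite xlty/= ler_norml => /andP[h1 h2].
      have : 0 <= e * (y - x) by rewrite mulr_ge0//; lra.
      lra.
    rewrite /ball/= in ts.
    split => xy; apply: key => // z /andP[z1 z2]; apply: rU; rewrite /ball/=.
    + move: ts; rewrite !ger0_norm; lra.
    + move: ts; rewrite !ler0_norm; lra.
  - have : ~ ((~` [set t | c < t < d ->
         exists2 df, is_derive t (1 : R) f df & 0 <= df]) t) /\ t <> c /\ t <> d.
      split; first by move=> q; apply/nUt/subU; left.
      by split => q; apply/nUt/subU; right; rewrite q /=; tauto.
    move=> [/contrapT /= dt [/eqP tc /eqP td']].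
    have /dt[df [drv dfE] df0] : c < t < d by rewrite !lt_neqAle ct td td' eq_sym tc.
    have : h0^-1 *: (f (h0 *: 1 + t) - f t) @[h0 --> 0^'] --> df.
      by rewrite -dfE; exact: drv.
    move=> /cvgrPdist_lt /(_ _ e_gt0) /nbhs_ballP[r /= r0 rP].
    apply/nbhs_ballP; exists r => //= s ts /andP[cs sd].
    have [->//|nst] := eqVneq s t.
    have := rP (s - t); rewrite /ball/= sub0r normrN distrC => /(_ ts).
    rewrite subr_eq0 => /(_ nst).
    rewrite /GRing.scale/= mulr1 subrK ltr_norml => /andP[_ q].
    have {}q : - e < (s - t)^-1 * (f s - f t) by lra.
    split => st.
    + have st' : s < t by rewrite lt_neqAle nst.
      rewrite -(ltr_nM2r (_ : s - t < 0)) ?subr_lt0// in q.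
      rewrite mulrAC mulVf ?subr_eq0// mul1r in q.
      have /(ler_wpM2l L0) := mup s t cs st; rewrite /h; lra.
    + have st' : t < s by rewrite lt_neqAle eq_sym nst.
      rewrite -(ltr_pM2r (_ : 0 < s - t)) ?subr_gt0// in q.
      rewrite mulrAC mulVf ?subr_eq0// mul1r in q.
      have /(ler_wpM2l L0) := mup t s ct st; rewrite /h; lra.
rewrite /h => H.
have mc : 0 <= m c by apply: fine_ge0.
have md : m d <= e by apply: (mfin _ _).1.
have := ler_wpM2l L0 mc; have := ler_wpM2l L0 md.
have -> : e0 = e * (d - c + L + 1) by rewrite /e divfK//; lra.
move=> *; lra.
Qed.

Lemma is_derive_continuous (R : realType) (f : R -> R) (x l : R) :
  is_derive x (1 : R) f l -> {for x, continuous f}.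
Proof.
by move=> [df _]; apply: differentiable_continuous; exact/derivable1_diffP.
Qed.

Lemma is_derive_affine (R : realType) (a b x : R) :
  is_derive x (1 : R) (fun y => a * y + b) a.
Proof.
have := is_deriveD (is_deriveZ a (is_derive_id x (1 : R)))
  (is_derive_cst b x (1 : R)).
by rewrite /GRing.scale/= mulr1 addr0.
Qed.

Lemma derive_ge0_ndecr (R : realType) (f df : R -> R) (c d : R) :
  (forall x, c <= x <= d -> is_derive x (1 : R) f (df x)) ->
  (forall x, c <= x <= d -> 0 <= df x) -> c <= d -> f c <= f d.
Proof.
move=> fdf df0 cd.
have cf : {within `[c, d], continuous f}.
  by apply: derivable_within_continuous => x xcd; case: (fdf x xcd).
have dfo x : x \in `]c, d[ -> is_derive x (1 : R) f (df x).
  by move=> /subset_itv_oo_cc; exact: fdf.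
have [x] := MVT_segment cd dfo cf.
rewrite in_itv/= => xcd fcd.
by rewrite -subr_ge0 fcd mulr_ge0 ?subr_ge0// df0.
Qed.

Lemma derive_gt0_incr (R : realType) (f df : R -> R) (c d : R) :
  (forall x, c <= x <= d -> is_derive x (1 : R) f (df x)) ->
  (forall x, c < x < d -> 0 < df x) -> c < d -> f c < f d.
Proof.
move=> fdf df0 cd.
have cf : {within `[c, d], continuous f}.
  by apply: derivable_within_continuous => x xcd; case: (fdf x xcd).
have dfo x : x \in `]c, d[ -> is_derive x (1 : R) f (df x).
  by move=> /subset_itv_oo_cc; exact: fdf.
have [x] := MVT cd dfo cf.
rewrite in_itv/= => xcd fcd.
by rewrite -subr_gt0 fcd mulr_gt0 ?subr_gt0// df0.
Qed.

Lemma continuous_itv_integrable (R : realType) (f : R -> R) (y z : R) :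
  continuous f -> (@lebesgue_measure R).-integrable `[y, z] (EFin \o f).
Proof.
move=> cf; apply: continuous_compact_integrable; first exact: segment_compact.
exact: continuous_subspaceT.
Qed.

Lemma Rintegral_derive (R : realType) (F f : R -> R) (y z : R) :
  (forall x, is_derive x (1 : R) F (f x)) -> continuous f -> y <= z ->
  \int[@lebesgue_measure R]_(x in `[y, z]) f x = F z - F y.
Proof.
move=> Ff cf; rewrite le_eqVlt => /orP[/eqP->|yz].
  by rewrite set_itv1 Rintegral_set1 subrr.
have cF x : {for x, continuous F} by exact: (is_derive_continuous (Ff x)).
rewrite /Rintegral (@continuous_FTC2 _ f F)//=.
- exact: continuous_subspaceT.
- split => [x _| |].
  + by case: (Ff x) => h _; exact: h.
  + by apply: cvg_at_right_filter; exact: cF.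
  + by apply: cvg_at_left_filter; exact: cF.
- by move=> x _; rewrite derive1E; case: (Ff x).
Qed.

(** The integral from - N to x, corrected so as to vanish at 0, does not depend on N;
   letting N depend on x makes it a primitive on the whole line. *)
Lemma continuous_primitive (R : realType) (f : R -> R) :
  continuous f -> exists F : R -> R, forall x, is_derive x (1 : R) F (f x).
Proof.
move=> cf; pose G N x := \int[@lebesgue_measure R]_(s in `[- N, x]) f s.
have GE (N M x : R) : - N < x -> 0 < N -> N <= M ->
    G N x - G N 0 = G M x - G M 0.
  move=> Nx N0 NM.
  have e z : - N < z -> G M z = G M (- N) + G N z.
    move=> Nz; rewrite /G.
    have h := @Rintegral_itvB R f (BLeft (- M)) (BRight z) (- N)
      (continuous_itv_integrable _ _ cf).
    rewrite !bnd_simp in h.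
    rewrite -[X in _ = _ + X]Rintegral_itv_obnd_cbnd; last first.
      by apply: integrableS (continuous_itv_integrable (- N) z cf) => //;
        apply: subset_itvr; rewrite bnd_simp.
    by rewrite -h; lra.
  by rewrite (e x)// (e 0); lra.
exists (fun x => G (`|x| + 1) x - G (`|x| + 1) 0) => x.
set N := `|x| + 3.
have N0 : 0 < N by rewrite /N; have := normr_ge0 x; lra.
have xN : - N < x by rewrite /N; have := ler_norm (- x); rewrite normrN; lra.
have xx1 : x < x + 1 by lra.
have [dG GE1] := @continuous_FTC1_closed R f (- N) x (x + 1) xx1
  (continuous_itv_integrable _ _ cf) xN (cf x).
have dG1 : is_derive x (1 : R) (fun y => G N y - G N 0) (f x).
  have : is_derive x (1 : R) (G N) (f x).
    by constructor; [exact: dG | rewrite -GE1 derive1E].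
  move=> h.
  have -> : (fun y => G N y - G N 0) = G N - cst (G N 0) by [].
  by have := is_deriveB h (is_derive_cst (G N 0) x (1 : R)); rewrite subr0.
apply: near_eq_is_derive dG1 => //.
near=> y.
have xy : `|x - y| < 1 by near: y; apply: nbhsx_ballx.
have yx : `|y| < `|x| + 1.
  rewrite -[y](subrK x) (le_lt_trans (ler_normD _ _))// distrC; lra.
have y0 := ler_norm (- y); rewrite normrN in y0.
have y1 := normr_ge0 y.
by apply/esym/GE; rewrite /N; lra.
Unshelve. all: by end_near. Qed.

Lemma aeS (R : realType) (A B : R -> Prop) :
  {ae (@lebesgue_measure R), forall t, A t} -> (forall t, A t -> B t) ->
  {ae (@lebesgue_measure R), forall t, B t}.
Proof.
move=> + AB; apply: filterS AB; exact: (ae_filter_ringOfSetsType lebesgue_measure).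
Qed.

Lemma aeI (R : realType) (A B : R -> Prop) :
  {ae (@lebesgue_measure R), forall t, A t} ->
  {ae (@lebesgue_measure R), forall t, B t} ->
  {ae (@lebesgue_measure R), forall t, A t /\ B t}.
Proof.
by apply: (@filterS2 _ _ (ae_filter_ringOfSetsType lebesgue_measure) A B).
Qed.

Lemma ae_slope_le (R : realType) (f : R -> R) (L M c d : R) :
  (forall s t, c <= s <= d -> c <= t <= d -> `|f s - f t| <= L * `|s - t|) ->
  {ae (@lebesgue_measure R), forall t, c < t < d ->
     exists2 df, is_derive t (1 : R) f df & df <= M} ->
  c <= d -> f d - f c <= M * (d - c).
Proof.
move=> lipf aef cd.
pose g t := M * t - f t.
suff : g c <= g d by rewrite /g; lra.
apply: (@ae_ndecr _ g (`|M| + L)) cd => [s t cs ct|].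
  rewrite /g (_ : _ - _ = M * (s - t) - (f s - f t)); last by ring.
  by rewrite (le_trans (ler_normB _ _))// mulrDl normrM lerD// lipf.
apply: (aeS aef) => t h /h[df fdf dfM].
exists (M - df); last by rewrite subr_ge0.
have -> : g = M \*: id - f by [].
by have := is_deriveB (is_deriveZ M (is_derive_id t (1 : R))) fdf; rewrite /GRing.scale/= mulr1.
Qed.

Lemma ae_slope_ge (R : realType) (f : R -> R) (L M c d : R) :
  (forall s t, c <= s <= d -> c <= t <= d -> `|f s - f t| <= L * `|s - t|) ->
  {ae (@lebesgue_measure R), forall t, c < t < d ->
     exists2 df, is_derive t (1 : R) f df & M <= df} ->
  c <= d -> M * (d - c) <= f d - f c.
Proof.
move=> lipf aef cd.
suff : (- f) d - (- f) c <= - M * (d - c) by rewrite mulNr !fctE; lra.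
apply: (@ae_slope_le _ _ L) cd => [s t cs ct|].
  by rewrite -opprD normrN lipf.
apply: (aeS aef) => t h /h[df fdf dfM].
by exists (- df); [exact: is_deriveN | rewrite lerN2].
Qed.

(** After the last time at which f is nonpositive, f could only decrease. *)
Lemma ae_barrier (R : realType) (f : R -> R) (L c d : R) :
  (forall s t, c <= s <= d -> c <= t <= d -> `|f s - f t| <= L * `|s - t|) ->
  {ae (@lebesgue_measure R), forall t, c < t < d -> 0 < f t ->
     exists2 df, is_derive t (1 : R) f df & df <= 0} ->
  c <= d -> f c <= 0 -> f d <= 0.
Proof.
move=> lipf aef cd fc0; rewrite leNgt; apply/negP => fd0.
pose S := [set t | c <= t <= d /\ f t <= 0].
have Sc : S c by split=> //; rewrite lexx cd.
have Sub : ubound S d by move=> t [/andP[_ ?] _].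
have supS : has_sup S by split; [exists c | exists d].
set t0 := sup S.
have ct0 : c <= t0 by apply: (sup_upper_bound supS).
have t0d : t0 <= d by apply: ge_sup => //; exists c.
have L0 : 0 <= L.
  have ncd : c - d != 0 by rewrite subr_eq0; apply/eqP => cdE; move: fd0; rewrite -cdE; lra.
  have := lipf c d; rewrite !lexx cd => /(_ isT isT) h.
  have := le_trans (normr_ge0 _) h.
  by rewrite pmulr_lge0// normr_gt0.
have ft0 : f t0 <= 0.
  apply/ler_addgt0Pr => e e0; rewrite add0r.
  have e1 : 0 < e / (L + 1) by rewrite divr_gt0//; lra.
  have [s [/andP[cs sd] hs] ts] := @sup_adherent _ S _ e1 supS.
  have st0 : s <= t0 by apply: (sup_upper_bound supS); split => //; rewrite cs sd.
  have := lipf t0 s; rewrite cs sd ct0 t0d => /(_ isT isT).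
  rewrite (ger0_norm (_ : 0 <= t0 - s)) ?subr_ge0// => h.
  have h2 := le_trans (ler_norm _) h.
  rewrite -/t0 in ts.
  have h3 : L * (t0 - s) <= (L + 1) * (e / (L + 1)).
    by apply: ler_pM => //; lra.
  by rewrite mulrCA divff in h3; lra.
have : f d - f t0 <= 0 * (d - t0).
  apply: (@ae_slope_le _ f L) => // [s t /andP[s1 s2] /andP[t1 t2]|].
    by apply: lipf; lra.
  apply: (aeS aef) => t h /andP[t0t td]; apply: h; first lra.
  rewrite ltNge; apply/negP => ft.
  have : S t by split => //; lra.
  by move=> /(sup_upper_bound supS); rewrite -/t0; lra.
by lra.
Qed.

(** * The effective speed of a periodic medium *)

Lemma periodic_reduce (R : realType) (f : R -> R) (P x : R) :
  0 < P -> periodic f P -> exists2 y, 0 <= y <= P & f x = f y.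
Proof.
move=> P0 pf.
have fz (n : nat) z : f (z - P *+ n) = f z.
  by rewrite -[in RHS](subrK (P *+ n) z) (periodicn pf).
pose k := Num.floor (x / P).
have := floor_itv (x / P); rewrite -/k => /andP[].
rewrite ler_pdivlMr// ltr_pdivrMr// => k1 k2.
exists (x - k%:~R * P); first by move: k2; rewrite intrD mulrDl mul1r; lra.
rewrite -[LHS]/(f x); move: k {k1 k2} => [] n; first by rewrite mulr_natl fz.
by rewrite NegzE mulrNz mulNr opprK mulr_natl (periodicn pf).
Qed.

Section speed.
Context {R : realType}.
Implicit Types (beta : R -> R) (q P : R).

Definition oscillating beta P :=
  [/\ 0 < P, periodic beta P &
      exists2 K, 0 < K & forall y z, `|beta y - beta z| <= K * `|y - z|].

(** A point driven at velocity q - beta crosses a period in the time given by the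
   integral, unless q - beta vanishes somewhere and pins it. *)
Definition speed beta P q : R :=
  if `[< exists y, beta y = q >] then 0
  else P / \int[@lebesgue_measure R]_(s in `[0, P]) (q - beta s)^-1.

Lemma oscillating_continuous beta P : oscillating beta P -> continuous beta.
Proof.
move=> [_ _ [K K0 Kl]] x; apply/cvgrPdist_lt => e e0; near=> y.
rewrite (le_lt_trans (Kl _ _))// -ltr_pdivlMl//.
by near: y; apply/nbhs_ballP; exists (K^-1 * e) => //=; rewrite mulr_gt0// invr_gt0.
Unshelve. all: by end_near. Qed.

Lemma oscillating_max beta P : oscillating beta P ->
  exists y, forall x, beta x <= beta y.
Proof.
move=> h; have [P0 pb _] := h.
have [y _ ymax] := @EVT_max R beta 0 P (ltW P0)
  (continuous_subspaceT (oscillating_continuous h)).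
by exists y => x; have [z zP ->] := periodic_reduce x P0 pb; apply: ymax; rewrite in_itv.
Qed.

Lemma oscillatingN beta P : oscillating beta P -> oscillating (\- beta) P.
Proof.
move=> [P0 pb [K K0 Kl]]; split=> //; first by move=> u /=; rewrite pb.
by exists K => // y z; rewrite /= -opprD normrN.
Qed.

Lemma oscillating_min beta P : oscillating beta P ->
  exists y, forall x, beta y <= beta x.
Proof.
by move=> /oscillatingN/oscillating_max[y hy]; exists y => x; rewrite -lerN2 hy.
Qed.

Lemma unpinnedP beta P q : oscillating beta P -> ~ (exists y, beta y = q) ->
  exists2 m, 0 < m & (forall y, m <= q - beta y) \/ (forall y, m <= beta y - q).
Proof.
move=> h nq.
have [y ymax] := oscillating_max h; have [z zmin] := oscillating_min h.
have [qy|yq] := leP q (beta y); last first.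
  by exists (q - beta y); [rewrite subr_gt0 | left => x; have := ymax x; lra].
have [zq|qz] := leP (beta z) q; last first.
  by exists (beta z - q); [rewrite subr_gt0 | right => x; have := zmin x; lra].
exfalso; apply: nq.
have cb := oscillating_continuous h.
wlog: / True by exact.
have [yz|zy] := leP y z.
- have [||c _ <-] := @IVT R beta y z q yz; last by exists c.
  + exact: continuous_subspaceT.
  + by rewrite ge_min le_max zq qy !orbT.
- have [||c _ <-] := @IVT R beta z y q (ltW zy); last by exists c.
  + exact: continuous_subspaceT.
  + by rewrite ge_min le_max zq qy !orbT.
Qed.

(** T y - T x is the time that a solution of x' = q - beta x takes from x to y. It is
   the sum of a linear and a periodic function, so that, multiplied by the speed, it
   stays within a bounded distance of the identity. *)
Lemma travel_time beta P q : oscillating beta P -> ~ (exists y, beta y = q) ->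
  exists T : R -> R, [/\ forall x, is_derive x (1 : R) T (q - beta x)^-1,
    T P - T 0 = P / speed beta P q,
    speed beta P q != 0,
    forall x, T (x + P) - T x = T P - T 0 &
    exists C, forall x, `|speed beta P q * T x - x| <= C].
Proof.
move=> h nq; have [P0 pb _] := h.
have cb := oscillating_continuous h.
have nz x : q - beta x != 0.
  by rewrite subr_eq0; apply/eqP => qE; apply: nq; exists x.
have cf : continuous (fun x => (q - beta x)^-1).
  move=> x; apply: cvgV => //; apply: cvgB; [exact: cvg_cst | exact: cb].
have [T dT] := continuous_primitive cf.
have sE : speed beta P q = P / (T P - T 0).
  rewrite /speed (_ : `[< _ >] = false); last by apply/asboolP.
  by rewrite (Rintegral_derive dT cf (ltW P0)).
have [m m0 mq] := unpinnedP h nq.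
have sgn : (0 < T P - T 0 /\ forall x, 0 < (q - beta x)^-1) \/
           (T P - T 0 < 0 /\ forall x, (q - beta x)^-1 < 0).
  case: mq => mq.
    have sg x : 0 < (q - beta x)^-1 by rewrite invr_gt0 (lt_le_trans m0).
    left; split=> //; rewrite subr_gt0; apply: (derive_gt0_incr (fun x _ => dT x)) => //.
  have sg x : (q - beta x)^-1 < 0 by rewrite invr_lt0; have := mq x; lra.
  right; split=> //; rewrite subr_lt0 -ltrN2.
  apply: (@derive_gt0_incr _ (- T) (fun x => - (q - beta x)^-1)) => //.
  by move=> x _; rewrite oppr_gt0.
have TP0 : T P - T 0 != 0 by case: sgn => -[s _]; [rewrite gt_eqF | rewrite lt_eqF].
have s0 : speed beta P q != 0 by rewrite sE mulf_neq0 ?invr_eq0// gt_eqF.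
have pT x : T (x + P) - T x = T P - T 0.
  have dTP y : is_derive y (1 : R) (fun z => T (z + P) - T z) 0.
    have d1 : is_derive y (1 : R) (T \o (fun z => z + P)) ((q - beta y)^-1 * 1).
      apply: is_derive1_comp; first by rewrite -[beta y]pb; exact: dT.
      by have := is_deriveD (is_derive_id y (1:R)) (is_derive_cst P y (1 : R)); rewrite addr0.
    by have := is_deriveB d1 (dT y); rewrite mulr1 subrr.
  by rewrite (is_derive_0_is_cst x 0 dTP) add0r.
exists T; split => //.
- by rewrite sE invf_div mulrCA divff ?mulr1// gt_eqF.
- pose D x := speed beta P q * T x - x.
  have dD x : is_derive x (1 : R) D (speed beta P q * (q - beta x)^-1 - 1).
    by apply: is_deriveB; apply: is_deriveZ.
  have pD : periodic D P.
    move=> x; rewrite /D; have -> : T (x + P) = T x + (T P - T 0) by rewrite -(pT x); ring.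
    have : speed beta P q * (T P - T 0) = P by rewrite sE divfK.
    lra.
  have cD : continuous D by move=> x; exact: (is_derive_continuous (dD x)).
  have [c1 _ c1P] := @EVT_max R D 0 P (ltW P0) (continuous_subspaceT cD).
  have [c2 _ c2P] := @EVT_min R D 0 P (ltW P0) (continuous_subspaceT cD).
  exists (`|D c1| + `|D c2|) => x; rewrite -/(D x).
  have [y yP ->] := periodic_reduce x P0 pD.
  have := c1P y; have := c2P y; rewrite in_itv/= => /(_ yP) h1 /(_ yP) h2.
  have := ler_norm (D c1); have := ler_norm (- D c2); rewrite normrN.
  have := normr_ge0 (D c1); have := normr_ge0 (D c2).
  by rewrite ler_norml; lra.
Qed.

Lemma speed_pinned beta P y : speed beta P (beta y) = 0.
Proof. by rewrite /speed ifT//; apply/asboolP; exists y. Qed.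

Variant speed_spec beta P q : R -> Prop :=
| SpeedPinned y of beta y = q : speed_spec beta P q 0
| SpeedPos m of 0 < m & 0 < speed beta P q & (forall y, m <= q - beta y) :
    speed_spec beta P q (speed beta P q)
| SpeedNeg m of 0 < m & speed beta P q < 0 & (forall y, m <= beta y - q) :
    speed_spec beta P q (speed beta P q).

Lemma speedP beta P q : oscillating beta P ->
  speed_spec beta P q (speed beta P q).
Proof.
move=> h; have [P0 _ _] := h.
have [[y <-]|nq] := pselect (exists y, beta y = q).
  by rewrite speed_pinned; exact: SpeedPinned.
have [m m0 mq] := unpinnedP h nq.
have [T [dT TP s0 _ _]] := travel_time h nq.
have PT : speed beta P q = P / (T P - T 0) by rewrite TP invf_div mulrCA divff ?mulr1// gt_eqF.
case: mq => mq; [apply: (SpeedPos m0 _ mq) | apply: (SpeedNeg m0 _ mq)]; rewrite PT.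
  rewrite divr_gt0// subr_gt0; apply: (derive_gt0_incr (fun x _ => dT x)) => //.
  by move=> x _; rewrite invr_gt0 (lt_le_trans m0).
rewrite pmulr_rlt0// invr_lt0 subr_lt0 -ltrN2.
apply: (@derive_gt0_incr _ (- T) (fun x => - (q - beta x)^-1)) => //.
by move=> x _; rewrite oppr_gt0 invr_lt0; have := mq x; lra.
Qed.

(** The travel time over a period is monotone in the velocity field as long as the
   field keeps its sign. *)
Lemma speed_cmp beta P q q' k : oscillating beta P -> 0 < k ->
  (forall x, q' - beta x <= k * (q - beta x)) ->
  (forall x, 0 < q' - beta x) \/ (forall x, q - beta x < 0) ->
  speed beta P q' <= k * speed beta P q.
Proof.
move=> h k0 qq' sgn; have [P0 _ _] := h.
have sgn2 x : (0 < q' - beta x /\ 0 < q - beta x) \/ (q' - beta x < 0 /\ q - beta x < 0).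
  have := qq' x; case: sgn => /(_ x) s1 s2; [left|right]; split => //.
    by rewrite -(pmulr_rgt0 _ k0) (lt_le_trans s1).
  by rewrite (le_lt_trans s2)// pmulr_rlt0.
have nq : ~ (exists y, beta y = q).
  by move=> [y yq]; have := sgn2 y; rewrite yq subrr ltxx => -[[]|[]].
have nq' : ~ (exists y, beta y = q').
  by move=> [y yq]; have := sgn2 y; rewrite yq subrr ltxx => -[[]|[]].
have [T [dT TP s0 _ _]] := travel_time h nq.
have [T' [dT' TP' s0' _ _]] := travel_time h nq'.
have dG x : is_derive x (1 : R) (T' - k^-1 \*: T)
    ((q' - beta x)^-1 - k^-1 * (q - beta x)^-1).
  exact: is_deriveB.
have : (T' - k^-1 \*: T) 0 <= (T' - k^-1 \*: T) P.
  apply: (derive_ge0_ndecr (fun x _ => dG x)) (ltW P0) => x _.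
  rewrite subr_ge0 -invfM; case: (sgn2 x) => -[s1 s2].
    by rewrite lef_pV2 ?posrE ?mulr_gt0.
  by rewrite lef_nV2 ?negrE ?pmulr_rlt0.
rewrite !fctE => G; have {}G : T' 0 - k^-1 * T 0 <= T' P - k^-1 * T P := G.
have {G} : k^-1 * (P / speed beta P q) <= P / speed beta P q'.
  by rewrite -TP -TP'; lra.
have ss : (0 < speed beta P q' /\ 0 < speed beta P q) \/
          (speed beta P q' < 0 /\ speed beta P q < 0).
  have s := sgn2 0.
  case: (speedP q h) => [y yq|m m0 sp mq|m m0 sp mq]; first by exfalso; apply: nq; exists y.
    left; split => //; case: (speedP q' h) => [y yq|//|m' m'0 _ /(_ 0)]; first by exfalso; apply: nq'; exists y.
    by have := mq 0; case: s => -[]; lra.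
  right; split => //; case: (speedP q' h) => [y yq|m' m'0 _ /(_ 0)|//]; first by exfalso; apply: nq'; exists y.
  by have := mq 0; case: s => -[]; lra.
rewrite mulrCA ler_pM2l// -invfM; case: ss => -[s1 s2].
  by rewrite lef_pV2 ?posrE ?mulr_gt0.
by rewrite lef_nV2 ?negrE ?pmulr_rlt0.
Qed.

Lemma speed_ndecr beta P q q' : oscillating beta P -> q <= q' ->
  speed beta P q <= speed beta P q'.
Proof.
move=> h qq'.
have cmp : (forall x, 0 < q - beta x) \/ (forall x, q' - beta x < 0) ->
    speed beta P q <= speed beta P q'.
  move=> sg; rewrite -[leRHS]mul1r; apply: speed_cmp => // x.
  by rewrite mul1r lerD2r.
case: (speedP q h) cmp => [y yq|m m0 sp mq|m m0 sp mq] cmp.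
- case: (speedP q' h) cmp => [//|m m0 /ltW //|m m0 _ /(_ y)]; lra.
- by apply: cmp; left => x; rewrite (lt_le_trans m0).
- case: (speedP q' h) cmp => [? _ _|m' m'0 s' _ _|m' m'0 s' mq' cmp].
  + exact: ltW.
  + exact/ltW/(lt_trans sp).
  + by apply: cmp; right => x; have := mq' x; lra.
Qed.

Lemma speedN beta P q : oscillating beta P ->
  speed (\- beta) P (- q) = - speed beta P q.
Proof.
move=> h; have hN := oscillatingN h; have [P0 _ _] := h.
have [[y <-]|nq] := pselect (exists y, beta y = q).
  by rewrite (speed_pinned (\- beta)) speed_pinned oppr0.
have nqN : ~ exists y, (\- beta) y = - q.
  by move=> [y /oppr_inj yq]; apply: nq; exists y.
have [T [dT TP s0 _ _]] := travel_time h nq.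
have [T' [dT' TP' s0' _ _]] := travel_time hN nqN.
have dG x : is_derive x (1 : R) (T' + T) 0.
  have := is_deriveD (dT' x) (dT x).
  have -> : - q - (\- beta) x = - (q - beta x) by rewrite /=; ring.
  by rewrite invrN addNr.
have := is_derive_0_is_cst P 0 dG; rewrite !fctE => E.
have {E} : P / speed (\- beta) P (- q) = - (P / speed beta P q) by rewrite -TP -TP'; lra.
by rewrite -mulrN => /(mulfI (lt0r_neq0 P0)); rewrite -invrN => /invr_inj.
Qed.

(** If q is pinned, the approximation comes from above the maximum of beta: there the
   travel time blows up at least logarithmically, because beta is Lipschitz, and the
   speed tends to 0. *)
Lemma speed_right_approx beta P q eta : oscillating beta P -> 0 < eta ->
  exists q', [/\ q < q', ~ (exists y, beta y = q') &
    speed beta P q' <= speed beta P q + eta].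
Proof.
move=> h eta0; have [P0 pb [K K0 Kl]] := h.
case: (speedP q h) => [y yq|m m0 sp mq|m m0 sp mq].
- have [y0 y0m] := oscillating_max h.
  (* for this d the logarithmic lower bound of the travel time is at least P / eta *)
  have [d dE] : exists d, d = K * P * expR (- (K * P / eta)) by eexists.
  have d0 : 0 < d by rewrite dE !mulr_gt0// expR_gt0.
  have nq : ~ (exists y, beta y = beta y0 + d).
    by move=> [z zE]; have := y0m z; lra.
  exists (beta y0 + d); split => //; first by rewrite -yq; have := y0m y; lra.
  rewrite add0r.
  have [T [dT TP s0 pT _]] := travel_time h nq.
  have sp : 0 < speed beta P (beta y0 + d).
    case: (speedP (beta y0 + d) h) => [z zE|//|m m0 _ /(_ y0)]; last lra.
    by exfalso; apply: nq; exists z.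
  pose G z := T z - K^-1 * ln (d + K * (z - y0)).
  have dG z : y0 <= z <= y0 + P -> is_derive z (1 : R) G
      ((beta y0 + d - beta z)^-1 - K^-1 * ((d + K * (z - y0))^-1 * K)).
    move=> /andP[z1 z2].
    have pos : 0 < d + K * (z - y0) by rewrite ltr_pwDl// mulr_ge0 ?(ltW K0)//; lra.
    have dI : is_derive z (1 : R) (fun z => d + K * (z - y0)) K.
      have -> : (fun z => d + K * (z - y0)) = (fun z => K * z + (d - K * y0)).
        by apply/funext => t; ring.
      exact: is_derive_affine.
    have dL := is_derive1_comp (g := fun z => d + K * (z - y0)) (is_derive1_ln pos) dI.
    exact: (is_deriveB (dT z) (is_deriveZ K^-1 dL)).
  have : G y0 <= G (y0 + P).
    apply: (derive_ge0_ndecr dG); last by lra.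
    move=> z /andP[z1 z2]; rewrite subr_ge0 mulrCA mulVf ?mulr1 ?gt_eqF//.
    have := Kl y0 z; rewrite ler_norml => /andP[_]; rewrite ler0_norm; last lra.
    move=> KL; have := y0m z => bz.
    by rewrite lef_pV2 ?posrE; lra.
  rewrite /G subrr mulr0 addr0 (_ : y0 + P - y0 = P); last by ring.
  have -> : T (y0 + P) = T y0 + P / speed beta P (beta y0 + d) by rewrite -TP -(pT y0); ring.
  have lnE : ln d + K * P / eta <= ln (d + K * P).
    have dKP : 0 < d + K * P by rewrite addr_gt0 ?mulr_gt0.
    have e0 : 0 < expR (K * P / eta) by rewrite expR_gt0.
    rewrite -[X in _ + X]expRK -lnM ?posrE// ler_ln ?posrE ?mulr_gt0 ?expR_gt0//.
    by rewrite {1}dE -[leLHS]mulrA -expRD addNr expR0 mulr1; lra.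
  have Ki : 0 < K^-1 by rewrite invr_gt0.
  move=> H.
  have {H lnE} : K^-1 * (K * P / eta) <= P / speed beta P (beta y0 + d).
    have := ler_wpM2l (ltW Ki) lnE; rewrite mulrDr; lra.
  rewrite -!mulrA mulKf ?gt_eqF// ler_pM2l// lef_pV2 ?posrE//.
- have s1 : 0 < speed beta P q + 1 by lra.
  have [d dE] : exists d, d = m * eta / (speed beta P q + 1) by eexists.
  have d0 : 0 < d by rewrite dE divr_gt0 ?mulr_gt0.
  exists (q + d).
  split; first by lra.
    by move=> [y yE]; have := mq y; lra.
  apply: (@le_trans _ _ ((1 + d / m) * speed beta P q)).
    apply: speed_cmp => //; first by rewrite addr_gt0 ?divr_gt0.
    + move=> x; have : d / m * m <= d / m * (q - beta x).
        by rewrite ler_pM2l ?divr_gt0.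
      rewrite divfK ?gt_eqF//; lra.
    + by left => x; have := mq x; lra.
  have dmE : d / m = eta / (speed beta P q + 1) by rewrite dE; field; rewrite !gt_eqF.
  rewrite mulrDl mul1r lerD2l dmE mulrAC -mulrA -[leRHS]mulr1 ler_pM2l//.
  by rewrite ler_pdivrMr//; lra.
- have s1 : 0 < 1 - speed beta P q by lra.
  pose d := Num.min (m / 2) (m * eta / (1 - speed beta P q)).
  have d0 : 0 < d by rewrite lt_min !divr_gt0 ?mulr_gt0.
  have dm : d <= m / 2 by rewrite ge_min lexx.
  exists (q + d); split; first by lra.
    by move=> [y yE]; have := mq y; lra.
  have dm1 : d / m <= 1 / 2 by rewrite ler_pdivrMr//; lra.
  apply: (@le_trans _ _ ((1 - d / m) * speed beta P q)).
    apply: speed_cmp => //; first by lra.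
    + move=> x; have : d / m * m <= d / m * (beta x - q).
        by rewrite ler_pM2l ?divr_gt0.
      rewrite divfK ?gt_eqF//; lra.
    + by right => x; have := mq x; lra.
  rewrite mulrBl mul1r lerD2l -mulrN.
  have : d / m <= eta / (1 - speed beta P q).
    rewrite ler_pdivrMr// (le_trans (_ : _ <= m * eta / (1 - speed beta P q)))//.
      by rewrite ge_min lexx orbT.
    by rewrite -mulrA mulrC.
  rewrite ler_pdivlMr// => H.
  have dm0 : 0 < d / m by rewrite divr_gt0.
  lra.
Qed.

Lemma speed_left_approx beta P q eta : oscillating beta P -> 0 < eta ->
  exists q', [/\ q' < q, ~ (exists y, beta y = q') &
    speed beta P q - eta <= speed beta P q'].
Proof.
move=> h eta0; have [q' [qq' nq' sq]] := speed_right_approx (- q) (oscillatingN h) eta0.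
exists (- q'); split; first by rewrite ltrNl.
  by move=> [y yE]; apply: nq'; exists y; rewrite /= yE opprK.
by have := speedN (- q') h; rewrite opprK speedN// in sq * => E; rewrite E in sq; lra.
Qed.

(** The derivative of sg * r * e * T (x / e), where r is the speed, is r times the ratio
   of sg * x' to q - beta, and r has the sign of q - beta. So this clock advances at
   least (or at most) at rate r, and it stays within O(e) of sg * x. The sign sg allows
   for both contact points of a drop. *)
Lemma displacement_unpinned beta P q : oscillating beta P ->
  ~ (exists y, beta y = q) ->
  exists C, forall (e sg c d L : R) (x : R -> R), 0 < e -> c <= d -> `|sg| = 1 ->
    (forall s t, c <= s <= d -> c <= t <= d -> `|x s - x t| <= L * `|s - t|) ->
    ({ae (@lebesgue_measure R), forall t, c < t < d ->
       exists2 dx, is_derive t (1 : R) x dx & sg * dx <= q - beta (x t / e)} ->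
     sg * (x d - x c) <= speed beta P q * (d - c) + C * e) /\
    ({ae (@lebesgue_measure R), forall t, c < t < d ->
       exists2 dx, is_derive t (1 : R) x dx & q - beta (x t / e) <= sg * dx} ->
     speed beta P q * (d - c) - C * e <= sg * (x d - x c)).
Proof.
move=> h nq; have [P0 _ _] := h.
have [T [dT TP s0 _ [C CT]]] := travel_time h nq.
set r := speed beta P q in s0 CT *.
exists (2 * C) => e sg c d L x e0 cd sg1 lipx.
have en0 : e != 0 by rewrite gt_eqF.
have rT y : 0 <= r * (q - beta y)^-1.
  rewrite /r; case: (speedP q h) => [? _|m m0 sp mq|m m0 sp mq].
  - by rewrite mul0r.
  - by rewrite mulr_ge0 ?invr_ge0// ltW// (lt_le_trans m0).
  - by rewrite mulr_le0// ?invr_le0 ltW//; have := mq y; lra.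
have [m m0 mq] := unpinnedP h nq.
have Tb y : `|(q - beta y)^-1| <= m^-1.
  have mn : m <= `|q - beta y|.
    by case: mq => /(_ y) mq; [|rewrite distrC]; rewrite ler_normr mq.
  by rewrite normfV lef_pV2 ?posrE// (lt_le_trans m0).
pose psi t := sg * (r * (e * T (x t / e))).
have TL y z : `|T y - T z| <= m^-1 * `|y - z|.
  wlog yz : y z / z <= y.
    by move=> H; case: (leP z y) => [/H//|/ltW/H]; rewrite distrC [in leRHS]distrC.
  have [w _ ->] := MVT_segment yz (fun x _ => dT x)
    (continuous_subspaceT (fun x => is_derive_continuous (dT x))).
  by rewrite normrM ler_wpM2r.
have psiL s t : c <= s <= d -> c <= t <= d ->
    `|psi s - psi t| <= (`|r| * m^-1 * L) * `|s - t|.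
  move=> cs ct; rewrite /psi -!mulrBr !normrM sg1 mul1r -!mulrA ler_wpM2l//.
  rewrite (gtr0_norm e0) (le_trans (ler_wpM2l (ltW e0) (TL _ _)))//.
  rewrite -mulrBl normrM normfV (gtr0_norm e0) [leLHS](_ : _ = m^-1 * `|x s - x t|).
    by rewrite ler_wpM2l ?invr_ge0 ?(ltW m0)// lipx.
  by field; rewrite gt_eqF.
have dpsi t dx : is_derive t (1 : R) x dx ->
    is_derive t (1 : R) psi (r * (q - beta (x t / e))^-1 * (sg * dx)).
  move=> dxt.
  have d1 : is_derive t (1 : R) (fun s => x s / e) (e^-1 * dx).
    have -> : (fun s => x s / e) = e^-1 \*: x by apply/funext => s; rewrite mulrC.
    exact: is_deriveZ.
  have := is_deriveZ sg (is_deriveZ r (is_deriveZ e (is_derive1_comp (g := fun s => x s / e) (dT _) d1))).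
  rewrite -![_ *: (_ : R)]/(_ * _) => D.
  have -> : r * (q - beta (x t / e))^-1 * (sg * dx) =
    sg * (r * (e * ((q - beta (x t / e))^-1 * (e^-1 * dx)))) by set w := _^-1; field.
  exact: D.
have psiE t : `|psi t - sg * x t| <= C * e.
  rewrite /psi -mulrBr normrM sg1 mul1r.
  have -> : r * (e * T (x t / e)) - x t = e * (r * T (x t / e) - x t / e).
    by field.
  by rewrite normrM gtr0_norm// mulrC ler_wpM2r// ltW.
have bd := psiE d; have bc := psiE c.
rewrite !ler_norml in bd bc.
split=> aex.
  have : psi d - psi c <= r * (d - c).
    apply: (ae_slope_le psiL) cd; apply: (aeS aex) => t ht /ht[dx dxt dxq].
    exists (r * (q - beta (x t / e))^-1 * (sg * dx)); first exact: dpsi.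
    apply: (le_trans (ler_wpM2l (rT _) dxq)).
    by rewrite mulfVK// subr_eq0; apply/eqP => E; apply: nq; exists (x t / e).
  lra.
have : r * (d - c) <= psi d - psi c.
  apply: (ae_slope_ge psiL) cd; apply: (aeS aex) => t ht /ht[dx dxt dxq].
  exists (r * (q - beta (x t / e))^-1 * (sg * dx)); first exact: dpsi.
  apply: (le_trans _ (ler_wpM2l (rT _) dxq)).
  by rewrite mulfVK// subr_eq0; apply/eqP => E; apply: nq; exists (x t / e).
lra.
Qed.

(** A pinned q is replaced by an unpinned one of nearly the same speed. *)
Lemma displacement_le beta P q eta : oscillating beta P -> 0 < eta ->
  exists C, forall (e sg c d L : R) (x : R -> R), 0 < e -> c <= d -> `|sg| = 1 ->
    (forall s t, c <= s <= d -> c <= t <= d -> `|x s - x t| <= L * `|s - t|) ->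
    {ae (@lebesgue_measure R), forall t, c < t < d ->
       exists2 dx, is_derive t (1 : R) x dx & sg * dx <= q - beta (x t / e)} ->
    sg * (x d - x c) <= (speed beta P q + eta) * (d - c) + C * e.
Proof.
move=> h eta0; have [q' [qq' nq' sq]] := speed_right_approx q h eta0.
have [C CP] := displacement_unpinned h nq'.
exists C => e sg c d L x e0 cd sg1 lipx aex.
have [+ _] := CP e sg c d L x e0 cd sg1 lipx.
have aex' : {ae (@lebesgue_measure R), forall t, c < t < d ->
       exists2 dx, is_derive t (1 : R) x dx & sg * dx <= q' - beta (x t / e)}.
  by apply: (aeS aex) => t ht /ht[dx dxt dxq]; exists dx => //; lra.
move=> /(_ aex') H; apply: (le_trans H).
by rewrite lerD2r ler_wpM2r// subr_ge0.
Qed.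

Lemma displacement_ge beta P q eta : oscillating beta P -> 0 < eta ->
  exists C, forall (e sg c d L : R) (x : R -> R), 0 < e -> c <= d -> `|sg| = 1 ->
    (forall s t, c <= s <= d -> c <= t <= d -> `|x s - x t| <= L * `|s - t|) ->
    {ae (@lebesgue_measure R), forall t, c < t < d ->
       exists2 dx, is_derive t (1 : R) x dx & q - beta (x t / e) <= sg * dx} ->
    (speed beta P q - eta) * (d - c) - C * e <= sg * (x d - x c).
Proof.
move=> h eta0; have [q' [qq' nq' sq]] := speed_left_approx q h eta0.
have [C CP] := displacement_unpinned h nq'.
exists C => e sg c d L x e0 cd sg1 lipx aex.
have [_] := CP e sg c d L x e0 cd sg1 lipx.
have aex' : {ae (@lebesgue_measure R), forall t, c < t < d ->
       exists2 dx, is_derive t (1 : R) x dx & q' - beta (x t / e) <= sg * dx}.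
  by apply: (aeS aex) => t ht /ht[dx dxt dxq]; exists dx => //; lra.
move=> /(_ aex') H; apply: (le_trans _ H).
by rewrite lerD2r ler_wpM2r// subr_ge0.
Qed.

(** The solution is the inverse function of the travel time, or a constant if q is
   pinned. Its existence makes the limit that defines the effective speed unique. *)
Lemma flow_exists beta P q : oscillating beta P ->
  exists x : R -> R, forall t : R, is_derive t (1 : R) x (q - beta (x t)).
Proof.
move=> h; have [[y yq]|nq] := pselect (exists y, beta y = q).
  by exists (cst y) => t; rewrite /= yq subrr; exact: is_derive_cst.
have [P0 _ _] := h.
have [T [dT TP s0 _ [C CT]]] := travel_time h nq.
have cT : continuous T by move=> x; exact: (is_derive_continuous (dT x)).
have nz y : q - beta y != 0.
  by rewrite subr_eq0; apply/eqP => E; apply: nq; exists y.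
have inj : injective T.
  move=> y z; wlog yz : y z / y <= z.
    by move=> H; case: (leP y z) => [/H//|/ltW/H + E]; move=> /(_ (esym E)).
  move=> TE; apply/eqP; rewrite eq_le yz/= leNgt; apply/negP => ltyz.
  have [w _] := MVT ltyz (fun x _ => dT x) (continuous_subspaceT cT).
  by rewrite TE subrr => /eqP; rewrite eq_sym mulf_eq0 invr_eq0 (negPf (nz w)) subr_eq0 gt_eqF.
have surj t : exists y, T y = t.
  set r := speed beta P q in s0 CT.
  have k1 := CT (r * t + C + 1); have k2 := CT (r * t - C - 1).
  set y1 := r * t + C + 1 in k1; set y2 := r * t - C - 1 in k2.
  rewrite !ler_norml in k1 k2.
  have C0 : 0 <= C by apply: le_trans (CT 0).
  have y21 : y2 <= y1 by rewrite /y1 /y2; lra.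
  have H : Num.min (T y2) (T y1) <= t <= Num.max (T y2) (T y1).
    have h1 : r * t < r * T y1 by rewrite /y1 in k1 *; lra.
    have h2 : r * T y2 < r * t by rewrite /y2 in k2 *; lra.
    case: (ltgtP r 0) s0 h1 h2 => // [r0|r0] _.
      by rewrite !ltr_nM2l// => h1 h2; rewrite ge_min le_max (ltW h1) (ltW h2) !orbT.
    by rewrite !ltr_pM2l// => h1 h2; rewrite ge_min le_max (ltW h1) (ltW h2) !orbT.
  have [c _ cE] := IVT y21 (continuous_subspaceT cT) H.
  by exists c.
have [x xP] := choice surj; exists x => t.
have Tx : cancel T x by move=> y; apply: inj; rewrite xP.
have n1 : \forall z \near x t, x (T z) = z by near=> z; exact: Tx.
have n2 : \forall z \near x t, {for z, continuous T} by near=> z; exact: cT.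
have n3 : (q - beta (x t))^-1 != 0 by rewrite invr_eq0.
by have := is_derive_inverse n1 n2 (dT (x t)) n3; rewrite xP invrK.
Unshelve. all: by end_near. Qed.

Lemma effective_speedE beta P q : oscillating beta P ->
  effective_speed beta q = speed beta P q.
Proof.
move=> h.
have cvgs (x : R -> R) :
    (forall t : R, is_derive t (1 : R) x (q - beta (x t))) ->
    (x t - x 0) / t @[t --> +oo] --> speed beta P q.
  move=> dx.
  have [ym my] := oscillating_max h; have [yn ny] := oscillating_min h.
  pose M := `|q - beta ym| + `|q - beta yn|.
  have bM y : `|q - beta y| <= M.
    have := my y; have := ny y; rewrite /M ler_norml.
    have := ler_norm (q - beta yn); have := ler_norm (- (q - beta ym)).
    rewrite normrN; have := normr_ge0 (q - beta ym); have := normr_ge0 (q - beta yn).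
    by move=> *; lra.
  have lipx s t : `|x s - x t| <= M * `|s - t|.
    wlog st : s t / t <= s.
      by move=> H; case: (leP t s) => [/H//|/ltW/H]; rewrite distrC [in leRHS]distrC.
    have [w _ ->] := MVT_segment st (fun z _ => dx z)
      (continuous_subspaceT (fun z => is_derive_continuous (dx z))).
    by rewrite normrM ler_wpM2r.
  apply/cvgrPdist_le => eta eta0.
  have eta2 : 0 < eta / 2 by lra.
  have [C1 C1P] := displacement_le q h eta2.
  have [C2 C2P] := displacement_ge q h eta2.
  near=> t.
  have t0 : 0 < t by near: t; apply: nbhs_pinfty_gt; exact: num_real.
  have tC1 : C1 / (eta / 2) <= t by near: t; apply: nbhs_pinfty_ge; exact: num_real.
  have tC2 : C2 / (eta / 2) <= t by near: t; apply: nbhs_pinfty_ge; exact: num_real.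
  rewrite ler_pdivrMr// in tC1; rewrite ler_pdivrMr// in tC2.
  have := C1P 1 1 0 t M x ltr01 (ltW t0) (normr1 _) (fun s t _ _ => lipx s t).
  have := C2P 1 1 0 t M x ltr01 (ltW t0) (normr1 _) (fun s t _ _ => lipx s t).
  rewrite !mul1r !mulr1 !subr0 => H2 H1.
  have {}H1 : x t - x 0 <= (speed beta P q + eta / 2) * t + C1.
    by apply: H1; apply: aeW => s _; exists (q - beta (x s)) => //; rewrite mul1r divr1.
  have {}H2 : (speed beta P q - eta / 2) * t - C2 <= x t - x 0.
    by apply: H2; apply: aeW => s _; exists (q - beta (x s)) => //; rewrite mul1r divr1.
  have B1 : (x t - x 0) / t <= speed beta P q + eta by rewrite ler_pdivrMr//; lra.
  have B2 : speed beta P q - eta <= (x t - x 0) / t by rewrite ler_pdivlMr//; lra.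
  by rewrite ler_norml; apply/andP; split; lra.
rewrite /effective_speed; apply: xget_unique => //.
move=> l hl; have [x dx] := flow_exists q h.
by have := hl x dx; have := cvgs x dx => c1 c2; exact: (cvg_unique _ c2 c1).
Unshelve. all: by end_near. Qed.

End speed.

(** * The explicit profile *)

Section pointwise_derivatives.
Context {R : realType}.
Implicit Types (f g : R -> R) (x a b c : R).

Lemma derD f g x a b : is_derive x (1 : R) f a -> is_derive x (1 : R) g b ->
  is_derive x (1 : R) (fun y => f y + g y) (a + b).
Proof. by move=> *; exact: is_deriveD. Qed.

Lemma derB f g x a b : is_derive x (1 : R) f a -> is_derive x (1 : R) g b ->
  is_derive x (1 : R) (fun y => f y - g y) (a - b).
Proof. by move=> *; exact: is_deriveB. Qed.

Lemma derM f g x a b : is_derive x (1 : R) f a -> is_derive x (1 : R) g b ->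
  is_derive x (1 : R) (fun y => f y * g y) (a * g x + f x * b).
Proof.
move=> df dg; have := is_deriveM df dg.
rewrite -![_ *: (_ : R)]/(_ * _) => D; rewrite addrC (mulrC a); exact: D.
Qed.

Lemma derZ c f x a : is_derive x (1 : R) f a ->
  is_derive x (1 : R) (fun y => c * f y) (c * a).
Proof. by move=> *; exact: is_deriveZ. Qed.

Lemma derV f x a : f x != 0 -> is_derive x (1 : R) f a ->
  is_derive x (1 : R) (fun y => (f y)^-1) (- a / f x ^+ 2).
Proof.
move=> fx df; have := is_deriveV fx df.
rewrite -![_ *: (_ : R)]/(_ * _) => D; rewrite (_ : _ / _ = - f x ^- 2 * a); first exact: D.
by rewrite mulrC mulrN mulNr.
Qed.

Lemma derC c x : is_derive x (1 : R) (fun=> c) 0.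
Proof. exact: is_derive_cst. Qed.

Lemma derI x : is_derive x (1 : R) (fun y => y) 1.
Proof. exact: is_derive_id. Qed.

Lemma derS c f x a : is_derive (c * x) (1 : R) f a ->
  is_derive x (1 : R) (fun y => f (c * y)) (c * a).
Proof.
move=> df; rewrite mulrC; apply: (@is_derive1_comp _ f (fun y => c * y)) => //.
by have := is_derive_affine c 0 x; rewrite (_ : (fun y => c * y + 0) = (fun y => c * y)) //; apply/funext => y; rewrite addr0.
Qed.

End pointwise_derivatives.

Section hyperbolic.
Context {R : realType}.
Implicit Types x s : R.

Definition sh x : R := (expR x - expR (- x)) / 2.
Definition ch x : R := (expR x + expR (- x)) / 2.

Lemma ch2 x : ch x ^+ 2 = 1 + sh x ^+ 2.
Proof.
have : expR x * expR (- x) = 1 by rewrite -expRD subrr expR0.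
by rewrite /ch /sh; move: (expR x) (expR (- x)) => a b ab; field: ab.
Qed.

Lemma sh0 : sh 0 = 0. Proof. by rewrite /sh oppr0 subrr mul0r. Qed.
Lemma ch0 : ch 0 = 1. Proof. by rewrite /ch oppr0 expR0; field. Qed.

Lemma sh_gt0 x : 0 < x -> 0 < sh x.
Proof. by move=> x0; rewrite divr_gt0// subr_gt0 ltr_expR; lra. Qed.

Let expR_double x : expR (2 * x) = expR x * expR x.
Proof. by rewrite -expRD; congr expR; ring. Qed.

Lemma ch_double x : ch (2 * x) = 1 + 2 * sh x ^+ 2.
Proof.
have : expR x * expR (- x) = 1 by rewrite -expRD subrr expR0.
rewrite /ch /sh -mulrN !expR_double.
by move: (expR x) (expR (- x)) => a b ab; field: ab.
Qed.

Lemma sh_double x : sh (2 * x) = 2 * sh x * ch x.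
Proof. by rewrite /ch /sh -mulrN !expR_double; field. Qed.

Lemma der_expN x : is_derive x (1 : R) (fun y => expR (- y)) (- expR (- x)).
Proof.
have := @derS R (-1) expR x _ (is_derive_expR _).
rewrite !mulN1r (_ : (fun y => expR (-1 * y)) = (fun y => expR (- y)))//.
by apply/funext => y; rewrite mulN1r.
Qed.

Lemma der_sh x : is_derive x (1 : R) sh (ch x).
Proof.
rewrite /sh /ch; have := derZ 2^-1 (derB (is_derive_expR x) (der_expN x)).
rewrite opprK mulrC; congr is_derive; by apply/funext => y; rewrite mulrC.
Qed.

Lemma der_ch x : is_derive x (1 : R) ch (sh x).
Proof.
rewrite /sh /ch; have := derZ 2^-1 (derD (is_derive_expR x) (der_expN x)).
rewrite mulrC; congr is_derive; by apply/funext => y; rewrite mulrC.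
Qed.

Lemma sh_lt_xch s : 0 < s -> sh s < s * ch s.
Proof.
move=> s0; rewrite -subr_gt0.
have : 0 * ch 0 - sh 0 < s * ch s - sh s.
  apply: (@derive_gt0_incr R (fun x => x * ch x - sh x) (fun x => x * sh x)) => // x xs.
    apply: is_derive_eq (derB (derM (derI x) (der_ch x)) (der_sh x)) _.
    by ring.
  by move: xs => /andP[x0 _]; rewrite mulr_gt0// sh_gt0.
by rewrite sh0 mul0r subrr.
Qed.

Lemma x_lt_shch s : 0 < s -> s < sh s * ch s.
Proof.
move=> s0; rewrite -subr_gt0.
have : sh 0 * ch 0 - 0 < sh s * ch s - s.
  apply: (@derive_gt0_incr R (fun x => sh x * ch x - x) (fun x => 2 * sh x ^+ 2)) => // x xs.
    apply: is_derive_eq (derB (derM (der_sh x) (der_ch x)) (derI x)) _.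
    by rewrite -expr2 ch2; ring.
  by move: xs => /andP[x0 _]; rewrite mulr_gt0// exprn_gt0// sh_gt0.
by rewrite sh0 mul0r subrr.
Qed.

(** Both contact slopes of a drop are functions of s coth s - 1; kap is the derivative
   of this function. *)
Definition om s : R := s * ch s / sh s - 1.
Definition kap s : R := ch s / sh s - s / sh s ^+ 2.

Lemma der_om s : 0 < s -> is_derive s (1 : R) om (kap s).
Proof.
move=> s0; have n := lt0r_neq0 (sh_gt0 s0).
apply: is_derive_eq (derB (derM (derM (derI s) (der_ch s)) (derV n (der_sh s))) (derC 1 s)) _.
have := ch2 s; rewrite /kap; move: (sh s) (ch s) n => a b n ab.
by field: ab.
Qed.

Lemma kap_gt0 s : 0 < s -> 0 < kap s.
Proof.
move=> s0; have sp := sh_gt0 s0.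
have -> : kap s = (sh s * ch s - s) / sh s ^+ 2 by rewrite /kap; field; rewrite gt_eqF.
by rewrite divr_gt0 ?exprn_gt0// subr_gt0 x_lt_shch.
Qed.

Lemma om_gt0 s : 0 < s -> 0 < om s.
Proof.
move=> s0; have sp := sh_gt0 s0.
by rewrite subr_gt0 ltr_pdivlMr// mul1r sh_lt_xch.
Qed.

Lemma om_incr s s' : 0 < s -> s < s' -> om s < om s'.
Proof.
move=> s0 ss'; apply: (@derive_gt0_incr R om kap) => // x /andP[sx _].
  by apply: der_om; exact: lt_le_trans sx.
by apply: kap_gt0; exact: lt_trans sx.
Qed.

Lemma kap_incr s s' : 0 < s -> s < s' -> kap s < kap s'.
Proof.
move=> s0 ss'.
apply: (@derive_gt0_incr R kap (fun x => 2 * (x * ch x - sh x) / sh x ^+ 3)) => // x /andP[sx _].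
  have x0 : 0 < x := lt_le_trans s0 sx.
  have n := lt0r_neq0 (sh_gt0 x0).
  have n2 : sh x ^+ 2 != 0 by rewrite expf_neq0.
  have dV := derV n (der_sh x).
  have dV2 : is_derive x (1 : R) (fun y => (sh y ^+ 2)^-1) (- (2 * sh x * ch x) / (sh x ^+ 2) ^+ 2).
    apply: (derV (f := fun y => sh y ^+ 2)) => //.
    by apply: is_derive_eq (derM (der_sh x) (der_sh x)) _; ring.
  apply: is_derive_eq (derB (derM (der_ch x) dV) (derM (derI x) dV2)) _.
  have := ch2 x; move: (sh x) (ch x) n {n2 dV dV2} => a b n ab.
  by field: ab.
have x0 : 0 < x := lt_trans s0 sx.
by rewrite divr_gt0 ?exprn_gt0 ?sh_gt0// mulr_gt0// subr_gt0 sh_lt_xch.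
Qed.

Lemma coth_decr s s' : 0 < s -> s <= s' -> ch s' / sh s' <= ch s / sh s.
Proof.
move=> s0 ss'; rewrite -lerN2.
apply: (@derive_ge0_ndecr R (fun x => - (ch x / sh x)) (fun x => (sh x ^+ 2)^-1)) => // x /andP[sx _].
  have x0 : 0 < x := lt_le_trans s0 sx.
  have n := lt0r_neq0 (sh_gt0 x0).
  have d := is_deriveN (derM (der_ch x) (derV n (der_sh x))).
  apply: is_derive_eq d _.
  have := ch2 x; move: (sh x) (ch x) n => a b n ab.
  by field: ab.
by rewrite invr_ge0 sqr_ge0.
Qed.

Lemma om_le s : 0 < s -> om s <= s.
Proof.
move=> s0; rewrite lerBlDr ler_pdivrMr ?sh_gt0//.
have h : expR (- s) = ch s - sh s by rewrite /ch /sh; field.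
have e2 : expR s * expR (- s) = 1 by rewrite -expRD subrr expR0.
have hs : sh s = (expR s - expR (- s)) / 2 by [].
suff : s * expR (- s) <= sh s by rewrite h; lra.
have : 1 + s * 2 <= expR s * expR s by rewrite -expRD -mulr2n -(mulr_natr s 2) expR_ge1Dx.
move=> e4; have : (1 + s * 2) * expR (- s) <= expR s * expR s * expR (- s) by rewrite ler_pM2r ?expR_gt0.
rewrite -mulrA e2 mulr1 hs; lra.
Qed.

Lemma om_ge s : 0 < s -> s - 1 <= om s.
Proof.
move=> s0; rewrite lerD2r ler_pdivlMr ?sh_gt0// ler_pM2l//.
have := expR_gt0 (- s); rewrite /sh /ch; lra.
Qed.

Lemma om_surj c : 0 < c -> exists2 s, 0 < s & om s = c.
Proof.
move=> c0.
have c1 : c <= c + 1 by lra.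
have cont : {within `[c, c + 1], continuous om}.
  apply: derivable_within_continuous => x; rewrite in_itv/= => /andP[cx _].
  by have [d _] := der_om (lt_le_trans c0 cx).
have [|s] := IVT (v := c) c1 cont.
  have c10 : 0 < c + 1 by lra.
  by have := om_ge c10; rewrite addrK => h; rewrite ge_min le_max (om_le c0) h orbT.
rewrite in_itv/= => /andP[cs _] <-; exists s => //; exact: lt_le_trans cs.
Qed.

End hyperbolic.

(** The Euler-Lagrange equation on an interval of length l, in terms of the distance y
   from its left end, is w'' = m^2 w - k y - multiplier l, with w 0 = w l = 0 and mass V0.
   Its solution prof l is written with the initial slope lslope l; the coefficients of
   cosh - 1 make it vanish at l. The end slopes are A / om - B om and - (A / om + B om),
   where om is taken at m l / 2 and A, B do not depend on l. *)
Section profile.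
Context {R : realType}.
Context (V0 m k : R) (V0_gt0 : 0 < V0) (m_gt0 : 0 < m) (k_gt0 : 0 < k).
Implicit Types l y : R.

Definition lslope l : R :=
  V0 * m ^+ 2 / (2 * om (m * l / 2)) - k / m ^+ 2 * om (m * l / 2).
Definition rslope l : R :=
  V0 * m ^+ 2 / (2 * om (m * l / 2)) + k / m ^+ 2 * om (m * l / 2).
Definition prof l y : R :=
  lslope l / m * (sh (m * y) - ch (m * l / 2) / sh (m * l / 2) * (ch (m * y) - 1))
  + k / m ^+ 3 * (kap (m * l / 2) * (ch (m * y) - 1) - sh (m * y) + m * y).
Definition dprof l y : R :=
  lslope l * (ch (m * y) - ch (m * l / 2) / sh (m * l / 2) * sh (m * y))
  + k / m ^+ 2 * (kap (m * l / 2) * sh (m * y) - ch (m * y) + 1).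
Definition multiplier l : R :=
  lslope l * m * (ch (m * l / 2) / sh (m * l / 2)) - k / m * kap (m * l / 2).

Let mn0 : m != 0. Proof. by rewrite gt_eqF. Qed.
Let half_gt0 l : 0 < l -> 0 < m * l / 2.
Proof. by move=> l0; rewrite divr_gt0 ?mulr_gt0. Qed.

Lemma der_prof l y : is_derive y (1 : R) (prof l) (dprof l y).
Proof.
have dsh := derS (der_sh (m * y)); have dch := derS (der_ch (m * y)).
apply: is_derive_eq (derD (derZ _ (derB dsh (derZ _ (derB dch (derC 1 y)))))
  (derZ _ (derD (derB (derZ _ (derB dch (derC 1 y))) dsh) (derZ m (derI y))))) _.
by rewrite /dprof; set c := ch (m * l / 2) / _; field.
Qed.

Lemma der_dprof l y :
  is_derive y (1 : R) (dprof l) (m ^+ 2 * prof l y - k * y - multiplier l).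
Proof.
have dsh := derS (der_sh (m * y)); have dch := derS (der_ch (m * y)).
apply: is_derive_eq (derD (derZ _ (derB dch (derZ _ dsh)))
  (derZ _ (derD (derB (derZ _ dsh) dch) (derC 1 y)))) _.
by rewrite /prof /multiplier; set c := ch (m * l / 2) / _; field.
Qed.

Lemma prof0 l : prof l 0 = 0.
Proof. by rewrite /prof mulr0 sh0 ch0; ring. Qed.

Lemma dprof0 l : dprof l 0 = lslope l.
Proof. by rewrite /dprof mulr0 sh0 ch0; ring. Qed.

Lemma prof_end l : 0 < l -> prof l l = 0.
Proof.
move=> /half_gt0; rewrite /prof (_ : m * l = 2 * (m * l / 2)); last by field.
rewrite ch_double sh_double [2 * (m * l / 2) / 2](_ : _ = m * l / 2); last by field.
move: (m * l / 2) (lslope l) => s p s0; rewrite /kap.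
have n := lt0r_neq0 (sh_gt0 s0).
by move: (sh s) (ch s) n => a b n; field; rewrite n mn0.
Qed.

Lemma dprof_end l : 0 < l -> dprof l l = - rslope l.
Proof.
move=> l0; have s0 := half_gt0 l0; rewrite /dprof (_ : m * l = 2 * (m * l / 2)); last by field.
rewrite ch_double sh_double [2 * (m * l / 2) / 2](_ : _ = m * l / 2); last by field.
have -> : rslope l = lslope l + 2 * (k / m ^+ 2 * om (m * l / 2)) by rewrite /rslope /lslope; ring.
move: (m * l / 2) (lslope l) s0 => s p s0; rewrite /kap /om.
have n := lt0r_neq0 (sh_gt0 s0).
have := ch2 s; move: (sh s) (ch s) n => a b n ab.
by field: ab; rewrite n mn0.
Qed.

Definition iprof l y : R :=
  lslope l / m * ((ch (m * y) - 1) / m - ch (m * l / 2) / sh (m * l / 2) * (sh (m * y) / m - y))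
  + k / m ^+ 3 * (kap (m * l / 2) * (sh (m * y) / m - y) - (ch (m * y) - 1) / m + m * y ^+ 2 / 2).

Lemma der_iprof l y : is_derive y (1 : R) (iprof l) (prof l y).
Proof.
have dsh := derS (der_sh (m * y)); have dch := derS (der_ch (m * y)).
have d2 : is_derive y (1 : R) (fun y => m * y ^+ 2 / 2) (m * y).
  by apply: is_derive_eq (derM (derZ m (derM (derI y) (derI y))) (derC 2^-1 y)) _; field.
have d1 := derM (derB dch (derC 1 y)) (derC m^-1 y).
have d3 := derB (derM dsh (derC m^-1 y)) (derI y).
apply: is_derive_eq (derD (derZ _ (derB d1 (derZ _ d3)))
  (derZ _ (derD (derB (derZ _ d3) d1) d2))) _.
by rewrite /prof; set c := ch (m * l / 2) / _; field.
Qed.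

Lemma iprof0 l : iprof l 0 = 0.
Proof. by rewrite /iprof mulr0 sh0 ch0; ring. Qed.

Lemma iprof_end l : 0 < l -> iprof l l = V0.
Proof.
move=> l0; have s0 := half_gt0 l0; rewrite /iprof /lslope.
have lE : l = 2 * (m * l / 2) / m by field.
have h1 : sh (m * l) = 2 * sh (m * l / 2) * ch (m * l / 2).
  by rewrite -sh_double; congr sh; field.
have h2 : ch (m * l) = 1 + 2 * sh (m * l / 2) ^+ 2.
  by rewrite -ch_double; congr ch; field.
rewrite h1 h2 {h1 h2}; set s := m * l / 2 in lE s0 *; clearbody s; rewrite lE.
have n := lt0r_neq0 (sh_gt0 s0).
have o : s * ch s - sh s != 0 by rewrite subr_eq0 gt_eqF// sh_lt_xch.
rewrite /kap /om; clear s0 lE; have := ch2 s; move: (sh s) (ch s) n o => a b n o ab.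
by field: ab; rewrite n mn0 mulN1r o.
Qed.

(** Divided by 2 sinh^2 (m y / 2), the profile is a combination of coth and - kap at
   m y / 2 with nonnegative coefficients. Both decrease, and the value at y = l is 0. *)
Lemma prof_gt0 l y : 0 <= lslope l -> 0 < y < l -> 0 < prof l y.
Proof.
move=> p0 /andP[y0 yl]; have l0 : 0 < l := lt_trans y0 yl.
have s0 := half_gt0 l0; have e0 := half_gt0 y0.
have es : m * y / 2 < m * l / 2 by rewrite ltr_pM2r// ltr_pM2l.
have hc := coth_decr e0 (ltW es); have hk := kap_incr e0 es.
have -> : prof l y = 2 * sh (m * y / 2) ^+ 2 *
    (lslope l / m * (ch (m * y / 2) / sh (m * y / 2) - ch (m * l / 2) / sh (m * l / 2))
     + k / m ^+ 3 * (kap (m * l / 2) - kap (m * y / 2))).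
  rewrite /prof; set p := lslope l; set c := ch (m * l / 2) / _; set q := kap (m * l / 2).
  rewrite (_ : m * y = 2 * (m * y / 2)); last by field.
  rewrite ch_double sh_double [2 * (m * y / 2) / 2](_ : _ = m * y / 2); last by field.
  have n := lt0r_neq0 (sh_gt0 e0); rewrite /kap.
  by move: (m * y / 2) (sh (m * y / 2)) (ch (m * y / 2)) n => e a b n; field; rewrite n mn0.
apply: mulr_gt0; first by rewrite mulr_gt0// exprn_gt0// sh_gt0.
apply: ltr_wpDl; first by apply: mulr_ge0; [rewrite divr_ge0// ltW | rewrite subr_ge0].
by apply: mulr_gt0; [rewrite divr_gt0// exprn_gt0 | rewrite subr_gt0].
Qed.

Lemma multiplier_lt0 l : 0 < l -> lslope l = 0 -> multiplier l < 0.
Proof.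
move=> /half_gt0 s0 p0; rewrite /multiplier p0 !mul0r sub0r oppr_lt0.
by rewrite mulr_gt0 ?divr_gt0 ?kap_gt0.
Qed.

Lemma lslope_decr l l' : 0 < l -> l < l' -> lslope l' < lslope l.
Proof.
move=> l0 ll'; have s0 := half_gt0 l0.
have ss' : m * l / 2 < m * l' / 2 by rewrite ltr_pM2r// ltr_pM2l.
have w := om_gt0 s0; have w' := om_gt0 (lt_trans s0 ss').
have ww' := om_incr s0 ss'.
rewrite /lslope ler_ltB// ?ltr_pM2l ?divr_gt0 ?exprn_gt0//.
rewrite ler_pM2l ?mulr_gt0 ?exprn_gt0//.
by rewrite lef_pV2 ?posrE ?mulr_gt0// ler_pM2l// ltW.
Qed.

(** Longer drops would have a negative slope at the left end, so that this is an upper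
   bound for the length of a positive profile. *)
Lemma critical_length : exists2 l, 0 < l & lslope l = 0.
Proof.
have c0 : 0 < Num.sqrt (V0 * m ^+ 4 / (2 * k)).
  by rewrite sqrtr_gt0 divr_gt0 ?mulr_gt0 ?exprn_gt0.
have [s s0 omE] := om_surj c0.
exists (2 * s / m); first by rewrite divr_gt0 ?mulr_gt0.
rewrite /lslope (_ : m * (2 * s / m) / 2 = s); last by field.
have w0 : om s != 0 by rewrite gt_eqF// om_gt0.
have : om s ^+ 2 = V0 * m ^+ 4 / (2 * k).
  by rewrite omE sqr_sqrtr// divr_ge0 ?mulr_ge0 ?exprn_ge0 ?(ltW m_gt0) ?(ltW k_gt0) ?(ltW V0_gt0).
move=> w2; have -> : V0 = om s ^+ 2 * (2 * k) / m ^+ 4.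
  by rewrite w2; field; rewrite mn0 gt_eqF.
by field; rewrite mn0 w0.
Qed.

(** The product of the two terms A / om and B om is constant, so that their sum
   decreases as long as the first one is the larger. *)
Lemma rslope_decr l l' : 0 < l -> l <= l' -> 0 <= lslope l' ->
  rslope l' <= rslope l.
Proof.
move=> l0; rewrite le_eqVlt => /orP[/eqP->//|ll' p0]; have s0 := half_gt0 l0.
have ss' : m * l / 2 < m * l' / 2 by rewrite ltr_pM2r// ltr_pM2l.
have w := om_gt0 s0; have w' := om_gt0 (lt_trans s0 ss').
have ww' := om_incr s0 ss'.
move: p0; rewrite /lslope /rslope subr_ge0.
move: (om (m * l / 2)) (om (m * l' / 2)) w w' ww' => u v u0 v0 uv H.
have B0 : 0 < k / m ^+ 2 by rewrite divr_gt0 ?exprn_gt0.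
set B := k / m ^+ 2 in H B0 *; set A := V0 * m ^+ 2 in H *.
have H1 : 2 * B * v * v <= A.
  by move: H; rewrite ler_pdivlMr ?mulr_gt0//; lra.
have H2 : 2 * B * u * v <= A.
  by apply: le_trans H1; rewrite ler_pM2r// ler_pM2l; [exact: ltW | exact: mulr_gt0].
rewrite -subr_ge0.
have -> : A / (2 * u) + B * u - (A / (2 * v) + B * v) =
    (v - u) * (A - 2 * B * u * v) / (2 * u * v) by field; rewrite !gt_eqF.
by rewrite divr_ge0 ?mulr_ge0 ?subr_ge0 ?(ltW u0) ?(ltW v0)// ltW.
Qed.

Lemma rslope_gt0 l : 0 < l -> 0 < rslope l.
Proof.
move=> /half_gt0/om_gt0 w.
by rewrite addr_gt0 ?mulr_gt0 ?invr_gt0 ?exprn_gt0 ?mulr_gt0 ?divr_gt0 ?exprn_gt0.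
Qed.

Lemma lslope_lt_rslope l : 0 < l -> lslope l < rslope l.
Proof.
move=> /half_gt0/om_gt0 w; rewrite /lslope /rslope ltrD2l.
have : 0 < k / m ^+ 2 * om (m * l / 2) by rewrite mulr_gt0 ?divr_gt0 ?exprn_gt0.
lra.
Qed.

(** A fixed mass on a short interval makes the profile steep. *)
Lemma rslope_large M : 0 <= M -> exists2 l, 0 < l &
  forall l', 0 < l' -> l' <= l -> M <= 2^-1 * rslope l' ^+ 2.
Proof.
move=> M0; exists (V0 * m / (M + 2)); first by rewrite divr_gt0 ?mulr_gt0//; lra.
move=> l l0; rewrite ler_pdivlMr; last by lra.
move=> lM; have s0 := half_gt0 l0; have w := om_gt0 s0.
have X : M + 2 <= rslope l.
  apply: (@le_trans _ _ (V0 * m / l)); first by rewrite ler_pdivlMr// mulrC.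
  apply: (@le_trans _ _ (V0 * m ^+ 2 / (2 * om (m * l / 2)))).
    rewrite (_ : V0 * m / l = V0 * m ^+ 2 / (2 * (m * l / 2))); last by field; rewrite mn0 gt_eqF.
    rewrite ler_pM2l ?mulr_gt0 ?exprn_gt0// lef_pV2 ?posrE ?mulr_gt0 ?invr_gt0//.
    by rewrite ler_pM2l// om_le.
  by rewrite lerDl mulr_ge0 ?divr_ge0 ?exprn_ge0 ?(ltW k_gt0) ?(ltW m_gt0) ?ltW.
by nra.
Qed.

Section continuity.
Context (T : Type) (F : set_system T) (FF : Filter F) (lF : T -> R) (l : R).
Context (l0 : 0 < l) (lFl : lF @ F --> l).

Let half_cvg : (fun e => m * lF e / 2) @ F --> m * l / 2.
Proof. by apply: cvgM; [apply: cvgM => //; exact: cvg_cst | exact: cvg_cst]. Qed.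

Let comp_cvg (f : R -> R) (df : R) : is_derive (m * l / 2) (1 : R) f df ->
  (fun e => f (m * lF e / 2)) @ F --> f (m * l / 2).
Proof. by move=> /is_derive_continuous cf; apply: continuous_cvg half_cvg. Qed.

Let om_cvg : (fun e => om (m * lF e / 2)) @ F --> om (m * l / 2).
Proof. exact: comp_cvg (der_om (half_gt0 l0)). Qed.

Let sh_cvg : (fun e => sh (m * lF e / 2)) @ F --> sh (m * l / 2).
Proof. exact: comp_cvg (der_sh _). Qed.

Let ch_cvg : (fun e => ch (m * lF e / 2)) @ F --> ch (m * l / 2).
Proof. exact: comp_cvg (der_ch _). Qed.

Lemma lslope_cvg : (fun e => lslope (lF e)) @ F --> lslope l.
Proof.
have w := om_gt0 (half_gt0 l0).
apply: cvgB; apply: cvgM; try exact: cvg_cst; last exact: om_cvg.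
apply: cvgV; first by rewrite mulf_neq0// gt_eqF.
by apply: cvgM; [exact: cvg_cst | exact: om_cvg].
Qed.

Lemma rslope_cvg : (fun e => rslope (lF e)) @ F --> rslope l.
Proof.
have w := om_gt0 (half_gt0 l0).
apply: cvgD; apply: cvgM; try exact: cvg_cst; last exact: om_cvg.
apply: cvgV; first by rewrite mulf_neq0// gt_eqF.
by apply: cvgM; [exact: cvg_cst | exact: om_cvg].
Qed.

Lemma prof_cvg (yF : T -> R) (y : R) : yF @ F --> y ->
  (fun e => prof (lF e) (yF e)) @ F --> prof l y.
Proof.
move=> yFy; have s0 := half_gt0 l0; have n := lt0r_neq0 (sh_gt0 s0).
have my : (fun e => m * yF e) @ F --> m * y by apply: cvgM => //; exact: cvg_cst.
have shy : (fun e => sh (m * yF e)) @ F --> sh (m * y).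
  exact: (continuous_cvg _ (is_derive_continuous (der_sh _)) my).
have chy : (fun e => ch (m * yF e) - 1) @ F --> ch (m * y) - 1.
  by apply: cvgB; [exact: (continuous_cvg _ (is_derive_continuous (der_ch _)) my) | exact: cvg_cst].
have shi : (fun e => (sh (m * lF e / 2))^-1) @ F --> (sh (m * l / 2))^-1.
  by apply: cvgV => //; exact: sh_cvg.
have coth : (fun e => ch (m * lF e / 2) / sh (m * lF e / 2)) @ F --> ch (m * l / 2) / sh (m * l / 2).
  by apply: cvgM => //; exact: ch_cvg.
have kp : (fun e => kap (m * lF e / 2)) @ F --> kap (m * l / 2).
  apply: cvgB => //; apply: cvgM; first exact: half_cvg.
  by apply: cvgV; [rewrite expf_neq0 | apply: cvgM; exact: sh_cvg].
apply: cvgD; apply: cvgM; try exact: cvg_cst.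
- by apply: cvgM; [exact: lslope_cvg | exact: cvg_cst].
- by apply: cvgB => //; apply: cvgM.
- by apply: cvgD => //; apply: cvgB => //; apply: cvgM.
Qed.

End continuity.

End profile.

(** * Square integrable weak derivatives *)

Section square_integrable.
Context {R : realType}.
Local Notation mu := (@lebesgue_measure R).
Local Notation L2 := (Lfun mu 2%:E).
Implicit Types (f g v w : R -> R) (D : set R).

Definition Rintegrable D f := mu.-integrable D (EFin \o f).

Lemma RintegrableD D f g : measurable (D : set (measurableTypeR R)) -> Rintegrable D f -> Rintegrable D g ->
  Rintegrable D (fun x => f x + g x).
Proof. by move=> mD fi gi; exact: (integrableD mD fi gi). Qed.

Lemma RintegrableB D f g : measurable (D : set (measurableTypeR R)) -> Rintegrable D f -> Rintegrable D g ->
  Rintegrable D (fun x => f x - g x).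
Proof. by move=> mD fi gi; exact: (integrableB mD fi gi). Qed.

Lemma RintegrableZ D c f : measurable (D : set (measurableTypeR R)) -> Rintegrable D f ->
  Rintegrable D (fun x => c * f x).
Proof. by move=> mD fi; exact: (integrableZl mD c fi). Qed.

Lemma Rintegrable_norm D f : measurable (D : set (measurableTypeR R)) -> Rintegrable D f ->
  Rintegrable D (fun x => `|f x|).
Proof. by move=> mD fi; exact: (integrable_abse fi). Qed.

Lemma RintegrableS D E f : measurable (D : set (measurableTypeR R)) -> measurable (E : set (measurableTypeR R)) -> E `<=` D ->
  Rintegrable D f -> Rintegrable E f.
Proof. by move=> mD mE ED; exact: integrableS. Qed.

Lemma Rintegrable_cst (y z c : R) : Rintegrable `[y, z] (fun=> c).
Proof. by apply: continuous_itv_integrable => x; exact: cvg_cst. Qed.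

Lemma Rintegral_itv_cst (y z c : R) : y <= z ->
  \int[mu]_(x in `[y, z]) c = c * (z - y).
Proof.
move=> yz; have cc : continuous (fun _ : R => c) by move=> x; exact: cvg_cst.
rewrite (Rintegral_derive (fun x => is_derive_affine c 0 x) cc yz); ring.
Qed.

Lemma L2_measurable f : f \in L2 -> measurable_fun setT f.
Proof. by rewrite inE => /andP[]; rewrite inE. Qed.

Lemma L2_mul f g : f \in L2 -> g \in L2 -> Rintegrable setT (fun x => f x * g x).
Proof. by move=> fL gL; exact/Lfun1_integrable/Lfun2_mul_Lfun1. Qed.

Lemma L2_sqr f : f \in L2 -> Rintegrable setT (fun x => f x ^+ 2).
Proof. by move=> fL; exact: L2_mul. Qed.

Lemma sqr_L2 f : measurable_fun setT f -> Rintegrable setT (fun x => f x ^+ 2) ->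
  f \in L2.
Proof.
move=> mf fi; rewrite inE/=; apply/andP; split; rewrite inE//=.
rewrite /finite_norm unlock poweR_lty//.
under eq_integral => x _/= do rewrite powR_mulrn// -normrX.
by move/integrableP : fi => [].
Qed.

Lemma L2_sub f g : f \in L2 -> g \in L2 -> (fun x => f x - g x) \in L2.
Proof.
move=> fL gL; apply: sqr_L2; first by apply: measurable_funB; exact: L2_measurable.
have -> : (fun x => (f x - g x) ^+ 2) = (fun x => f x ^+ 2 - 2 * (f x * g x) + g x ^+ 2).
  by apply/funext => x; ring.
apply: RintegrableD => //; last exact: L2_sqr.
apply: RintegrableB => //; first exact: L2_sqr.
by apply: RintegrableZ => //; exact: L2_mul.
Qed.

Lemma L2_integrable f y z : f \in L2 -> Rintegrable `[y, z] f.
Proof.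
move=> fL.
apply: (@le_integrable _ _ _ mu _ _ _ (EFin \o (fun x => 1 + f x ^+ 2))) => //.
- by apply/measurable_EFinP; apply: measurable_funTS; exact: L2_measurable.
- move=> x _ /=; rewrite lee_fin [leRHS]ger0_norm ?addr_ge0 ?sqr_ge0//.
  rewrite -(real_normK (num_real (f x))); have := normr_ge0 (f x).
  by move: (`|f x|) => t t0; nra.
- apply: RintegrableD => //; first exact: Rintegrable_cst.
  by apply: RintegrableS (L2_sqr fL).
Qed.

(** Young's inequality for the product of |f| and 1; the free parameter d makes it as
   strong as the Cauchy-Schwarz inequality. *)
Lemma L2_itv_le f y z d : f \in L2 -> y <= z -> 0 < d ->
  \int[mu]_(x in `[y, z]) `|f x| <=
  d / 2 * \int[mu]_x (f x ^+ 2) + (z - y) / (2 * d).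
Proof.
move=> fL yz d0.
have fi := L2_sqr fL.
have fyz : Rintegrable `[y, z] (fun x => f x ^+ 2) by exact: RintegrableS fi.
apply: (@le_trans _ _ (\int[mu]_(x in `[y, z]) (d / 2 * f x ^+ 2 + (2 * d)^-1))).
  apply: le_Rintegral => //.
  - exact/Rintegrable_norm/L2_integrable.
  - by apply: RintegrableD => //; [exact: RintegrableZ | exact: Rintegrable_cst].
  - move=> x _; rewrite -(real_normK (num_real (f x))); move: (`|f x|) => t.
    rewrite -subr_ge0 (_ : _ - _ = (d * t - 1) ^+ 2 / (2 * d)); last by field; rewrite gt_eqF.
    by rewrite divr_ge0 ?sqr_ge0// mulr_ge0// ltW.
rewrite RintegralD//; last 2 first.
- exact: RintegrableZ.
- exact: Rintegrable_cst.
rewrite RintegralZl// Rintegral_itv_cst// [X in _ + X]mulrC lerD2r ler_pM2l ?divr_gt0//.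
rewrite Rintegral_mkcond; apply: le_Rintegral => //.
  have := (@integrable_mkcond _ _ _ mu `[y, z]%classic (EFin \o (fun x => f x ^+ 2)) (measurable_itv _)).1 fyz.
  by rewrite restrict_EFin.
by move=> x _; rewrite patchE; case: ifP => // _; rewrite sqr_ge0.
Qed.

Lemma weak_derivative_le v g y z : weak_derivative v g -> y <= z ->
  `|v z - v y| <= \int[mu]_(x in `[y, z]) `|g x|.
Proof.
move=> [gL vg] yz; rewrite vg//.
by apply: le_normr_Rintegral => //; exact: L2_integrable.
Qed.

Lemma weak_derivative_continuous v g : weak_derivative v g -> continuous v.
Proof.
move=> vg x; apply/cvgrPdist_lt => e e0.
have [gL _] := vg.
have N0 : 0 <= \int[mu]_x (g x ^+ 2) by apply: Rintegral_ge0 => t _; exact: sqr_ge0.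
set N := (X in 0 <= X) in N0.
have N1 : 0 < N + 1 by lra.
pose d := e / (N + 1); have d0 : 0 < d by rewrite divr_gt0.
have dN : d * (N + 1) = e by rewrite /d divfK// gt_eqF.
clearbody d.
have key y z : y <= z -> z - y < e * d -> `|v z - v y| < e.
  move=> yz zy; apply: le_lt_trans (weak_derivative_le vg yz) _.
  apply: le_lt_trans (L2_itv_le gL yz d0) _; rewrite -/N.
  have h1 : d / 2 * N <= e / 2.
    by lra.
  have h2 : (z - y) / (2 * d) < e / 2.
    by rewrite ltr_pdivrMr ?mulr_gt0// (_ : e / 2 * (2 * d) = e * d)//; field.
  lra.
have key2 y z : `|z - y| < e * d -> `|v z - v y| < e.
  have [yz|/ltW zy] := leP y z; first by rewrite ger0_norm ?subr_ge0//; exact: key.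
  by rewrite ler0_norm ?subr_le0// opprB distrC; exact: key.
near=> y; apply: key2.
by near: y; apply/nbhs_ballP; exists (e * d) => //=; rewrite mulr_gt0.
Unshelve. all: by end_near. Qed.

(** By Lebesgue's differentiation theorem. In particular two weak derivatives of the
   same function coincide almost everywhere. *)
Lemma weak_derivative_ae v g : weak_derivative v g ->
  {ae mu, forall x, is_derive x (1 : R) v (g x)}.
Proof.
move=> [gL vg].
have loc : locally_integrable [set: R] g.
  split; [exact: L2_measurable | exact: openT | move=> K _ cK].
  have [M [_ MK]] := compact_bounded cK.
  have KM : K `<=` `[- (`|M| + 1), `|M| + 1].
    move=> x /(MK (`|M| + 1)); rewrite /= in_itv/= -ler_norml; apply.
    by rewrite (le_lt_trans (ler_norm _))// ltrDl.
  have mK : measurable K by exact: compact_measurable.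
  have : Rintegrable K g by apply: RintegrableS KM _ => //; exact: L2_integrable.
  by move=> /integrableP[_]; under eq_integral do rewrite /=.
have H (n : nat) : {ae mu, forall x : R, - n%:R < x -> is_derive x (1 : R) v (g x)}.
  have gi (y : R) : mu.-integrable [set` Interval (BLeft (- n%:R)) (BRight y)] (EFin \o g).
    exact: L2_integrable.
  have := FTC1 gi loc; move=> /aeS; apply => x h nx.
  have [|dF dFE] := h; first by rewrite lte_fin.
  have D : is_derive x (1 : R) (fun x => \int[mu]_(t in `[- n%:R, x]) g t + v (- n%:R)) (g x).
    have D1 : is_derive x (1 : R) (fun x => \int[mu]_(t in `[- n%:R, x]) g t) (g x).
      by constructor; [exact: dF | rewrite -dFE derive1E].
    by have := is_deriveD D1 (is_derive_cst (v (- n%:R)) x (1 : R)); rewrite addr0.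
  apply: near_eq_is_derive D; near=> y; rewrite -vg ?subrK//.
  have xy : `|x - y| < x + n%:R by near: y; apply/nbhs_ballP; exists (x + n%:R) => //=; lra.
  by move: xy; rewrite ltr_norml => /andP[]; lra.
apply: (aeS (ae_foralln H)) => x h.
have [n nx] : exists n : nat, `|x| < n%:R by exists (Num.bound `|x|); rewrite archi_boundP.
by apply: (h n); have := ler_norm (- x); rewrite normrN; lra.
Unshelve. all: by end_near. Qed.

Lemma eq_Rintegrable D f g : measurable (D : set (measurableTypeR R)) ->
  (forall x, D x -> f x = g x) -> Rintegrable D f -> Rintegrable D g.
Proof.
move=> mD fg; apply: eq_integrable => // x; rewrite inE => Dx /=.
by rewrite fg.
Qed.

Lemma L2_patch f y z : continuous f -> f \_ `[y, z] \in L2.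
Proof.
move=> cf; apply: sqr_L2.
  apply/(measurable_restrictT _ _).1 => //; apply: measurable_funTS.
  exact: continuous_measurable_fun.
have -> : (fun x => (f \_ `[y, z]) x ^+ 2) = (fun x => f x ^+ 2) \_ `[y, z].
  by apply/funext => x; rewrite !patchE; case: ifP => // _; rewrite expr2 mulr0.
rewrite /Rintegrable -restrict_EFin; apply/(integrable_mkcond _ _).1 => //.
by apply: continuous_itv_integrable => x; apply: cvgM; exact: cf.
Qed.

Lemma L2_mul_itv f g y z : continuous f -> g \in L2 ->
  Rintegrable `[y, z] (fun x => f x * g x).
Proof.
move=> cf gL; apply: (@eq_Rintegrable _ (fun x => (f \_ `[y, z]) x * g x)) => //.
  by move=> x yz; rewrite patchE mem_set.
by apply: (@RintegrableS setT) => //; apply: L2_mul => //; exact: L2_patch.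
Qed.

Lemma Rintegral_split f (p y z : R) : p <= y -> y <= z -> Rintegrable `[p, z] f ->
  \int[mu]_(x in `[p, z]) f x =
  \int[mu]_(x in `[p, y]) f x + \int[mu]_(x in `[y, z]) f x.
Proof.
move=> py yz fi; have := @Rintegral_itvB R f (BLeft p) (BRight z) y fi.
rewrite !bnd_simp => /(_ py yz) h.
rewrite -[X in _ + X]Rintegral_itv_obnd_cbnd -?h; first by ring.
by apply: integrableS fi => //; apply: subset_itv; rewrite bnd_simp.
Qed.

(** On [y, z] the increments of the two sides differ by at most a constant times
   (z - y) times the integral of |g| over [y, z]. Hence, for each e > 0, the difference D
   of the two sides is locally dominated by e times a primitive of |g|. *)
Lemma weak_integration_by_parts v g (phi dphi : R -> R) (p q : R) : weak_derivative v g ->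
  (forall x, is_derive x (1 : R) phi (dphi x)) -> continuous dphi -> p <= q ->
  \int[mu]_(x in `[p, q]) (phi x * g x + dphi x * v x) = phi q * v q - phi p * v p.
Proof.
move=> vg dphiP cdphi pq; have [gL vgE] := vg.
have cphi : continuous phi by move=> x; exact: (is_derive_continuous (dphiP x)).
have cv := weak_derivative_continuous vg.
have ig y z : Rintegrable `[y, z] (fun x => phi x * g x + dphi x * v x).
  apply: RintegrableD => //; first exact: L2_mul_itv.
  by apply: continuous_itv_integrable => x; apply: cvgM; [exact: cdphi | exact: cv].
have iabs y z : Rintegrable `[y, z] (fun x => `|g x|).
  by apply: Rintegrable_norm => //; exact: L2_integrable.
have [M M0 MP] : exists2 M, 0 <= M & forall x, p <= x <= q -> `|dphi x| <= M.
  have cn : continuous (fun x => `|dphi x|) by move=> x; apply: cvg_norm; exact: cdphi.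
  have [c _ cM] := EVT_max pq (continuous_subspaceT cn).
  by exists `|dphi c| => // x xpq; apply: cM; rewrite in_itv.
pose K z := \int[mu]_(x in `[p, z]) `|g x|.
pose D z := phi z * v z - \int[mu]_(x in `[p, z]) (phi x * g x + dphi x * v x).
have KB y z : p <= y -> y <= z -> K z - K y = \int[mu]_(x in `[y, z]) `|g x|.
  by move=> py yz; rewrite /K (Rintegral_split py yz)//; ring.
have K0 y z : p <= y -> y <= z -> 0 <= K z - K y.
  by move=> py yz; rewrite KB//; apply: Rintegral_ge0.
have est y z : p <= y -> y <= z -> z <= q ->
    `|D z - D y| <= 2 * M * (z - y) * (K z - K y).
  move=> py yz zq; rewrite /D (Rintegral_split py yz)//.
  have phiL x : y <= x -> x <= z -> `|phi z - phi x| <= M * (z - y).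
    move=> yx xz; have [w wxz ->] := MVT_segment xz (fun t _ => dphiP t) (continuous_subspaceT cphi).
    move: wxz; rewrite in_itv/= => /andP[w1 w2].
    rewrite normrM (ger0_norm (_ : 0 <= z - x)) ?subr_ge0//.
    by apply: ler_pM => //; [rewrite subr_ge0 | apply: MP; lra | lra].
  have vL x : y <= x -> x <= z -> `|v y - v x| <= K z - K y.
    move=> yx xz; rewrite distrC (le_trans (weak_derivative_le vg yx))//.
    by rewrite -KB//; have := K0 x z; lra.
  set I := \int[mu]_(x in `[y, z]) _.
  have -> : phi z * v z - (\int[mu]_(x in `[p, y]) (phi x * g x + dphi x * v x) + I) -
     (phi y * v y - \int[mu]_(x in `[p, y]) (phi x * g x + dphi x * v x)) =
     phi z * (v z - v y) + (phi z - phi y) * v y - I by ring.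
  rewrite vgE// -(Rintegral_derive dphiP cdphi yz).
  rewrite -RintegralZl//; last exact: L2_integrable.
  rewrite -RintegralZr//; last exact: continuous_itv_integrable.
  have i1 : Rintegrable `[y, z] (fun x => phi z * g x).
    by apply: RintegrableZ => //; exact: L2_integrable.
  have i2 : Rintegrable `[y, z] (fun x => dphi x * v y).
    by apply: continuous_itv_integrable => x; apply: cvgM; [exact: cdphi | exact: cvg_cst].
  rewrite -RintegralD// -RintegralB//; [|exact: RintegrableD|exact: ig].
  have i3 : Rintegrable `[y, z] (fun x => phi z * g x + dphi x * v y - (phi x * g x + dphi x * v x)).
    by apply: RintegrableB => //; exact: RintegrableD.
  apply: (le_trans (le_normr_Rintegral _ i3)) => //.
  have -> : 2 * M * (z - y) * (K z - K y) = \int[mu]_(x in `[y, z]) (M * (z - y) * `|g x| + M * (K z - K y)).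
    rewrite RintegralD//; last 2 first.
    - exact: RintegrableZ.
    - exact: Rintegrable_cst.
    rewrite RintegralZl//; last exact: iabs.
    by rewrite Rintegral_itv_cst// KB//; ring.
  apply: le_Rintegral => //.
  - exact: Rintegrable_norm.
  - by apply: RintegrableD => //; [exact: RintegrableZ | exact: Rintegrable_cst].
  - move=> x; rewrite /= in_itv/= => /andP[yx xz].
    have -> : phi z * g x + dphi x * v y - (phi x * g x + dphi x * v x) =
      (phi z - phi x) * g x + dphi x * (v y - v x) by ring.
    apply: (le_trans (ler_normD _ _)); rewrite !normrM; apply: lerD.
      by apply: ler_wpM2r => //; exact: phiL.
    apply: ler_pM => //; last exact: vL.
    by apply: MP; lra.
have DE (sg : R) : `|sg| = 1 -> forall e, 0 < e -> sg * D p + e * K p <= sg * D q + e * K q.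
  move=> sg1 e e0; apply: (@local_ndecr R (fun z => sg * D z + e * K z)) => // t /andP[pt tq].
  have M1 : 0 < 2 * M + 1 by lra.
  have key y z : p <= y -> y <= z -> z <= q -> z - y < e / (2 * M + 1) ->
      sg * D y + e * K y <= sg * D z + e * K z.
    move=> py yz zq; rewrite ltr_pdivlMr// => zy.
    have h0 := K0 _ _ py yz.
    have := est _ _ py yz zq.
    have -> : `|D z - D y| = `|sg * (D z - D y)| by rewrite normrM sg1 mul1r.
    rewrite ler_norml => /andP[+ _].
    have : 2 * M * (z - y) * (K z - K y) <= e * (K z - K y).
      by apply: ler_wpM2r => //; nra.
    lra.
  apply/nbhs_ballP; exists (e / (2 * M + 1)) => /=; first by rewrite divr_gt0.
  move=> s /= ts /andP[ps sq]; rewrite /ball/= in ts.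
  split => st; apply: key => //.
  - by move: ts; rewrite ger0_norm// subr_ge0.
  - by move: ts; rewrite distrC ger0_norm// subr_ge0.
have pK : 0 <= K q - K p by exact: K0.
have DD : D q = D p.
  apply/eqP; rewrite eq_le; apply/andP; split.
  - apply/ler_addgt0Pr => e e0.
    have e1 : 0 < e / (K q - K p + 1) by rewrite divr_gt0//; lra.
    have := DE (-1) (normrN1 _) _ e1.
    have : e / (K q - K p + 1) * (K q - K p) <= e by rewrite mulrAC ler_pdivrMr; nra.
    lra.
  - apply/ler_addgt0Pr => e e0.
    have e1 : 0 < e / (K q - K p + 1) by rewrite divr_gt0//; lra.
    have := DE 1 (normr1 _) _ e1.
    have : e / (K q - K p + 1) * (K q - K p) <= e by rewrite mulrAC ler_pdivrMr; nra.
    lra.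
move: DD; rewrite /D set_itv1 Rintegral_set1 subr0; lra.
Qed.

End square_integrable.

(** * Minimizers of the energy *)

Section clamp.
Context {R : realType}.
Local Notation mu := (@lebesgue_measure R).

Definition clamp (p q t : R) : R := Num.max p (Num.min t q).

Lemma clamp_itv (p q t : R) : p <= q -> p <= clamp p q t <= q.
Proof. by move=> pq; rewrite /clamp le_max lexx ge_max pq ge_min lexx orbT. Qed.

Lemma clamp_id (p q t : R) : p <= t <= q -> clamp p q t = t.
Proof. by move=> /andP[pt tq]; rewrite /clamp (min_idPl tq) (max_idPr pt). Qed.

Lemma clamp_le (p q t : R) : p <= q -> t <= p -> clamp p q t = p.
Proof.
by move=> pq tp; rewrite /clamp (min_idPl (le_trans tp pq)) (max_idPl tp).
Qed.

Lemma clamp_ge (p q t : R) : p <= q -> q <= t -> clamp p q t = q.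
Proof. by move=> pq qt; rewrite /clamp (min_idPr qt) (max_idPr pq). Qed.

Lemma patch_primitive (F f : R -> R) (p q y z : R) :
  (forall x, is_derive x (1 : R) F (f x)) -> continuous f -> p <= q -> y <= z ->
  \int[mu]_(x in `[y, z]) (f \_ `[p, q]) x = F (clamp p q z) - F (clamp p q y).
Proof.
move=> Ff cf pq yz; rewrite -Rintegral_mkcondr.
have [h|h] := leP (Num.max y p) (Num.min z q).
  have -> : `[y, z] `&` `[p, q] = `[Num.max y p, Num.min z q]%classic.
    apply/seteqP; split => x /=; rewrite !in_itv/= ge_max le_min.
      by move=> [/andP[-> ->] /andP[-> ->]].
    by move=> /andP[/andP[-> ->] /andP[-> ->]].
  rewrite (Rintegral_derive Ff cf h); congr (F _ - F _).
    move: h; rewrite ge_max => /andP[_ h].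
    by rewrite /clamp (max_idPr h).
  move: h; rewrite le_min => /andP[_]; rewrite ge_max => /andP[yq _].
  by rewrite /clamp (min_idPl yq) maxC.
have -> : `[y, z] `&` `[p, q] = set0 :> set R.
  apply/seteqP; split => x //=; rewrite !in_itv/= => -[/andP[yx xz] /andP[px xq]].
  by move: h; rewrite ltNge => /negP; apply; rewrite ge_max !le_min yz pq (le_trans yx xq) (le_trans px xz).
rewrite Rintegral_set0; apply/esym/eqP; rewrite subr_eq0; apply/eqP; congr F.
move: h; rewrite lt_max !gt_min => /orP[/orP[|qy]|/orP[zp|]].
- by rewrite ltNge yz.
- by rewrite !clamp_ge//; lra.
- by rewrite !clamp_le//; lra.
- by rewrite ltNge pq.
Qed.

End clamp.

Section minimization.
Context {R : realType}.
Local Notation mu := (@lebesgue_measure R).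
Local Notation L2 := (Lfun mu 2%:E).
Context (V0 kappa alpha m k : R) (V0_gt0 : 0 < V0) (m_gt0 : 0 < m) (k_gt0 : 0 < k).
Context (mE : m ^+ 2 = kappa * cos alpha) (kE : k = kappa * sin alpha).
Implicit Types (a b : R) (v w g : R -> R).
Local Notation prof := (prof V0 m k).
Local Notation dprof := (dprof V0 m k).
Local Notation lslope := (lslope V0 m k).
Local Notation rslope := (rslope V0 m k).

Definition sessile a b : R -> R := (fun y => prof (b - a) (y - a)) \_ `[a, b].
Definition dsessile a b : R -> R := (fun y => dprof (b - a) (y - a)) \_ `[a, b].

Let der_shift (f : R -> R) (df a y : R) : is_derive (y - a) (1 : R) f df ->
  is_derive y (1 : R) (fun z => f (z - a)) df.
Proof.
move=> h; rewrite -[df]mulr1; apply: (@is_derive1_comp _ f (fun z => z - a)) => //.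
by have := derB (derI y) (derC a y); rewrite subr0.
Qed.

Lemma sessile_clamp a b y : a < b -> sessile a b y = prof (b - a) (clamp a b y - a).
Proof.
move=> ab; have l0 : 0 < b - a by rewrite subr_gt0.
rewrite /sessile patchE; case: ifPn => [|].
  by rewrite inE /= in_itv/= => yab; rewrite clamp_id.
rewrite notin_setE /= in_itv/= => /negP; rewrite negb_and -!ltNge => /orP[ya|by'].
  by rewrite clamp_le// ?ltW// subrr prof0.
by rewrite clamp_ge// ?ltW// prof_end.
Qed.

Lemma sessile_weak_derivative a b : a < b -> weak_derivative (sessile a b) (dsessile a b).
Proof.
move=> ab.
have dp x : is_derive x (1 : R) (fun y => prof (b - a) (y - a)) (dprof (b - a) (x - a)).
  by apply: der_shift; exact: der_prof.
have cd : continuous (fun y => dprof (b - a) (y - a)).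
  by move=> x; apply: is_derive_continuous; apply: der_shift; exact: der_dprof.
split; first exact: L2_patch.
by move=> y z yz; rewrite (patch_primitive dp cd (ltW ab) yz) !sessile_clamp.
Qed.

Lemma sessile_out a b y : a < b -> y \notin `]a, b[ -> sessile a b y = 0.
Proof.
move=> ab; rewrite in_itv/= negb_and -!leNgt => /orP[ya|by'].
  by rewrite sessile_clamp// clamp_le// ?ltW// subrr prof0.
by rewrite sessile_clamp// clamp_ge// ?ltW// prof_end// subr_gt0.
Qed.

Lemma sessile_H10 a a' b : a <= a' -> a' < b -> H10 a b (sessile a' b).
Proof.
move=> aa' a'b; split; first by exists (dsessile a' b); exact: sessile_weak_derivative.
move=> y yab; apply: sessile_out => //; apply: contra yab.
by rewrite !in_itv/= => /andP[y1 ->]; rewrite (le_lt_trans aa' y1).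
Qed.

Lemma sessile_mass a b : a < b -> \int[mu]_y sessile a b y = V0.
Proof.
move=> ab; rewrite /sessile -Rintegral_mkcond.
have di x : is_derive x (1 : R) (fun y => iprof V0 m k (b - a) (y - a)) (prof (b - a) (x - a)).
  by apply: der_shift; exact: der_iprof.
have cp : continuous (fun y => prof (b - a) (y - a)).
  by move=> x; apply: is_derive_continuous; apply: der_shift; exact: der_prof.
by rewrite (Rintegral_derive di cp (ltW ab)) subrr iprof0 iprof_end ?subr0// subr_gt0.
Qed.

Lemma sessile_pos a b y : 0 <= lslope (b - a) -> a < y < b -> 0 < sessile a b y.
Proof.
move=> p0 /andP[ay yb]; have ab := lt_trans ay yb.
rewrite sessile_clamp// clamp_id ?(ltW ay) ?(ltW yb)//.
by apply: prof_gt0 => //; rewrite subr_gt0 ay ltrD2r.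
Qed.

Lemma sessile_ge0 a b y : a < b -> 0 <= lslope (b - a) -> 0 <= sessile a b y.
Proof.
move=> ab p0; have [yab|yab] := boolP (y \in `]a, b[); last by rewrite sessile_out.
by rewrite ltW// sessile_pos.
Qed.

Lemma sessile_class a a' b : a <= a' -> a' < b -> 0 <= lslope (b - a') ->
  profile_class V0 a b (sessile a' b).
Proof.
move=> aa' a'b p0; split; first exact: sessile_H10.
- by move=> y; exact: sessile_ge0.
- exact: sessile_mass.
Qed.

Lemma H10_L2 a b v : H10 a b v -> v \in L2.
Proof.
move=> [[g vg] v0]; have -> : v = v \_ `[a, b].
  apply/funext => y; rewrite patchE; case: ifPn => // yab; rewrite v0//.
  apply: contra yab; rewrite inE /= in_itv/= => /andP[ay yb].
  by rewrite in_itv/= (ltW ay) (ltW yb).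
exact/L2_patch/weak_derivative_continuous/vg.
Qed.

Lemma H10_mulx a b v : H10 a b v -> Rintegrable setT (fun y => v y * y).
Proof.
move=> h; have vL := H10_L2 h; have [_ v0] := h.
have iL : (id : R -> R) \_ `[a, b] \in L2 by apply: L2_patch => x; exact: cvg_id.
have := L2_mul vL iL; congr Rintegrable; apply/funext => y /=; rewrite patchE.
case: ifPn => // yab; rewrite v0 ?mul0r//.
apply: contra yab; rewrite inE /= in_itv/= => /andP[ay yb].
by rewrite in_itv/= (ltW ay) (ltW yb).
Qed.

Lemma H10_integrable a b v : H10 a b v -> Rintegrable setT v.
Proof.
move=> h; have vL := H10_L2 h; have [_ v0] := h.
have iL : (fun=> 1 : R) \_ `[a, b] \in L2 by apply: L2_patch => x; exact: cvg_cst.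
have := L2_mul vL iL; congr Rintegrable; apply/funext => y /=; rewrite patchE.
case: ifPn => [|yab]; first by rewrite mulr1.
rewrite v0 ?mul0r//.
apply: contra yab; rewrite inE /= in_itv/= => /andP[ay yb].
by rewrite in_itv/= (ltW ay) (ltW yb).
Qed.

(** The energy is defined with a chosen weak derivative; this is its density for an
   arbitrary one. *)
Definition density v g y : R := 2^-1 * g y ^+ 2 + m ^+ 2 / 2 * v y ^+ 2 - k * (v y * y).

Lemma density_integrable a b v g : H10 a b v -> g \in L2 ->
  Rintegrable setT (density v g).
Proof.
move=> h gL; apply: RintegrableB => //; last by apply: RintegrableZ => //; exact: H10_mulx h.
apply: RintegrableD => //; apply: RintegrableZ => //; apply: L2_sqr => //.
exact: H10_L2 h.
Qed.

Lemma energyE a b v g : H10 a b v -> weak_derivative v g ->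
  energy kappa alpha v = \int[mu]_y density v g y.
Proof.
move=> h vg; have [gL _] := vg.
have wvg : weak_derivative v (wderiv v) by apply: xgetPex; exists g.
have [wL _] := wvg.
have -> : energy kappa alpha v = \int[mu]_y density v (wderiv v) y.
  apply: eq_Rintegral => y _.
  by rewrite /density real_normK ?num_real// mE kE; field.
congr fine; apply: ae_eq_integral => //.
- by case/integrableP: (density_integrable h wL).
- by case/integrableP: (density_integrable h gL).
apply: (aeS (aeI (weak_derivative_ae wvg) (weak_derivative_ae vg))) => y [D1 D2] _.
have E : wderiv v y = g y.
  by rewrite -(@derive_val _ _ _ _ _ _ _ D1) (@derive_val _ _ _ _ _ _ _ D2).
by rewrite /density /= E.
Qed.

(** Let d = w - W with W the drop on (a', b). The energy of w exceeds that of W by a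
   quadratic form in d plus a linear one. Integration by parts and the equation for W
   turn the linear form into a multiple of the integral of d, which is 0, a boundary
   term at a', which the hypothesis on the contact at a' removes, and the integral of
   - (k y + lam) w over (a, a'), which is nonnegative because the multiplier is negative.
   With a = a' this is the minimality of the drop that fills (a, b); otherwise it solves
   the obstacle problem in which the drop leaves (a, a') dry. *)
Lemma sessile_minimal a a' b w g : a <= a' -> a' < b -> H10 a b w ->
  (forall y, 0 <= w y) -> \int[mu]_y w y = V0 -> weak_derivative w g ->
  0 <= lslope (b - a') -> a = a' \/ lslope (b - a') = 0 ->
  energy kappa alpha (sessile a' b) + 2^-1 * \int[mu]_y ((g y - dsessile a' b y) ^+ 2)
  <= energy kappa alpha w.
Proof.
move=> aa' a'b hw w0 wV wg p0 contact.
have hW := sessile_H10 aa' a'b; have Wg := sessile_weak_derivative a'b.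
have [gL wgE] := wg; have [dL WgE] := Wg.
rewrite (energyE hW Wg) (energyE hw wg).
set W := sessile a' b in hW Wg WgE *; set psi := dsessile a' b in Wg dL WgE *.
pose lam := multiplier V0 m k (b - a') - k * a'.
pose phi y := dprof (b - a') (y - a').
pose dphi y := m ^+ 2 * prof (b - a') (y - a') - k * y - lam.
have phiP y : is_derive y (1 : R) phi (dphi y).
  rewrite (_ : dphi y = m ^+ 2 * prof (b - a') (y - a') - k * (y - a') - multiplier V0 m k (b - a')); last first.
    by rewrite /dphi /lam; ring.
  by apply: der_shift; exact: der_dprof.
have cdphi : continuous dphi.
  move=> y; have dp := der_shift (der_prof V0 k m_gt0 (b - a') (y - a')).
  exact: (is_derive_continuous (derB (derB (derZ (m ^+ 2) dp) (derZ k (derI y))) (derC lam y))).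
pose d y := w y - W y; pose dg y := g y - psi y.
have dgL : dg \in L2 by exact: L2_sub.
have ddg : weak_derivative d dg.
  split => // y z yz; rewrite /d /dg RintegralB//; last 2 first.
  - exact: L2_integrable.
  - exact: L2_integrable.
  by rewrite -wgE// -WgE//; ring.
pose part := (fun y => phi y * dg y + dphi y * d y) \_ `[a', b].
have ipart : Rintegrable setT part.
  rewrite /Rintegrable /part -restrict_EFin; apply/(integrable_mkcond _ _).1 => //.
  apply: RintegrableD => //; apply: L2_mul_itv => //.
  - by move=> y; exact: (is_derive_continuous (phiP y)).
  - by apply: L2_sub; [exact: H10_L2 hw | exact: H10_L2 hW].
have part0 : \int[mu]_y part y = 0.
  rewrite /part -Rintegral_mkcond (weak_integration_by_parts ddg phiP cdphi (ltW a'b)).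
  have [_ wout] := hw; have [_ Wout] := hW.
  have Wa' : W a' = 0 by rewrite /W sessile_out// in_itv/= ltxx.
  have wb : w b = 0 by rewrite wout// in_itv/= ltxx andbF.
  have Wb : W b = 0 by rewrite Wout// in_itv/= ltxx andbF.
  rewrite /d wb Wb Wa' !subr0 mulr0 sub0r.
  have [aE|q0] := contact.
    by rewrite wout ?mulr0 ?oppr0// in_itv/= aE ltxx.
  by rewrite /phi subrr dprof0 q0 mul0r oppr0.
have id0 : Rintegrable setT d by apply: RintegrableB => //; [exact: H10_integrable hw | exact: H10_integrable hW].
have d0 : \int[mu]_y d y = 0.
  rewrite RintegralB//; [|exact: H10_integrable hw|exact: H10_integrable hW].
  by rewrite wV sessile_mass// subrr.
have iW := density_integrable hW dL; have iw := density_integrable hw gL.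
have idg2 := L2_sqr dgL.
have i1 : Rintegrable setT (fun y => 2^-1 * dg y ^+ 2) by exact: RintegrableZ.
have i2 : Rintegrable setT (fun y => lam * d y) by exact: RintegrableZ.
have i3 : Rintegrable setT (fun y => part y + lam * d y) by exact: RintegrableD.
have i4 : Rintegrable setT (fun y => density W psi y + 2^-1 * dg y ^+ 2) by exact: RintegrableD.
have -> : (\int[mu]_y (density W psi y)) + 2^-1 * (\int[mu]_y ((g y - psi y) ^+ 2)) =
  \int[mu]_y (density W psi y + 2^-1 * dg y ^+ 2 + (part y + lam * d y)).
  rewrite (RintegralD _ i4 i3)// (RintegralD _ iW i1)// (RintegralD _ ipart i2)//.
  rewrite (RintegralZl _ _ idg2)// (RintegralZl _ _ id0)// part0 d0 mulr0 !addr0.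
  by [].
apply: le_Rintegral => //; first exact: RintegrableD.
move=> y _.
have key : part y + lam * d y <= psi y * dg y + (m ^+ 2 * W y - k * y) * d y.
  have [ya|ya] := boolP (y \in `[a', b]).
    have E : part y = phi y * dg y + dphi y * d y.
      by rewrite /part patchE mem_set//.
    have E1 : psi y = phi y by rewrite /psi /dsessile patchE mem_set.
    have E2 : W y = prof (b - a') (y - a') by rewrite /W /sessile patchE mem_set.
    by rewrite E E1 /dphi -E2; lra.
  have E : part y = 0 by rewrite /part patchE memNset//; apply/negP.
  have E1 : psi y = 0 by rewrite /psi /dsessile patchE memNset//; apply/negP.
  have E2 : W y = 0 by rewrite /W /sessile patchE memNset//; apply/negP.
  rewrite E E1 E2 !mul0r mulr0 !add0r -subr_ge0.
  rewrite (_ : _ - _ = (- (k * y) - lam) * d y); last by ring.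
  have dE : d y = w y by rewrite /d E2 subr0.
  move: ya; rewrite in_itv/= negb_and -!ltNge => /orP[ya|by'].
    rewrite dE; have [aE|q0] := contact.
      have [_ ->] := hw; first by rewrite mulr0.
      by rewrite in_itv/= aE ltNge (ltW ya).
    rewrite mulr_ge0// /lam.
    have l0 : 0 < b - a' by rewrite subr_gt0.
    have := multiplier_lt0 m_gt0 k_gt0 l0 q0.
    have : k * y <= k * a' by rewrite ler_pM2l// ltW.
    lra.
  have [_ w0'] := hw; rewrite dE w0' ?mulr0//.
  by rewrite in_itv/= [y < b]ltNge (ltW by') andbF.
have sq : 0 <= m ^+ 2 / 2 * d y ^+ 2 by rewrite mulr_ge0 ?divr_ge0 ?sqr_ge0.
rewrite /density; rewrite /d /dg in key sq *.
lra.
Qed.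

(** Equality of the energies leaves no room for the Dirichlet term of the difference,
   so that the two functions have the same increments. *)
Lemma obstacle_unique a a' b v : a <= a' -> a' < b ->
  0 <= lslope (b - a') -> a = a' \/ lslope (b - a') = 0 ->
  drop_profile kappa alpha V0 a b v -> v = sessile a' b.
Proof.
move=> aa' a'b p0 contact [_ [hv v0 vV] vmin].
have [[g vg] vout] := hv; have [gL vgE] := vg.
have cW := sessile_class aa' a'b p0; have [[_ Wout] _ _] := cW.
have [dL WgE] := sessile_weak_derivative a'b.
have := vmin _ cW; have := sessile_minimal aa' a'b hv v0 vV vg p0 contact.
set I := \int[mu]_y _ => h1 h2.
have I0 : I <= 0 by lra.
have dgL : (fun y => g y - dsessile a' b y) \in L2 by exact: L2_sub.
have inc y z : y <= z -> v z - v y = sessile a' b z - sessile a' b y.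
  move=> yz; apply/eqP; rewrite -subr_eq0 -normr_le0.
  rewrite vgE// WgE// -RintegralB//; last 2 first.
  - exact: L2_integrable.
  - exact: L2_integrable.
  apply/ler_addgt0Pr => e e0; rewrite add0r.
  have dgi : Rintegrable `[y, z] (fun y => g y - dsessile a' b y) by exact: L2_integrable.
  apply: (le_trans (le_normr_Rintegral _ dgi)) => //.
  have d0 : 0 < (z - y + 1) / e by rewrite divr_gt0//; lra.
  apply: (le_trans (L2_itv_le dgL yz d0)); rewrite -/I.
  have t1 : (z - y + 1) / e / 2 * I <= 0 by rewrite mulr_ge0_le0// ltW// divr_gt0.
  have t2 : (z - y) / (2 * ((z - y + 1) / e)) <= e.
    have s0 : 0 <= z - y by rewrite subr_ge0.
    move: (z - y) s0 => s s0; have s1 : s + 1 != 0 by rewrite gt_eqF//; lra.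
    have -> : s / (2 * ((s + 1) / e)) = s / (2 * (s + 1)) * e.
      by field; rewrite s1 gt_eqF.
    by rewrite ler_piMl ?(ltW e0)// ler_pdivrMr; lra.
  lra.
apply/funext => y; pose y0 := Num.min y a.
have y0a : y0 \notin `]a, b[ by rewrite in_itv/= negb_and -leNgt ge_min lexx orbT.
have := inc y0 y; rewrite ge_min lexx => /(_ isT).
by rewrite (vout _ y0a) (Wout _ y0a) !subr0.
Qed.

Lemma sessile_is_profile a b : a < b -> 0 <= lslope (b - a) ->
  drop_profile kappa alpha V0 a b (sessile a b).
Proof.
move=> ab p0; split; last 2 first.
- exact: sessile_class.
- move=> w [hw w0 wV]; have [[g wg] _] := hw.
  apply: le_trans (sessile_minimal (lexx a) ab hw w0 wV wg p0 (or_introl erefl)).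
  by rewrite lerDl mulr_ge0//; apply: Rintegral_ge0 => y _; exact: sqr_ge0.
apply/seteqP; split => y /=; rewrite in_itv/=; last exact: sessile_pos.
move=> dy; apply/negPn/negP => yab; move: dy.
by rewrite sessile_out ?ltxx// in_itv.
Qed.

(** On an interval longer than the critical length the minimizer is the drop of critical
   length at the right end. It vanishes near a, which contradicts positivity. *)
Lemma drop_profileP a b v : drop_profile kappa alpha V0 a b v ->
  [/\ a < b, 0 <= lslope (b - a) & v = sessile a b].
Proof.
move=> vP; have [vpos [[_ vout] v0 vV] _] := vP.
have ab : a < b.
  rewrite ltNge; apply/negP => ba.
  have : \int[mu]_y v y = 0.
    rewrite (_ : v = fun=> 0); first by rewrite Rintegral_cst// mul0r.
    apply/funext => y; apply: vout; rewrite in_itv/=; apply/negP => /andP[ay yb].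
    by have := lt_trans ay yb; rewrite ltNge ba.
  by move=> V00; move: V0_gt0; rewrite -vV V00 ltxx.
have p0 : 0 <= lslope (b - a).
  rewrite leNgt; apply/negP => p0.
  have [l l0 pl] := critical_length V0_gt0 m_gt0 k_gt0.
  have lba : l < b - a.
    rewrite ltNge; apply/negP; rewrite le_eqVlt => /orP[/eqP E|E].
      by move: p0; rewrite E pl ltxx.
    have := lslope_decr V0_gt0 m_gt0 k_gt0 (_ : 0 < b - a) E; rewrite subr_gt0 pl => /(_ ab).
    by move=> /(lt_trans p0); rewrite ltxx.
  have aa' : a <= b - l by lra.
  have a'b : b - l < b by lra.
  have bl : b - (b - l) = l by ring.
  have vE : v = sessile (b - l) b.
    apply: (obstacle_unique aa' a'b _ _ vP); rewrite bl pl//; by right.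
  have : [set y | 0 < v y] ((a + (b - l)) / 2) by rewrite vpos /= in_itv/=; apply/andP; split; lra.
  rewrite /= vE sessile_out ?ltxx// in_itv/= negb_and -leNgt; apply/orP; left; lra.
split => //; apply: (obstacle_unique _ _ _ _ vP) => //; by left.
Qed.

Let der_cvg (f : R -> R) (x df : R) : is_derive x (1 : R) f df ->
  h^-1 * (f (x + h) - f x) @[h --> 0^'] --> df.
Proof.
move=> [drv dE]; have H : h^-1 *: (f (h *: 1 + x) - f x) @[h --> 0^'] --> df.
  by rewrite -dE; exact: drv.
apply: cvg_trans H; apply: near_eq_cvg; near=> h.
by rewrite [h *: 1]mulr1 (addrC h x).
Unshelve. all: by end_near. Qed.

Lemma sessile_right_derivative a b p : a < b ->
  right_derivative (sessile a b) a p <-> p = lslope (b - a).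
Proof.
move=> ab.
have H : right_derivative (sessile a b) a (lslope (b - a)).
  have := der_cvg (der_prof V0 k m_gt0 (b - a) 0).
  rewrite dprof0 => /cvg_dnbhs_at_right; apply: cvg_trans; apply: near_eq_cvg; near=> h.
  have h0 : 0 < h by near: h; exact: nbhs_right_gt.
  have hb : h < b - a by near: h; apply: nbhs_right_lt; rewrite subr_gt0.
  rewrite !sessile_clamp// !clamp_id ?lexx ?(ltW ab)//; last by apply/andP; split; lra.
  by rewrite subrr (_ : a + h - a = 0 + h)//; ring.
by split => [Hp|->//]; exact: (cvg_unique _ Hp H).
Unshelve. all: by end_near. Qed.

Lemma sessile_left_derivative a b p : a < b ->
  left_derivative (sessile a b) b p <-> p = - rslope (b - a).
Proof.
move=> ab.
have H : left_derivative (sessile a b) b (- rslope (b - a)).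
  have := der_cvg (der_prof V0 k m_gt0 (b - a) (b - a)).
  rewrite dprof_end ?subr_gt0// => /cvg_dnbhs_at_left; apply: cvg_trans; apply: near_eq_cvg; near=> h.
  have h0 : h < 0 by near: h; exact: nbhs_left_lt.
  have hb : a - b < h by near: h; apply: nbhs_left_gt; rewrite subr_lt0.
  rewrite !sessile_clamp// !clamp_id ?lexx ?(ltW ab)//; last by apply/andP; split; lra.
  by congr (_ * (prof _ _ - _)); ring.
by split => [Hp|->//]; exact: (cvg_unique _ Hp H).
Unshelve. all: by end_near. Qed.

End minimization.

(** * Limits of motions in a fast oscillating medium *)

Section preliminaries.
Context {R : realType}.
Local Notation mu := (@lebesgue_measure R).
Implicit Types (f x : R -> R).

Lemma is_derive_expansion f (t d e : R) : is_derive t (1 : R) f d -> 0 < e ->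
  \forall s \near t, `|f s - f t - d * (s - t)| <= e * `|s - t|.
Proof.
move=> [drv dE] e0.
have H : h^-1 *: (f (h *: 1 + t) - f t) @[h --> 0^'] --> d by rewrite -dE; exact: drv.
move/cvgrPdist_lt : H => /(_ _ e0) /nbhs_ballP[r /= r0 rP].
apply/nbhs_ballP; exists r => //= s ts.
have [->|nst] := eqVneq s t; first by rewrite !subrr mulr0 subr0 normr0 mulr0.
have ts' : `|s - t| < r by rewrite distrC.
have := rP (s - t); rewrite /ball/= sub0r normrN => /(_ ts').
rewrite subr_eq0 => /(_ nst).
rewrite -[_ *: (_ - _)]/(_ * _) [(s - t) *: 1]mulr1 subrK => q.
have n0 : s - t != 0 by rewrite subr_eq0.
have -> : f s - f t - d * (s - t) = - (d - (s - t)^-1 * (f s - f t)) * (s - t) by field.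
by rewrite normrM normrN ler_wpM2r// ltW.
Qed.

Lemma expansion_is_derive f (t d : R) :
  (forall e, 0 < e -> \forall s \near t, `|f s - f t - d * (s - t)| <= e * `|s - t|) ->
  is_derive t (1 : R) f d.
Proof.
move=> H.
have C : h^-1 *: (f (h *: 1 + t) - f t) @[h --> 0^'] --> d.
  apply/cvgrPdist_le => e e0; have /nbhs_ballP[r /= r0 rP] := H _ e0.
  apply/nbhs_ballP; exists r => //= h hr hn0.
  have := rP (h + t); rewrite /ball/= opprD addrCA subrr addr0 normrN addrK.
  move: hr; rewrite /ball/= sub0r normrN => hr /(_ hr) q.
  rewrite -[_ *: (_ - _)]/(_ * _) [h *: 1]mulr1.
  have -> : d - h^-1 * (f (h + t) - f t) = - (f (h + t) - f t - d * h) * h^-1 by field.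
  by rewrite normrM normrN normfV ler_pdivrMr ?normr_gt0.
by constructor; [apply/cvg_ex; exists d | exact: (cvg_lim _ C)].
Qed.

Lemma is_derive_max f (t d : R) : is_derive t (1 : R) f d ->
  (\forall s \near t, f s <= f t) -> d = 0.
Proof.
move=> fd /nbhs_ballP[r1 /= r10 P1].
have [//|d0] := eqVneq d 0; exfalso.
have e0 : 0 < `|d| / 2 by rewrite divr_gt0 ?normr_gt0.
have /nbhs_ballP[r2 /= r20 P2] := is_derive_expansion fd e0.
pose r := Num.min r1 r2 / 2.
have r0 : 0 < r by rewrite divr_gt0// lt_min r10.
have rr1 : r < r1.
  by rewrite ltr_pdivrMr// (le_lt_trans (_ : _ <= r1)) ?ge_min ?lexx//; lra.
have rr2 : r < r2.
  by rewrite ltr_pdivrMr// (le_lt_trans (_ : _ <= r2)) ?ge_min ?lexx ?orbT//; lra.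
clearbody r.
have sE : t + Num.sg d * r - t = Num.sg d * r by ring.
have nr : `|Num.sg d * r| = r by rewrite normrM normr_sg d0 mul1r gtr0_norm.
have := P1 (t + Num.sg d * r); have := P2 (t + Num.sg d * r).
rewrite /ball/= distrC sE nr mulrA (mulrC d) -normrEsg.
move=> /(_ rr2) h1 /(_ rr1) h2.
have dr : 0 < `|d| * r by rewrite mulr_gt0 ?normr_gt0.
move: h1; rewrite ler_norml; lra.
Qed.

Lemma lipschitz_halflineP f :
  [lipschitz f t | t in `[0, +oo[%classic] <->
  exists L, forall s t, 0 <= s -> 0 <= t -> `|f s - f t| <= L * `|s - t|.
Proof.
split.
  move=> /pinfty_ex_gt0[L L0 H]; exists L => s t s0 t0.
  by apply: (H (s, t)); split; rewrite /= in_itv/= andbT.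
move=> [L H]; rewrite /lipschitz_on; near=> M; move=> [s t] [/=].
rewrite !in_itv/= !andbT => s0 t0 /=; apply: (le_trans (H _ _ s0 t0)).
by rewrite ler_wpM2r//; near: M; apply: nbhs_pinfty_ge; exact: num_real.
Unshelve. all: by end_near. Qed.

Lemma lipschitz_lineP f :
  [lipschitz f t | t in setT] ->
  exists2 L, 0 < L & forall s t, `|f s - f t| <= L * `|s - t|.
Proof.
by move=> /pinfty_ex_gt0[L L0 H]; exists L => // s t; apply: (H (s, t)).
Qed.

Lemma ultra_fmap (S T : Type) (U : set_system S) (f : S -> T) :
  UltraFilter U -> UltraFilter (fmap f U).
Proof.
move=> UU; split; first exact: fmap_proper_filter.
move=> G GG UG; apply/seteqP; split=> // A GA.
have [//|UA] := in_ultra_setVsetC (f @^-1` A) UU.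
have GAA : G (A `&` ~` A) by apply: filterI => //; exact: UG.
by have [x []] := filter_ex GAA.
Qed.

Lemma ultra_bounded_cvg (T : Type) (U : set_system T) (f : T -> R) (p q : R) :
  UltraFilter U -> U [set e | p <= f e <= q] ->
  exists l : R, f @ U --> l.
Proof.
move=> UU pfq; have := @segment_compact R p q; rewrite compact_ultra.
move=> /(_ (f @ U) (ultra_fmap f UU)) [].
  have H : U (f @^-1` `[p, q]%classic) by apply: filterS pfq => e; rewrite /= in_itv.
  exact: H.
by move=> l [_ h]; exists l.
Qed.

(** A bounded number of periods costs O(e), so that in the limit only the effective
   speed of the driving force q is seen. *)
Lemma limit_displacement_le beta (P q sg c d xc xd L : R) (F : set_system R)
    (x : R -> R -> R) :
  oscillating beta P -> ProperFilter F -> (fun e => e) @ F --> (0 : R) ->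
  (\forall e \near F, 0 < e) -> c <= d -> `|sg| = 1 ->
  (\forall e \near F, forall s t, c <= s <= d -> c <= t <= d ->
     `|x e s - x e t| <= L * `|s - t|) ->
  (\forall e \near F, {ae mu, forall t, c < t < d ->
     exists2 dx, is_derive t (1 : R) (x e) dx & sg * dx <= q - beta (x e t / e)}) ->
  (fun e => x e c) @ F --> xc -> (fun e => x e d) @ F --> xd ->
  sg * (xd - xc) <= speed beta P q * (d - c).
Proof.
move=> h FF F0 Fpos cd sg1 lipx aex cxc cxd.
apply/ler_addgt0Pr => eta0 eta00.
have dc : 0 < d - c + 1 by lra.
have eta_gt0 : 0 < eta0 / (d - c + 1) by rewrite divr_gt0.
have [C CP] := displacement_le q h eta_gt0.
have H1 : (fun e => sg * (x e d - x e c)) @ F --> sg * (xd - xc).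
  by apply: cvgM; [exact: cvg_cst | exact: cvgB].
set r := speed beta P q in CP *; set eta := eta0 / _ in CP eta_gt0.
have H2 : (fun e => (r + eta) * (d - c) + C * e) @ F --> (r + eta) * (d - c) + C * 0.
  by apply: cvgD; [exact: cvg_cst | apply: cvgM; [exact: cvg_cst | exact: F0]].
have : sg * (xd - xc) <= (r + eta) * (d - c) + C * 0.
  apply: (ler_cvg_to H1 H2); near=> e.
  by apply: (CP e sg c d L (x e)) => //; near: e.
move=> H3; apply: (le_trans H3).
have : eta * (d - c) <= eta0.
  have E : eta * (d - c + 1) = eta0 by rewrite /eta divfK// gt_eqF.
  by rewrite -E ler_pM2l//; lra.
lra.
Unshelve. all: by end_near. Qed.

Lemma limit_displacement_ge beta (P q sg c d xc xd L : R) (F : set_system R)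
    (x : R -> R -> R) :
  oscillating beta P -> ProperFilter F -> (fun e => e) @ F --> (0 : R) ->
  (\forall e \near F, 0 < e) -> c <= d -> `|sg| = 1 ->
  (\forall e \near F, forall s t, c <= s <= d -> c <= t <= d ->
     `|x e s - x e t| <= L * `|s - t|) ->
  (\forall e \near F, {ae mu, forall t, c < t < d ->
     exists2 dx, is_derive t (1 : R) (x e) dx & q - beta (x e t / e) <= sg * dx}) ->
  (fun e => x e c) @ F --> xc -> (fun e => x e d) @ F --> xd ->
  speed beta P q * (d - c) <= sg * (xd - xc).
Proof.
move=> h FF F0 Fpos cd sg1 lipx aex cxc cxd.
apply/ler_addgt0Pr => eta0 eta00.
have dc : 0 < d - c + 1 by lra.
have eta_gt0 : 0 < eta0 / (d - c + 1) by rewrite divr_gt0.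
have [C CP] := displacement_ge q h eta_gt0.
have H1 : (fun e => sg * (x e d - x e c)) @ F --> sg * (xd - xc).
  by apply: cvgM; [exact: cvg_cst | exact: cvgB].
set r := speed beta P q in CP *; set eta := eta0 / _ in CP eta_gt0.
have H2 : (fun e => (r - eta) * (d - c) - C * e) @ F --> (r - eta) * (d - c) - C * 0.
  by apply: cvgB; [exact: cvg_cst | apply: cvgM; [exact: cvg_cst | exact: F0]].
have : (r - eta) * (d - c) - C * 0 <= sg * (xd - xc).
  apply: (ler_cvg_to H2 H1); near=> e.
  by apply: (CP e sg c d L (x e)) => //; near: e.
move=> H3.
have : eta * (d - c) <= eta0.
  have E : eta * (d - c + 1) = eta0 by rewrite /eta divfK// gt_eqF.
  by rewrite -E ler_pM2l//; lra.
lra.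
Unshelve. all: by end_near. Qed.

End preliminaries.

(** * The motion of the contact points *)

Section edges.
Context {R : realType}.
Local Notation mu := (@lebesgue_measure R).
Context (V0 kappa alpha m k : R) (V0_gt0 : 0 < V0) (m_gt0 : 0 < m) (k_gt0 : 0 < k).
Context (mE : m ^+ 2 = kappa * cos alpha) (kE : k = kappa * sin alpha).
Local Notation lslope := (lslope V0 m k).
Local Notation rslope := (rslope V0 m k).
Local Notation sessile := (sessile V0 m k).
Implicit Types (a b : R -> R) (t : R).

(** The driving forces at the two contact points of a drop of length l. *)
Definition lforce (l : R) : R := 2^-1 * lslope l ^+ 2.
Definition rforce (l : R) : R := 2^-1 * rslope l ^+ 2.

(** The contact point conditions, with the profile eliminated: the slopes are functions
   of the length. The minimum with the left slope becomes a reflection: a drop of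
   critical length, the only one whose left slope vanishes, may be dragged along by its
   right end. *)
Definition edge_motion (F : R -> R -> R) a b : Prop :=
  [/\ exists L, forall s t, 0 <= s -> 0 <= t ->
        `|a s - a t| <= L * `|s - t| /\ `|b s - b t| <= L * `|s - t|,
      forall t, 0 <= t -> a t < b t /\ 0 <= lslope (b t - a t) &
      {ae mu, forall t, 0 < t -> exists da db : R,
        [/\ is_derive t (1 : R) a da, is_derive t (1 : R) b db,
            0 <= da + F (a t) (lforce (b t - a t)),
            0 < lslope (b t - a t) -> da + F (a t) (lforce (b t - a t)) = 0 &
            db = F (b t) (rforce (b t - a t))]}].

Lemma drop_solution_edges F (a0 b0 : R) u :
  drop_solution F kappa alpha V0 a0 b0 u ->
  exists a b, [/\ edge_motion F a b, a 0 = a0, b 0 = b0 &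
    forall t, 0 <= t -> forall y, u y t = sessile (a t) (b t) y].
Proof.
move=> [a [b [[La Lb] [a0E b0E] prf aea aeb]]]; exists a, b.
have prfP t : 0 <= t -> [/\ a t < b t, 0 <= lslope (b t - a t) &
    (fun y => u y t) = sessile (a t) (b t)].
  by move=> t0; exact: (drop_profileP V0_gt0 m_gt0 k_gt0 mE kE (prf t t0)).
split => //; last by move=> t t0 y; have [_ _ /(congr1 (@^~ y))] := prfP t t0.
split.
- have [L1 h1] := (lipschitz_halflineP _).1 La.
  have [L2 h2] := (lipschitz_halflineP _).1 Lb.
  exists (`|L1| + `|L2|) => s t s0 t0.
  have n1 : L1 <= `|L1| + `|L2| by have := ler_norm L1; have := normr_ge0 L2; lra.
  have n2 : L2 <= `|L1| + `|L2| by have := ler_norm L2; have := normr_ge0 L1; lra.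
  by split; [apply: (le_trans (h1 _ _ s0 t0)) | apply: (le_trans (h2 _ _ s0 t0))];
    rewrite ler_wpM2r.
- by move=> t /prfP[].
- apply: (aeS (aeI aea aeb)) => t [ha hb] t0.
  have [ab p0 uE] := prfP t (ltW t0).
  have [da [p [dap pE pmin]]] := ha (ltW t0).
  have [db [q [dbq qE qmin]]] := hb (ltW t0).
  exists da, db; move: pE qE pmin qmin; rewrite uE.
  move=> /(sessile_right_derivative V0 k m_gt0 _ ab) ->.
  move=> /(sessile_left_derivative V0 k m_gt0 _ ab) ->.
  have q0 : 0 < rslope (b t - a t) by apply: rslope_gt0 => //; rewrite subr_gt0.
  rewrite normrN (ger0_norm p0) (gtr0_norm q0).
  rewrite -/(lforce _) -/(rforce _) => pmin qmin.
  split => //.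
  + by rewrite -pmin ge_min lexx.
  + move=> p00; move: pmin; rewrite minEle; case: ifP => _ pE; first exact: pE.
    by move: p00; rewrite pE ltxx.
  + move: qmin; rewrite minEle; case: ifP => _ qE; last by move: q0; rewrite qE ltxx.
    lra.
Qed.

Lemma edges_drop_solution F a b : edge_motion F a b ->
  drop_solution F kappa alpha V0 (a 0) (b 0) (fun y t => sessile (a t) (b t) y).
Proof.
move=> [[L LP] ab ae]; exists a, b.
(* at t = 0 the derivatives would involve a and b at negative times *)
have n0 : {ae mu, forall t, t <> 0}.
  exists [set 0]; split => //; first exact: lebesgue_measure_set1.
  by move=> t /= /contrapT.
split => //.
- by split; apply/lipschitz_halflineP; exists L => s t s0 t0; have [] := LP s t s0 t0.
- move=> t t0; have [h1 h2] := ab t t0.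
  exact: (sessile_is_profile m_gt0 k_gt0 mE kE h1 h2).
- apply: (aeS (aeI n0 ae)) => t [/eqP tn0 h] t0.
  have tp : 0 < t by rewrite lt_neqAle eq_sym tn0.
  have [da [db [h1 h2 h3 h4 h5]]] := h tp; have [abt p0] := ab t t0.
  exists da, (lslope (b t - a t)); split => //.
    by apply/(sessile_right_derivative V0 k m_gt0 _ abt).
  rewrite (ger0_norm p0) -/(lforce _); set x := da + _ in h3 h4 *.
  have [p00|p00] := ltP 0 (lslope (b t - a t)); first by rewrite h4// minEle p0.
  have -> : lslope (b t - a t) = 0 by apply/eqP; rewrite eq_le p00 p0.
  by rewrite minEle; case: ifP => // xle; apply/eqP; rewrite eq_le xle h3.
- apply: (aeS (aeI n0 ae)) => t [/eqP tn0 h] t0.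
  have tp : 0 < t by rewrite lt_neqAle eq_sym tn0.
  have [da [db [h1 h2 h3 h4 h5]]] := h tp; have [abt p0] := ab t t0.
  have q0 : 0 < rslope (b t - a t) by apply: rslope_gt0 => //; rewrite subr_gt0.
  exists db, (- rslope (b t - a t)); split => //.
    by apply/(sessile_left_derivative V0 k m_gt0 _ abt).
  by rewrite normrN (gtr0_norm q0) -/(rforce _) -h5 addNr minEle (ltW q0).
Qed.

Lemma lforce_nincr (l l' : R) : 0 < l -> l <= l' -> 0 <= lslope l' ->
  lforce l' <= lforce l.
Proof.
move=> l0; rewrite le_eqVlt => /orP[/eqP->//|ll' p0].
have := lslope_decr V0_gt0 m_gt0 k_gt0 l0 ll' => d.
by rewrite ler_pM2l// ler_sqr ?nnegrE//; lra.
Qed.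

Lemma rforce_nincr (l l' : R) : 0 < l -> l <= l' -> 0 <= lslope l' ->
  rforce l' <= rforce l.
Proof.
move=> l0 ll' p0; have l'0 := lt_le_trans l0 ll'.
by rewrite ler_pM2l// ler_sqr ?nnegrE; [exact: rslope_decr | exact/ltW/rslope_gt0 | exact/ltW/rslope_gt0].
Qed.

Lemma lforce_le_rforce (l : R) : 0 < l -> 0 <= lslope l -> lforce l <= rforce l.
Proof.
move=> l0 p0; have := lslope_lt_rslope V0 m_gt0 k_gt0 l0 => h.
by rewrite ler_pM2l// ler_sqr ?nnegrE//; lra.
Qed.

(** Both forces are nonincreasing functions of the length, so that the length solves
   l' = f l with a nonincreasing f, and a reflection at the critical length that can only
   slow it down. Two lengths with the same initial value thus never separate, and the
   length determines the speed of b. *)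
Lemma edge_motion_unique (r : R -> R) a1 b1 a2 b2 :
  {homo r : x y / x <= y} ->
  edge_motion (fun _ q => r q) a1 b1 -> edge_motion (fun _ q => r q) a2 b2 ->
  a1 0 = a2 0 -> b1 0 = b2 0 -> forall t, 0 <= t -> a1 t = a2 t /\ b1 t = b2 t.
Proof.
move=> rmono.
have length_le a b a' b' t : edge_motion (fun _ q => r q) a b ->
    edge_motion (fun _ q => r q) a' b' ->
    a 0 = a' 0 -> b 0 = b' 0 -> 0 <= t -> b t - a t <= b' t - a' t.
  move=> [[L LP] ab ae] [[L' LP'] ab' ae'] a0 b0 t0.
  pose f s := (b s - a s) - (b' s - a' s).
  suff : f t <= 0 by rewrite /f subr_le0.
  apply: (@ae_barrier R f (2 * L + 2 * L') 0 t) => //.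
  - move=> s s' /andP[s0 _] /andP[s'0 _].
    have [h1 h2] := LP _ _ s0 s'0; have [h3 h4] := LP' _ _ s0 s'0.
    rewrite (_ : f s - f s' = ((b s - b s') - (a s - a s')) - ((b' s - b' s') - (a' s - a' s'))); last by rewrite /f; ring.
    rewrite (le_trans (ler_normB _ _))//.
    have := ler_normB (b s - b s') (a s - a s').
    have := ler_normB (b' s - b' s') (a' s - a' s').
    lra.
  - apply: (aeS (aeI ae ae')) => s [h h'] /andP[s0 _] fs.
    have [da [db [D1 D2 D3 D4 D5]]] := h s0.
    have [da' [db' [E1 E2 E3 E4 E5]]] := h' s0.
    have [abs p0] := ab s (ltW s0); have [abs' p0'] := ab' s (ltW s0).
    exists ((db - da) - (db' - da')).
      exact: (is_deriveB (is_deriveB D2 D1) (is_deriveB E2 E1)).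
    have l'0 : 0 < b' s - a' s by rewrite subr_gt0.
    have ll : b' s - a' s < b s - a s by move: fs; rewrite /f subr_gt0.
    have pp : 0 < lslope (b' s - a' s).
      exact: (le_lt_trans p0 (lslope_decr V0_gt0 m_gt0 k_gt0 l'0 ll)).
    have := E4 pp.
    have := rmono _ _ (lforce_nincr l'0 (ltW ll) p0).
    have := rmono _ _ (rforce_nincr l'0 (ltW ll) p0).
    rewrite D5 E5; lra.
  - by rewrite /f a0 b0 subrr.
move=> em1 em2 a0 b0 t t0.
have lE s : 0 <= s -> b1 s - a1 s = b2 s - a2 s.
  by move=> s0; apply/eqP; rewrite eq_le; apply/andP; split; exact: length_le.
have bE : b1 t = b2 t.
  have [[L LP] ab ae] := em1; have [[L' LP'] ab' ae'] := em2.
  pose f s := b1 s - b2 s.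
  have lipf s s' : 0 <= s <= t -> 0 <= s' <= t -> `|f s - f s'| <= (L + L') * `|s - s'|.
    move=> /andP[s0 _] /andP[s'0 _].
    have [h1 h2] := LP _ _ s0 s'0; have [h3 h4] := LP' _ _ s0 s'0.
    rewrite (_ : f s - f s' = (b1 s - b1 s') - (b2 s - b2 s')); last by rewrite /f; ring.
    by rewrite (le_trans (ler_normB _ _))//; lra.
  have aef : {ae mu, forall s, 0 < s < t -> is_derive s (1 : R) f 0}.
    apply: (aeS (aeI ae ae')) => s [h h'] /andP[s0 _].
    have [da [db [D1 D2 D3 D4 D5]]] := h s0.
    have [da' [db' [E1 E2 E3 E4 E5]]] := h' s0.
    have := is_deriveB D2 E2; rewrite D5 E5 lE ?subrr//; exact: ltW.
  have h1 : f t - f 0 <= 0 * (t - 0).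
    by apply: (ae_slope_le lipf) t0; apply: (aeS aef) => s hs /hs; exists 0.
  have h2 : 0 * (t - 0) <= f t - f 0.
    by apply: (ae_slope_ge lipf) t0; apply: (aeS aef) => s hs /hs; exists 0.
  by rewrite /f b0 in h1 h2; lra.
split => //; have := lE t t0; rewrite bE; lra.
Qed.

End edges.

(** * Homogenization of the contact points *)

Section homogenization.
Context {R : realType}.
Local Notation mu := (@lebesgue_measure R).
Context (V0 m k : R) (V0_gt0 : 0 < V0) (m_gt0 : 0 < m) (k_gt0 : 0 < k).
Local Notation lslope := (lslope V0 m k).
Local Notation rslope := (rslope V0 m k).
Local Notation lforce := (lforce V0 m k).
Local Notation rforce := (rforce V0 m k).
Local Notation edge_motion := (edge_motion V0 m k).
Context (beta : R -> R) (P : R) (osc : oscillating beta P).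
Context (a_ b_ : R -> R -> R) (a0 b0 : R).
Context (em : forall e : R, 0 < e ->
  edge_motion (fun y q => q - beta (y / e)) (a_ e) (b_ e)).
Context (a_0 : forall e : R, 0 < e -> a_ e 0 = a0) (b_0 : forall e : R, 0 < e -> b_ e 0 = b0).

Lemma lforce_ge0 l : 0 <= lforce l.
Proof. by rewrite mulr_ge0// sqr_ge0. Qed.

Lemma oscillating_bounded : exists2 M, 0 <= M & forall y, `|beta y| <= M.
Proof.
have [y ymax] := oscillating_max osc; have [z zmin] := oscillating_min osc.
exists (`|beta y| + `|beta z|) => [|x]; first by rewrite addr_ge0.
have := ymax x; have := zmin x; have := ler_norm (beta y); have := ler_norm (- beta z).
rewrite normrN; have := normr_ge0 (beta y); have := normr_ge0 (beta z).
by rewrite ler_norml; lra.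
Qed.

(** The steep edges of a short drop overcome the medium, so that short drops spread. *)
Lemma length_bounded_below : a0 < b0 ->
  exists2 l, 0 < l & forall e t, 0 < e -> 0 <= t -> l <= b_ e t - a_ e t.
Proof.
move=> ab0.
have [M M0 bM] := oscillating_bounded.
have M2 : 0 <= 2 * M by rewrite mulr_ge0.
have [l1 l10 l1P] := rslope_large V0_gt0 m_gt0 k_gt0 M2.
pose l := Num.min l1 (b0 - a0).
have l0 : 0 < l by rewrite lt_min l10 subr_gt0.
have ll1 : l <= l1 by rewrite ge_min lexx.
have ll0 : l <= b0 - a0 by rewrite ge_min lexx orbT.
clearbody l; exists l => // e t e0 t0.
have [[L LP] ab ae] := em e0.
rewrite -subr_le0.
apply: (@ae_barrier R (fun t => l - (b_ e t - a_ e t)) (2 * L) 0 t) => //.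
- move=> s s' /andP[s0 _] /andP[s'0 _]; have [h1 h2] := LP _ _ s0 s'0.
  rewrite (_ : _ - _ = (a_ e s - a_ e s') - (b_ e s - b_ e s')); last by ring.
  by rewrite (le_trans (ler_normB _ _))//; lra.
- apply: (aeS ae) => s h /andP[s0 _] fs.
  have [da [db [D1 D2 D3 D4 D5]]] := h s0; have [abs p0] := ab s (ltW s0).
  exists (0 - (db - da)); first exact: (is_deriveB (is_derive_cst _ _ _) (is_deriveB D2 D1)).
  have l'0 : 0 < b_ e s - a_ e s by rewrite subr_gt0.
  have [_ p00] := ab 0 (lexx 0); rewrite a_0// b_0// in p00.
  have ll' : b_ e s - a_ e s < b0 - a0 by lra.
  have pp := le_lt_trans p00 (lslope_decr V0_gt0 m_gt0 k_gt0 l'0 ll').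
  have := D4 pp; have := l1P _ l'0 (_ : b_ e s - a_ e s <= l1); rewrite -/(rforce _).
  have := lforce_ge0 (b_ e s - a_ e s).
  have := bM (a_ e s / e); have := bM (b_ e s / e); rewrite !ler_norml.
  move=> /andP[q1 q2] /andP[q3 q4] q5 q6 q7.
  have := q6 ltac:(lra); lra.
- by rewrite a_0// b_0// subr_le0.
Qed.

Lemma critical_max (l : R -> R) : (forall t, 0 <= t -> 0 < l t /\ 0 <= lslope (l t)) ->
  forall t, 0 <= t -> lslope (l t) = 0 -> forall s, 0 <= s -> l s <= l t.
Proof.
move=> lP t t0 pt s s0; rewrite leNgt; apply/negP => ts.
have [lt0 _] := lP t t0; have [_ ps] := lP s s0.
have := lslope_decr V0_gt0 m_gt0 k_gt0 lt0 ts.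
by rewrite pt ltNge ps.
Qed.

(** The reflection gives no upper bound for the speed of a at the critical length, but
   there the length is maximal, so that a and b have the same speed. *)
Lemma edges_equilipschitz : a0 < b0 ->
  exists2 M, 0 < M & forall e s t, 0 < e -> 0 <= s -> 0 <= t ->
    `|a_ e s - a_ e t| <= M * `|s - t| /\ `|b_ e s - b_ e t| <= M * `|s - t|.
Proof.
move=> ab0; have [l l0 lP] := length_bounded_below ab0.
have [M M0 bM] := oscillating_bounded.
have f0 : 0 <= rforce l by rewrite mulr_ge0// sqr_ge0.
exists (rforce l + M + 1) => [|e s t e0]; first by lra.
wlog st : s t / s <= t.
  move=> H s0 t0; have [st|/ltW ts] := leP s t; first by apply: H.
  by have [h1 h2] := H t s ts t0 s0; split; rewrite distrC [in leRHS]distrC.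
move=> s0 t0; have [[L LP] ab ae] := em e0.
have bd : {ae mu, forall z : R, 0 < z -> exists da db : R, [/\ is_derive z (1 : R) (a_ e) da,
    is_derive z (1 : R) (b_ e) db, `|da| <= rforce l + M + 1 & `|db| <= rforce l + M + 1]}.
  apply: (aeS ae) => z h z0.
  have [da [db [D1 D2 D3 D4 D5]]] := h z0; have [abz p0] := ab z (ltW z0).
  have l'0 : 0 < b_ e z - a_ e z by rewrite subr_gt0.
  have r1 := rforce_nincr V0_gt0 m_gt0 k_gt0 l0 (lP _ _ e0 (ltW z0)) p0.
  have r2 := lforce_le_rforce m_gt0 k_gt0 l'0 p0.
  have r3 := lforce_ge0 (b_ e z - a_ e z).
  have := bM (a_ e z / e); have := bM (b_ e z / e); rewrite !ler_norml => /andP[q1 q2] /andP[q3 q4].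
  have dbB : `|db| <= rforce l + M + 1 by rewrite ler_norml D5; lra.
  exists da, db; split => //.
  have [pp|pp] := ltP 0 (lslope (b_ e z - a_ e z)).
    by have := D4 pp; rewrite ler_norml; lra.
  have pE : lslope (b_ e z - a_ e z) = 0 by apply/eqP; rewrite eq_le pp p0.
  have lP' u : 0 <= u -> 0 < b_ e u - a_ e u /\ 0 <= lslope (b_ e u - a_ e u).
    by move=> u0; have [h1 h2] := ab u u0; rewrite subr_gt0.
  have mx := critical_max lP' (ltW z0) pE.
  suff E : db - da = 0 by rewrite (_ : da = db)//; lra.
  apply: (is_derive_max (is_deriveB D2 D1)).
  apply/nbhs_ballP; exists z => //= w; rewrite /ball/= => zw.
  by apply: mx; move: zw; rewrite ltr_norml; lra.
have lipa u v : s <= u <= t -> s <= v <= t -> `|a_ e u - a_ e v| <= L * `|u - v|.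
  by move=> /andP[u1 _] /andP[v1 _]; have [] := LP u v (le_trans s0 u1) (le_trans s0 v1).
have lipb u v : s <= u <= t -> s <= v <= t -> `|b_ e u - b_ e v| <= L * `|u - v|.
  by move=> /andP[u1 _] /andP[v1 _]; have [] := LP u v (le_trans s0 u1) (le_trans s0 v1).
have st0 : s - t <= 0 by rewrite subr_le0.
rewrite (ler0_norm st0) !ler_norml.
have A1 : a_ e t - a_ e s <= (rforce l + M + 1) * (t - s).
  apply: (ae_slope_le lipa) st; apply: (aeS bd) => z h /andP[sz _].
  have [da [db [D1 _ + _]]] := h (le_lt_trans s0 sz).
  by rewrite ler_norml => /andP[_ ?]; exists da.
have A2 : - (rforce l + M + 1) * (t - s) <= a_ e t - a_ e s.
  apply: (ae_slope_ge lipa) st; apply: (aeS bd) => z h /andP[sz _].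
  have [da [db [D1 _ + _]]] := h (le_lt_trans s0 sz).
  by rewrite ler_norml => /andP[? _]; exists da.
have B1 : b_ e t - b_ e s <= (rforce l + M + 1) * (t - s).
  apply: (ae_slope_le lipb) st; apply: (aeS bd) => z h /andP[sz _].
  have [da [db [_ D1 _ +]]] := h (le_lt_trans s0 sz).
  by rewrite ler_norml => /andP[_ ?]; exists db.
have B2 : - (rforce l + M + 1) * (t - s) <= b_ e t - b_ e s.
  apply: (ae_slope_ge lipb) st; apply: (aeS bd) => z h /andP[sz _].
  have [da [db [_ D1 _ +]]] := h (le_lt_trans s0 sz).
  by rewrite ler_norml => /andP[? _]; exists db.
rewrite mulNr in A2 B2.
by split; apply/andP; split; lra.
Qed.

Section limit.
Context (M : R) (M_gt0 : 0 < M) (MP : forall e s t : R, 0 < e -> 0 <= s -> 0 <= t ->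
  `|a_ e s - a_ e t| <= M * `|s - t| /\ `|b_ e s - b_ e t| <= M * `|s - t|).
Context (lmin : R) (lmin_gt0 : 0 < lmin)
  (lminP : forall e t : R, 0 < e -> 0 <= t -> lmin <= b_ e t - a_ e t).
Context (F : set_system R) (FF : ProperFilter F) (F0 : (fun e => e) @ F --> (0 : R))
  (Fpos : \forall e \near F, 0 < e) (a b : R -> R)
  (aP : forall t, 0 <= t -> (fun e => a_ e t) @ F --> a t)
  (bP : forall t, 0 <= t -> (fun e => b_ e t) @ F --> b t).

Let len_ e t := b_ e t - a_ e t.
Let len t := b t - a t.

Let lenP t : 0 <= t -> (fun e => len_ e t) @ F --> len t.
Proof. by move=> t0; apply: cvgB; [exact: bP | exact: aP]. Qed.

Lemma limit_lipschitz s t : 0 <= s -> 0 <= t ->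
  `|a s - a t| <= M * `|s - t| /\ `|b s - b t| <= M * `|s - t|.
Proof.
move=> s0 t0; split.
- have H : (fun e => `|a_ e s - a_ e t|) @ F --> `|a s - a t|.
    by apply: cvg_norm; apply: cvgB; exact: aP.
  apply: (ler_cvg_to H (cvg_cst _)); near=> e.
  by have [] := MP (_ : 0 < e) s0 t0; first by near: e.
- have H : (fun e => `|b_ e s - b_ e t|) @ F --> `|b s - b t|.
    by apply: cvg_norm; apply: cvgB; exact: bP.
  apply: (ler_cvg_to H (cvg_cst _)); near=> e.
  by have [] := MP (_ : 0 < e) s0 t0; first by near: e.
Unshelve. all: by end_near. Qed.

Lemma limit_length_ge t : 0 <= t -> lmin <= len t.
Proof.
move=> t0; apply: (ler_cvg_to (cvg_cst lmin) (lenP t0)); near=> e.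
by apply: lminP => //; near: e.
Unshelve. all: by end_near. Qed.

Let len_gt0 t : 0 <= t -> 0 < len t.
Proof. by move=> t0; apply: lt_le_trans (limit_length_ge t0). Qed.

Lemma limit_lslope_ge0 t : 0 <= t -> 0 <= lslope (len t).
Proof.
move=> t0.
have H : (fun e => lslope (len_ e t)) @ F --> lslope (len t).
  exact: (lslope_cvg m_gt0 _ (len_gt0 t0) (lenP t0)).
apply: (ler_cvg_to (cvg_cst (0 : R)) H); near=> e.
have e0 : 0 < e by near: e.
by have [_ ab _] := em e0; have [] := ab t t0.
Unshelve. all: by end_near. Qed.

Lemma near_length (t0 r : R) : 0 <= t0 -> 0 < r -> exists2 h, 0 < h &
  \forall e \near F, forall t, 0 <= t -> `|t - t0| < h -> `|len t0 - len_ e t| < r.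
Proof.
move=> t00 r0; have h0 : 0 < r / (4 * M) by rewrite divr_gt0 ?mulr_gt0.
exists (r / (4 * M)) => //.
have r2 : 0 < r / 2 by rewrite divr_gt0.
have /cvgrPdist_lt/(_ _ r2) H := lenP t00.
near=> e => t tpos th.
have e0 : 0 < e by near: e.
have H1 : `|len t0 - len_ e t0| < r / 2 by near: e; exact: H.
have [q1 q2] := MP e0 tpos t00.
have E : len t0 - len_ e t = (len t0 - len_ e t0) + ((a_ e t - a_ e t0) - (b_ e t - b_ e t0)).
  by rewrite /len_; ring.
rewrite E (le_lt_trans (ler_normD _ _))//.
have q3 := ler_normB (a_ e t - a_ e t0) (b_ e t - b_ e t0).
have q4 : M * `|t - t0| < r / 4.
  rewrite (_ : r / 4 = M * (r / (4 * M))); first by rewrite ltr_pM2l.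
  by field; rewrite gt_eqF.
lra.
Unshelve. all: by end_near. Qed.

Lemma near_force (f : R -> R) (t0 r : R) : 0 <= t0 -> 0 < r ->
  {for len t0, continuous f} -> exists2 h, 0 < h &
  \forall e \near F, forall t, 0 <= t -> `|t - t0| < h -> `|f (len t0) - f (len_ e t)| < r.
Proof.
move=> t00 r0 /cvgrPdist_lt/(_ _ r0)/nbhs_ballP[d /= d0 dP].
have [h h0 hP] := near_length t00 d0.
exists h => //; apply: filterS hP => e H t tpos th.
by apply: dP; exact: H.
Qed.

Let lslope_continuous l : 0 < l -> {for l, continuous lslope}.
Proof. by move=> l0; apply: (lslope_cvg (V0 := V0) (k := k) m_gt0 _ l0); exact: cvg_id. Qed.

Let lforce_continuous l : 0 < l -> {for l, continuous lforce}.
Proof.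
move=> l0; have c := lslope_continuous l0.
by apply: cvgM; [exact: cvg_cst | apply: cvgM].
Qed.

Let rforce_continuous l : 0 < l -> {for l, continuous rforce}.
Proof.
move=> l0; have c : {for l, continuous rslope}.
  by apply: (rslope_cvg (V0 := V0) (k := k) m_gt0 _ l0); exact: cvg_id.
by apply: cvgM; [exact: cvg_cst | apply: cvgM].
Qed.

Local Notation r := (speed beta P).

Let speed_near (q eta : R) : 0 < eta -> exists2 d, 0 < d &
  r (q + d) <= r q + eta /\ r q - eta <= r (q - d).
Proof.
move=> eta0; have [q1 [q1q _ h1]] := speed_right_approx q osc eta0.
have [q2 [q2q _ h2]] := speed_left_approx q osc eta0.
have d0 : 0 < Num.min (q1 - q) (q - q2) by rewrite lt_min !subr_gt0 q1q.
exists (Num.min (q1 - q) (q - q2)) => //; split.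
  by apply: le_trans h1; apply: speed_ndecr => //; rewrite -lerBrDl ge_min lexx.
apply: (le_trans h2); apply: speed_ndecr => //.
by rewrite lerBrDr -lerBrDl ge_min lexx orbT.
Qed.

(** Near t0 the forces on the approximating drops stay within q of the force at t0 on
   the limit drop, so that the effective speeds of the frozen forces apply. *)
Lemma right_edge_slope (t0 eta : R) : 0 <= t0 -> 0 < eta -> exists2 h, 0 < h &
  forall c d, 0 <= c -> c <= d -> `|c - t0| < h -> `|d - t0| < h ->
    `|b d - b c - r (rforce (len t0)) * (d - c)| <= eta * (d - c).
Proof.
move=> t00 eta0; have [q q0 [q1 q2]] := speed_near (rforce (len t0)) eta0.
have [h h0 hP] := near_force t00 q0 (rforce_continuous (len_gt0 t00)).
exists h => // c d c0 cd ch dh.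
have lipb : \forall e \near F, forall s t, c <= s <= d -> c <= t <= d ->
     `|b_ e s - b_ e t| <= M * `|s - t|.
  near=> e => s t /andP[cs _] /andP[ct _]; have e0 : 0 < e by near: e.
  by have [] := MP e0 (le_trans c0 cs) (le_trans c0 ct).
have mid t : c < t < d -> `|t - t0| < h by move: ch dh; rewrite !ltr_norml; lra.
have d0 := le_trans c0 cd.
have ae1 : \forall e \near F, {ae mu, forall t, c < t < d -> exists2 dx,
    is_derive t (1 : R) (b_ e) dx & 1 * dx <= rforce (len t0) + q - beta (b_ e t / e)}.
  near=> e; have e0 : 0 < e by near: e.
  have hPe : forall t, 0 <= t -> `|t - t0| < h -> `|rforce (len t0) - rforce (len_ e t)| < q by near: e.
  have [_ _ ae] := em e0; apply: (aeS ae) => t + tcd.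
  have tpos : 0 < t by apply: le_lt_trans c0 _; case/andP: tcd.
  move=> /(_ tpos)[da [db [_ D _ _ E]]]; exists db => //.
  by have := hPe t (ltW tpos) (mid t tcd); rewrite E /len_ ltr_norml; lra.
have ae2 : \forall e \near F, {ae mu, forall t, c < t < d -> exists2 dx,
    is_derive t (1 : R) (b_ e) dx & rforce (len t0) - q - beta (b_ e t / e) <= 1 * dx}.
  near=> e; have e0 : 0 < e by near: e.
  have hPe : forall t, 0 <= t -> `|t - t0| < h -> `|rforce (len t0) - rforce (len_ e t)| < q by near: e.
  have [_ _ ae] := em e0; apply: (aeS ae) => t + tcd.
  have tpos : 0 < t by apply: le_lt_trans c0 _; case/andP: tcd.
  move=> /(_ tpos)[da [db [_ D _ _ E]]]; exists db => //.
  by have := hPe t (ltW tpos) (mid t tcd); rewrite E /len_ ltr_norml; lra.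
have := limit_displacement_le osc FF F0 Fpos cd (normr1 _) lipb ae1 (bP c0) (bP d0).
have := limit_displacement_ge osc FF F0 Fpos cd (normr1 _) lipb ae2 (bP c0) (bP d0).
have dc : 0 <= d - c by rewrite subr_ge0.
have := ler_wpM2r dc q1; have := ler_wpM2r dc q2.
by rewrite ler_norml; lra.
Unshelve. all: by end_near. Qed.

Lemma left_edge_slope_ge (t0 eta : R) : 0 <= t0 -> 0 < eta -> exists2 h, 0 < h &
  forall c d, 0 <= c -> c <= d -> `|c - t0| < h -> `|d - t0| < h ->
    - (r (lforce (len t0)) + eta) * (d - c) <= a d - a c.
Proof.
move=> t00 eta0; have [q q0 [q1 q2]] := speed_near (lforce (len t0)) eta0.
have [h h0 hP] := near_force t00 q0 (lforce_continuous (len_gt0 t00)).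
exists h => // c d c0 cd ch dh.
have lipa : \forall e \near F, forall s t, c <= s <= d -> c <= t <= d ->
     `|a_ e s - a_ e t| <= M * `|s - t|.
  near=> e => s t /andP[cs _] /andP[ct _]; have e0 : 0 < e by near: e.
  by have [] := MP e0 (le_trans c0 cs) (le_trans c0 ct).
have mid t : c < t < d -> `|t - t0| < h by move: ch dh; rewrite !ltr_norml; lra.
have d0 := le_trans c0 cd.
have ae1 : \forall e \near F, {ae mu, forall t, c < t < d -> exists2 dx,
    is_derive t (1 : R) (a_ e) dx & -1 * dx <= lforce (len t0) + q - beta (a_ e t / e)}.
  near=> e; have e0 : 0 < e by near: e.
  have hPe : forall t, 0 <= t -> `|t - t0| < h -> `|lforce (len t0) - lforce (len_ e t)| < q by near: e.
  have [_ _ ae] := em e0; apply: (aeS ae) => t + tcd.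
  have tpos : 0 < t by apply: le_lt_trans c0 _; case/andP: tcd.
  move=> /(_ tpos)[da [db [D _ E _ _]]]; exists da => //.
  by have := hPe t (ltW tpos) (mid t tcd); rewrite /len_ ltr_norml; lra.
have := limit_displacement_le osc FF F0 Fpos cd (normrN1 _) lipa ae1 (aP c0) (aP d0).
have dc : 0 <= d - c by rewrite subr_ge0.
by have := ler_wpM2r dc q1; lra.
Unshelve. all: by end_near. Qed.

(** Below the critical length, where no reflection acts, the left end obeys the converse
   bound as well. *)
Lemma left_edge_slope_le (t0 eta : R) : 0 <= t0 -> 0 < eta -> 0 < lslope (len t0) ->
  exists2 h, 0 < h &
  forall c d, 0 <= c -> c <= d -> `|c - t0| < h -> `|d - t0| < h ->
    a d - a c <= - (r (lforce (len t0)) - eta) * (d - c).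
Proof.
move=> t00 eta0 p0; have [q q0 [q1 q2]] := speed_near (lforce (len t0)) eta0.
have [h1 h10 h1P] := near_force t00 q0 (lforce_continuous (len_gt0 t00)).
have [h2 h20 h2P] := near_force t00 p0 (lslope_continuous (len_gt0 t00)).
pose h := Num.min h1 h2; have hh1 : h <= h1 by rewrite ge_min lexx.
have hh2 : h <= h2 by rewrite ge_min lexx orbT.
have h0 : 0 < h by rewrite lt_min h10.
clearbody h.
exists h => // c d c0 cd ch dh.
have lipa : \forall e \near F, forall s t, c <= s <= d -> c <= t <= d ->
     `|a_ e s - a_ e t| <= M * `|s - t|.
  near=> e => s t /andP[cs _] /andP[ct _]; have e0 : 0 < e by near: e.
  by have [] := MP e0 (le_trans c0 cs) (le_trans c0 ct).
have mid t : c < t < d -> `|t - t0| < h by move: ch dh; rewrite !ltr_norml; lra.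
have d0 := le_trans c0 cd.
have ae1 : \forall e \near F, {ae mu, forall t, c < t < d -> exists2 dx,
    is_derive t (1 : R) (a_ e) dx & lforce (len t0) - q - beta (a_ e t / e) <= -1 * dx}.
  near=> e; have e0 : 0 < e by near: e.
  have hP1 : forall t, 0 <= t -> `|t - t0| < h1 -> `|lforce (len t0) - lforce (len_ e t)| < q by near: e.
  have hP2 : forall t, 0 <= t -> `|t - t0| < h2 -> `|lslope (len t0) - lslope (len_ e t)| < lslope (len t0) by near: e.
  have [_ _ ae] := em e0; apply: (aeS ae) => t + tcd.
  have tpos : 0 < t by apply: le_lt_trans c0 _; case/andP: tcd.
  move=> /(_ tpos)[da [db [D _ _ E _]]]; exists da => //.
  have mt := mid t tcd.
  have := hP1 t (ltW tpos) (lt_le_trans mt hh1).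
  have := hP2 t (ltW tpos) (lt_le_trans mt hh2).
  rewrite !ltr_norml => /andP[_ w1] /andP[w2 w3].
  have pp : 0 < lslope (b_ e t - a_ e t) by rewrite /len_ in w1; lra.
  by have := E pp; rewrite /len_ in w2 w3; lra.
have := limit_displacement_ge osc FF F0 Fpos cd (normrN1 _) lipa ae1 (aP c0) (aP d0).
have dc : 0 <= d - c by rewrite subr_ge0.
by have := ler_wpM2r dc q2; lra.
Unshelve. all: by end_near. Qed.

Let slope_derive (f : R -> R) (t0 D : R) : 0 < t0 ->
  (forall eta, 0 < eta -> exists2 h, 0 < h &
     forall c d, 0 <= c -> c <= d -> `|c - t0| < h -> `|d - t0| < h ->
       `|f d - f c - D * (d - c)| <= eta * (d - c)) ->
  is_derive t0 (1 : R) f D.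
Proof.
move=> t00 H; apply: expansion_is_derive => e e0; have [h h0 hP] := H e e0.
have n0 : `|t0 - t0| < h by rewrite subrr normr0.
near=> s.
have s0 : 0 <= s.
  have : `|t0 - s| < t0 by near: s; apply/nbhs_ballP; exists t0.
  by rewrite ltr_norml; lra.
have sh : `|s - t0| < h by rewrite distrC; near: s; apply/nbhs_ballP; exists h.
have [st|/ltW ts] := leP s t0.
  have := hP s t0 s0 st sh n0.
  rewrite [X in _ -> _ <= e * X]distrC (ger0_norm (_ : 0 <= t0 - s)) ?subr_ge0//.
  by rewrite -normrN; congr (`|_| <= _); ring.
by have := hP t0 s (ltW t00) ts n0 sh; rewrite [in X in _ -> X](ger0_norm (_ : 0 <= s - t0)) ?subr_ge0.
Unshelve. all: by end_near. Qed.

Lemma right_edge_derive (t : R) : 0 < t -> is_derive t (1 : R) b (r (rforce (len t))).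
Proof.
by move=> t0; apply: slope_derive => // eta; apply: right_edge_slope; exact: ltW.
Qed.

Lemma left_edge_derive (t : R) : 0 < t -> 0 < lslope (len t) ->
  is_derive t (1 : R) a (- r (lforce (len t))).
Proof.
move=> t0 p0; apply: slope_derive => // eta eta0.
have [h1 h10 H1] := left_edge_slope_ge (ltW t0) eta0.
have [h2 h20 H2] := left_edge_slope_le (ltW t0) eta0 p0.
pose h := Num.min h1 h2; have hh1 : h <= h1 by rewrite ge_min lexx.
have hh2 : h <= h2 by rewrite ge_min lexx orbT.
have h0 : 0 < h by rewrite lt_min h10.
clearbody h; exists h => // c d c0 cd ch dh.
have := H1 c d c0 cd (lt_le_trans ch hh1) (lt_le_trans dh hh1).
have := H2 c d c0 cd (lt_le_trans ch hh2) (lt_le_trans dh hh2).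
by rewrite ler_norml; lra.
Qed.

Let limit_critical_max t : 0 <= t -> lslope (len t) = 0 ->
  forall s, 0 <= s -> len s <= len t.
Proof.
apply: critical_max => s s0; split; [exact: len_gt0 | exact: limit_lslope_ge0].
Qed.

(** Otherwise the drop would have been longer than critical shortly before t. *)
Lemma critical_speed (t : R) : 0 < t -> lslope (len t) = 0 ->
  0 <= r (rforce (len t)) + r (lforce (len t)).
Proof.
move=> t0 pt; rewrite leNgt; apply/negP => S0.
pose eta := - (r (rforce (len t)) + r (lforce (len t))) / 4.
have eta0 : 0 < eta by rewrite /eta divr_gt0// oppr_gt0.
have [h1 h10 H1] := right_edge_slope (ltW t0) eta0.
have [h2 h20 H2] := left_edge_slope_ge (ltW t0) eta0.
pose h := Num.min t (Num.min h1 h2) / 2.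
have h0 : 0 < h by rewrite divr_gt0// !lt_min t0 h10.
have hle x : Num.min t (Num.min h1 h2) <= x -> 0 < x -> h < x.
  by move=> hx x0; rewrite /h ltr_pdivrMr//; lra.
have ht : h < t by apply: hle => //; rewrite ge_min lexx.
have hh1 : h < h1 by apply: hle => //; rewrite !ge_min lexx orbT.
have hh2 : h < h2 by apply: hle => //; rewrite !ge_min lexx !orbT.
clear hle; clearbody h.
have c0 : 0 <= t - h by lra.
have ct : t - h <= t by lra.
have ch : `|t - h - t| = h by rewrite addrAC subrr sub0r normrN gtr0_norm.
have n0 : `|t - t| = 0 by rewrite subrr normr0.
have := H1 (t - h) t c0 ct; rewrite ch n0 => /(_ hh1 h10); rewrite ler_norml => /andP[_ q1].
have := H2 (t - h) t c0 ct; rewrite ch n0 => /(_ hh2 h20) q2.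
have := limit_critical_max (ltW t0) pt c0; rewrite /len => q3.
have Sh : (r (rforce (len t)) + r (lforce (len t)) + 2 * eta) * h < 0.
  by rewrite pmulr_llt0// /eta; lra.
have tE : t - (t - h) = h by ring.
rewrite tE in q1 q2.
by lra.
Qed.

(** A shorter drop grows at least at the rate available at the critical length, which is
   nonnegative, so that the length cannot fall below the critical one again. *)
Lemma critical_absorbing (t s : R) : 0 < t -> lslope (len t) = 0 -> t <= s ->
  lslope (len s) = 0.
Proof.
move=> t0 pt ts; have S0 := critical_speed t0 pt.
have s0 := le_trans (ltW t0) ts.
have : len t - len s <= 0.
  apply: (@ae_barrier R (fun x => len t - len x) (2 * M) t s) => //.
  - move=> x y /andP[tx _] /andP[ty _].
    have [h1 h2] := limit_lipschitz (le_trans (ltW t0) tx) (le_trans (ltW t0) ty).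
    rewrite (_ : _ - _ = (a x - a y) - (b x - b y)); last by rewrite /len; ring.
    by rewrite (le_trans (ler_normB _ _))//; lra.
  - apply: aeW => x /andP[tx _] lx.
    have x0 := lt_trans t0 tx.
    have xt : len x < len t by lra.
    have px : 0 < lslope (len x).
      by rewrite -pt; exact: (lslope_decr V0_gt0 m_gt0 k_gt0 (len_gt0 (ltW x0)) xt).
    exists (0 - (r (rforce (len x)) - - r (lforce (len x)))).
      exact: (is_deriveB (is_derive_cst _ _ _) (is_deriveB (right_edge_derive x0) (left_edge_derive x0 px))).
    have pt0 : 0 <= lslope (len t) by rewrite pt.
    have := speed_ndecr osc (rforce_nincr V0_gt0 m_gt0 k_gt0 (len_gt0 (ltW x0)) (ltW xt) pt0).
    have := speed_ndecr osc (lforce_nincr V0_gt0 m_gt0 k_gt0 (len_gt0 (ltW x0)) (ltW xt) pt0).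
    lra.
  - by rewrite subrr.
rewrite subr_le0 le_eqVlt => /orP[/eqP <-//|lts].
have := limit_critical_max (ltW t0) pt s0; by rewrite leNgt lts.
Qed.

(** Below the critical length both ends are differentiable. The critical times form a
   half line, inside of which the drop is translated with the speed of its right end. *)
Lemma limit_edge_motion : edge_motion (fun _ q => r q) a b.
Proof.
split.
- by exists M; exact: limit_lipschitz.
- by move=> t t0; split; [rewrite -subr_gt0; exact: len_gt0 | exact: limit_lslope_ge0].
(* a may fail to be differentiable at the first critical time only *)
pose E := [set t | [/\ 0 < t, lslope (len t) = 0 &
  forall s, 0 < s -> s < t -> lslope (len s) <> 0]].
have E1 t s : E t -> E s -> t = s.
  move=> [t0 pt tE] [s0 ps sE]; apply/eqP; rewrite eq_le !leNgt; apply/andP; split; apply/negP => h.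
    exact: tE ps.
  exact: sE pt.
have aeE : {ae mu, forall t, ~ E t}.
  have [[t0 Et0]|nE] := pselect (exists t, E t); last first.
    by apply: aeW => t Et; apply: nE; exists t.
  exists [set t0]; split => //; first exact: lebesgue_measure_set1.
  by move=> t /= /contrapT Et; exact: E1.
apply: (aeS aeE) => t nEt t0.
have Db := right_edge_derive t0.
have [p0|p0] := ltP 0 (lslope (len t)).
  exists (- r (lforce (len t))), (r (rforce (len t))); split => //.
  - exact: left_edge_derive.
  - by rewrite addNr.
  - by rewrite addNr.
have pt : lslope (len t) = 0 by apply/eqP; rewrite eq_le p0 limit_lslope_ge0// ltW.
have [s [s0 st ps]] : exists s, [/\ 0 < s, s < t & lslope (len s) = 0].
  apply: contrapT => H; apply: nEt; split => // s s0 st ps.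
  by apply: H; exists s.
exists (r (rforce (len t))), (r (rforce (len t))); split => //.
- have D : is_derive t (1 : R) (fun x => b x - len s) (r (rforce (len t))).
    by have := is_deriveB Db (is_derive_cst (len s) t (1 : R)); rewrite subr0.
  apply: near_eq_is_derive D; near=> x.
  have sx : s <= x.
    have : `|t - x| < t - s by near: x; apply/nbhs_ballP; exists (t - s) => //=; rewrite subr_gt0.
    by rewrite ltr_norml; lra.
  have px := critical_absorbing s0 ps sx.
  have x0 := le_trans (ltW s0) sx.
  have : len x = len s.
    by apply/eqP; rewrite eq_le !limit_critical_max// ltW.
  by rewrite /len => <-; ring.
- exact: critical_speed.
Unshelve. all: by end_near. Qed.

End limit.

End homogenization.

(** * Convergence of the profiles *)

Lemma clamp_dist (R : realType) (p q p' q' t : R) :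
  `|clamp p q t - clamp p' q' t| <= `|p - p'| + `|q - q'|.
Proof.
have minL (x y z : R) : `|Num.min x y - Num.min x z| <= `|y - z|.
  have := ler_norm (y - z); have := ler_norm (- (y - z)); rewrite normrN.
  by rewrite ler_norml; case: (leP x y); case: (leP x z); lra.
have maxL (x y z w : R) : `|Num.max x y - Num.max z w| <= `|x - z| + `|y - w|.
  have := ler_norm (x - z); have := ler_norm (- (x - z)); rewrite normrN.
  have := ler_norm (y - w); have := ler_norm (- (y - w)); rewrite normrN.
  by rewrite ler_norml; case: (leP x y); case: (leP z w); lra.
by apply: le_trans (maxL _ _ _ _) _; rewrite lerD2l.
Qed.

Section convergence.
Context {R : realType}.
Context (V0 m k : R) (V0_gt0 : 0 < V0) (m_gt0 : 0 < m) (k_gt0 : 0 < k).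
Local Notation sessile := (sessile V0 m k).
Local Notation edge_motion := (edge_motion V0 m k).
Context (beta : R -> R) (P : R) (osc : oscillating beta P).
Context (a_ b_ : R -> R -> R) (a0 b0 : R) (ab0 : a0 < b0).
Context (em : forall e : R, 0 < e ->
  edge_motion (fun y q => q - beta (y / e)) (a_ e) (b_ e)).
Context (a_0 : forall e : R, 0 < e -> a_ e 0 = a0) (b_0 : forall e : R, 0 < e -> b_ e 0 = b0).
Local Notation r := (speed beta P).

(** Bounded functions of e converge along an ultrafilter, at all times at once and
   without extraction of subsequences. *)
Lemma ultralimit (U : set_system R) : UltraFilter U -> (0 : R)^'+ `<=` U ->
  exists a b, [/\ forall t, 0 <= t -> (fun e => a_ e t) @ U --> a t,
    forall t, 0 <= t -> (fun e => b_ e t) @ U --> b t,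
    edge_motion (fun _ q => r q) a b & a 0 = a0 /\ b 0 = b0].
Proof.
move=> UU subU.
have Upos : \forall e \near U, 0 < e by apply: subU; exact: nbhs_right_gt.
have U0 : (fun e => e) @ U --> (0 : R).
  by move=> A /= A0; apply: subU; exact: (@cvg_within _ (nbhs (0 : R)) _ _ A A0).
have [M M0 MP] := edges_equilipschitz V0_gt0 m_gt0 k_gt0 osc em a_0 b_0 ab0.
have [l l0 lP] := length_bounded_below V0_gt0 m_gt0 k_gt0 osc em a_0 b_0 ab0.
have exa t : exists x : R, 0 <= t -> (fun e => a_ e t) @ U --> x.
  have [t0|t0] := leP 0 t; last by exists 0.
  have [|x hx] := @ultra_bounded_cvg R R U (fun e => a_ e t) (a0 - M * t) (a0 + M * t) UU; last by exists x.
  apply: filterS Upos => e e0; have [+ _] := MP e t 0 e0 t0 (lexx 0).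
  by rewrite a_0// subr0 (ger0_norm t0) ler_norml /=; lra.
have exb t : exists x : R, 0 <= t -> (fun e => b_ e t) @ U --> x.
  have [t0|t0] := leP 0 t; last by exists 0.
  have [|x hx] := @ultra_bounded_cvg R R U (fun e => b_ e t) (b0 - M * t) (b0 + M * t) UU; last by exists x.
  apply: filterS Upos => e e0; have [_ +] := MP e t 0 e0 t0 (lexx 0).
  by rewrite b_0// subr0 (ger0_norm t0) ler_norml /=; lra.
have [a aP] := choice exa; have [b bP] := choice exb.
exists a, b; split => //.
  exact: (limit_edge_motion V0_gt0 m_gt0 k_gt0 osc em M0 MP l0 lP ultra_proper U0 Upos aP bP).
split.
- have c0 : (fun e => a_ e 0) @ U --> a0.
    have H : (fun _ : R => a0) @ U --> a0 by exact: cvg_cst.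
    apply: cvg_trans H; apply: near_eq_cvg.
    by apply: filterS Upos => e e0; rewrite a_0.
  exact: (cvg_unique _ (aP 0 (lexx 0)) c0).
- have c0 : (fun e => b_ e 0) @ U --> b0.
    have H : (fun _ : R => b0) @ U --> b0 by exact: cvg_cst.
    apply: cvg_trans H; apply: near_eq_cvg.
    by apply: filterS Upos => e e0; rewrite b_0.
  exact: (cvg_unique _ (bP 0 (lexx 0)) c0).
Qed.

(** If the convergence were not uniform, it would fail at some points x_ e, t_ e for all e
   in a set of some ultrafilter finer than 0^'+. Along it the contact points at the times
   t_ e converge to those of the limit motion, which is unique, and the formula for the
   profiles is continuous in the length and in the distance to the left end. *)
Lemma profiles_cvg (a b : R -> R) : edge_motion (fun _ q => r q) a b ->
  a 0 = a0 -> b 0 = b0 -> forall T eta : R, 0 < eta ->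
  \forall e \near 0^'+, forall x t : R, 0 <= t <= T ->
    `|sessile (a_ e t) (b_ e t) x - sessile (a t) (b t) x| < eta.
Proof.
move=> emab aE bE T eta eta0; apply: contrapT => H.
set B := [set e : R | forall x t : R, 0 <= t <= T ->
    `|sessile (a_ e t) (b_ e t) x - sessile (a t) (b t) x| < eta] in H.
have PF : ProperFilter (within (~` B) (0 : R)^'+).
  split; last exact: within_filter.
  move=> W0; have W : \forall e \near (0 : R)^'+, ~ B e -> False by exact: W0.
  by apply: H; apply: filterS W => e We; apply: contrapT => /We.
have [U [UU subU]] := ultraFilterLemma PF.
have subU0 : (0 : R)^'+ `<=` U.
  by move=> A A0; apply: subU; apply: filterS A0 => e.
have UB : U (~` B) by apply: subU; exact: withinT.
have Upos : U [set e : R | 0 < e] by apply: subU0; exact: nbhs_right_gt.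
have [M M0 MP] := edges_equilipschitz V0_gt0 m_gt0 k_gt0 osc em a_0 b_0 ab0.
have [a' [b' [aP bP em' [a0' b0']]]] := ultralimit UU subU0.
have uniq t : 0 <= t -> a' t = a t /\ b' t = b t.
  by apply: (edge_motion_unique V0_gt0 m_gt0 k_gt0 _ em' emab);
    [move=> x y; exact: speed_ndecr | rewrite a0' aE | rewrite b0' bE].
have wit (e : R) : exists xt : R * R, ~ B e -> 0 <= xt.2 <= T /\
    eta <= `|sessile (a_ e xt.2) (b_ e xt.2) xt.1 - sessile (a xt.2) (b xt.2) xt.1|.
  have [Be|nB] := pselect (B e); first by exists (0, 0).
  apply: contrapT => nw; apply: nB => x t tT; rewrite ltNge; apply/negP => h.
  by apply: nw; exists (x, t).
have [w wP] := choice wit.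
pose x_ e := (w e).1; pose t_ e := (w e).2.
have tU : U [set e | 0 <= t_ e <= T].
  by apply: filterS UB => e /wP[].
have [t tt] := ultra_bounded_cvg UU tU.
have t0 : 0 <= t.
  by apply: (ler_cvg_to (cvg_cst 0) tt); apply: filterS tU => e /= /andP[].
have [[L LP] ab _] := emab.
have [abt pt] := ab t t0.
have lt0 : 0 < b t - a t by rewrite subr_gt0.
(* equicontinuity allows for evaluation at the moving times t_ e *)
have moving (f_ : R -> R -> R) (f : R) :
    (forall e s t, 0 < e -> 0 <= s -> 0 <= t -> `|f_ e s - f_ e t| <= M * `|s - t|) ->
    (fun e => f_ e t) @ U --> f -> (fun e => f_ e (t_ e)) @ U --> f.
  move=> fM fc; apply/cvgrPdist_lt => d d0.
  have d1 : 0 < d / 2 by rewrite divr_gt0.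
  have d2 : 0 < d / (2 * M) by rewrite divr_gt0 ?mulr_gt0.
  have /cvgrPdist_lt/(_ _ d1) h1 := fc; have /cvgrPdist_lt/(_ _ d2) h2 := tt.
  near=> e.
  have e0 : 0 < e by near: e.
  have g1 : `|f - f_ e t| < d / 2 by near: e.
  have g2 : `|t - t_ e| < d / (2 * M) by near: e.
  have /andP[te0 _] : 0 <= t_ e <= T by near: e.
  have g3 := fM e t (t_ e) e0 t0 te0.
  have g4 : M * `|t - t_ e| < d / 2.
    rewrite (_ : d / 2 = M * (d / (2 * M))); first by rewrite ltr_pM2l.
    by field; rewrite gt_eqF.
  rewrite (_ : f - _ = (f - f_ e t) + (f_ e t - f_ e (t_ e))); last by ring.
  by rewrite (le_lt_trans (ler_normD _ _))//; lra.
have ac : (fun e => a_ e (t_ e)) @ U --> a t.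
  apply: moving => [e s s' e0 s0 s'0|]; first by have [] := MP e s s' e0 s0 s'0.
  by have [<- _] := uniq t t0; exact: aP.
have bc : (fun e => b_ e (t_ e)) @ U --> b t.
  apply: moving => [e s s' e0 s0 s'0|]; first by have [] := MP e s s' e0 s0 s'0.
  by have [_ <-] := uniq t t0; exact: bP.
have fixed (f f' : R -> R) : (forall s, 0 <= s -> f' s = f s) ->
    (forall s s', 0 <= s -> 0 <= s' -> `|f' s - f' s'| <= M * `|s - s'|) ->
    (fun e => f (t_ e)) @ U --> f t.
  move=> ff' fM; have H1 : (fun e => f' (Num.max 0 (t_ e))) @ U --> f t.
    rewrite -ff'//; apply: (@moving (fun _ s => f' (Num.max 0 s)) (f' t)) => [e s s' _ s0 s'0|].
      by rewrite !max_r//; exact: fM.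
    by rewrite (max_r t0); exact: cvg_cst.
  apply: cvg_trans H1; apply: near_eq_cvg; apply: filterS tU => e /andP[te0 _].
  by rewrite max_r// ff'.
have lipab s s' : 0 <= s -> 0 <= s' ->
    `|a' s - a' s'| <= M * `|s - s'| /\ `|b' s - b' s'| <= M * `|s - s'|.
  by move=> s0 s'0; apply: (limit_lipschitz MP ultra_proper Upos aP bP).
have ac' : (fun e => a (t_ e)) @ U --> a t.
  apply: (fixed a a') => [s /uniq[]//|s s' s0 s'0]; by have [] := lipab s s' s0 s'0.
have bc' : (fun e => b (t_ e)) @ U --> b t.
  apply: (fixed b b') => [s /uniq[]//|s s' s0 s'0]; by have [] := lipab s s' s0 s'0.
pose y_ e := clamp (a_ e (t_ e)) (b_ e (t_ e)) (x_ e) - a_ e (t_ e).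
pose z_ e := clamp (a (t_ e)) (b (t_ e)) (x_ e) - a (t_ e).
have [z zc] : exists z : R, z_ @ U --> z.
  apply: (@ultra_bounded_cvg R R U z_ 0 (b t - a t + 1)) => //.
  have lc0 : (fun e => b (t_ e) - a (t_ e)) @ U --> b t - a t by exact: cvgB.
  have /cvgrPdist_lt/(_ 1 ltr01) lc := lc0.
  near=> e; have /andP[te0 _] : 0 <= t_ e <= T by near: e.
  have h : `|b t - a t - (b (t_ e) - a (t_ e))| < 1 by near: e; exact: lc.
  have [abe _] := ab _ te0.
  have := clamp_itv (x_ e) (ltW abe); move: h; rewrite /z_ /= ltr_norml; lra.
have yc : y_ @ U --> z.
  have dc : (fun e => y_ e - z_ e) @ U --> 0.
    have bound : (fun e => `|a_ e (t_ e) - a (t_ e)| + `|b_ e (t_ e) - b (t_ e)| + `|a_ e (t_ e) - a (t_ e)|) @ U --> 0.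
      rewrite -[0](_ : `|a t - a t| + `|b t - b t| + `|a t - a t| = 0); last by rewrite !subrr normr0 !addr0.
      by apply: cvgD; [apply: cvgD|]; apply: cvg_norm; apply: cvgB.
    apply/cvgrPdist_lt => d d0; have /cvgrPdist_lt/(_ _ d0) hb := bound.
    near=> e; have : `|0 - (`|a_ e (t_ e) - a (t_ e)| + `|b_ e (t_ e) - b (t_ e)| + `|a_ e (t_ e) - a (t_ e)|)| < d by near: e; exact: hb.
    rewrite !sub0r !normrN; apply: le_lt_trans.
    rewrite [leRHS]ger0_norm ?addr_ge0//.
    rewrite (_ : y_ e - z_ e = (clamp (a_ e (t_ e)) (b_ e (t_ e)) (x_ e) - clamp (a (t_ e)) (b (t_ e)) (x_ e)) - (a_ e (t_ e) - a (t_ e))); last by rewrite /y_ /z_; ring.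
    by rewrite (le_trans (ler_normB _ _))// lerD2r clamp_dist.
  have -> : y_ = (fun e => (y_ e - z_ e) + z_ e) by apply/funext => e; rewrite subrK.
  by rewrite -[z]add0r; exact: cvgD.
have lc1 : (fun e => b_ e (t_ e) - a_ e (t_ e)) @ U --> b t - a t by exact: cvgB.
have lc2 : (fun e => b (t_ e) - a (t_ e)) @ U --> b t - a t by exact: cvgB.
have p1 : (fun e => prof V0 m k (b_ e (t_ e) - a_ e (t_ e)) (y_ e)) @ U -->
    prof V0 m k (b t - a t) z by exact: prof_cvg.
have p2 : (fun e => prof V0 m k (b (t_ e) - a (t_ e)) (z_ e)) @ U -->
    prof V0 m k (b t - a t) z by exact: prof_cvg.
have p0 : (fun e => prof V0 m k (b_ e (t_ e) - a_ e (t_ e)) (y_ e) -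
    prof V0 m k (b (t_ e) - a (t_ e)) (z_ e)) @ U --> (0 : R).
  by rewrite -[0](subrr (prof V0 m k (b t - a t) z)); exact: cvgB.
have /cvgrPdist_lt/(_ _ eta0) small := p0.
have [e [[[smalle Be] e0] te]] := filter_ex (filterI (filterI (filterI small UB) Upos) tU).
have {te} /andP[te0 _] := te.
have [_ big] := wP e Be.
have [_ abe _] := em e0; have [ab1 _] := abe _ te0; have [ab2 _] := ab _ te0.
rewrite !sessile_clamp// in big.
by move: smalle; rewrite /= sub0r normrN ltNge big.
Unshelve. all: by end_near. Qed.

End convergence.

Theorem theorem2p7 (R : realType) (V0 kappa alpha : R) (beta u0 : R -> R)
    (a0 b0 : R) :
  0 < V0 -> 0 < kappa -> 0 < alpha -> alpha < pi / 2 ->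
  [lipschitz beta x | x in setT] ->
  (exists2 P : R, 0 < P & periodic beta P) ->
  a0 < b0 -> drop_profile kappa alpha V0 a0 b0 u0 ->
  (forall ueps : R -> R -> R -> R,
     (forall e : R, 0 < e ->
        sliding_drop (fun x => beta (x / e)) kappa alpha V0 a0 b0 (ueps e)) ->
     exists u : R -> R -> R,
       homogenized_drop beta kappa alpha V0 a0 b0 u /\
       forall T eta : R, 0 < T -> 0 < eta ->
         \forall e \near 0^'+, forall x t : R, 0 <= t <= T ->
           `|ueps e x t - u x t| < eta) /\
  (forall u1 u2 : R -> R -> R,
     homogenized_drop beta kappa alpha V0 a0 b0 u1 ->
     homogenized_drop beta kappa alpha V0 a0 b0 u2 ->
     forall x t : R, 0 <= t -> u1 x t = u2 x t).
Proof.
move=> V0_gt0 kappa0 alpha0 alphapi lipb [P P0 pb] ab0 _.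
have cos0 : 0 < cos alpha by apply: cos_gt0_pihalf; rewrite alphapi andbT; lra.
have k0 : 0 < kappa * sin alpha by rewrite mulr_gt0// sin_gt0_pihalf// alpha0.
have m0 : 0 < Num.sqrt (kappa * cos alpha) by rewrite sqrtr_gt0 mulr_gt0.
have mE : Num.sqrt (kappa * cos alpha) ^+ 2 = kappa * cos alpha.
  by rewrite sqr_sqrtr// mulr_ge0// ltW.
have osc : oscillating beta P by split => //; exact: lipschitz_lineP.
have rE : (fun _ q : R => effective_speed beta q) = (fun _ q : R => speed beta P q).
  by apply/funext => _; apply/funext => q; exact: effective_speedE.
rewrite /homogenized_drop rE; split; last first.
  move=> u1 u2 /(drop_solution_edges V0_gt0 m0 k0 mE erefl)[a1 [b1 [em1 a10 b10 u1E]]].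
  move=> /(drop_solution_edges V0_gt0 m0 k0 mE erefl)[a2 [b2 [em2 a20 b20 u2E]]] x t t0.
  have [aE bE] := edge_motion_unique V0_gt0 m0 k0 (fun x y => @speed_ndecr _ _ _ x y osc)
    em1 em2 (etrans a10 (esym a20)) (etrans b10 (esym b20)) t0.
  by rewrite u1E// u2E// aE bE.
move=> ueps sol.
have ex e : exists ab : (R -> R) * (R -> R), 0 < e ->
    [/\ edge_motion V0 (Num.sqrt (kappa * cos alpha)) (kappa * sin alpha)
          (fun y q => q - beta (y / e)) ab.1 ab.2, ab.1 0 = a0, ab.2 0 = b0 &
     forall t, 0 <= t -> forall y, ueps e y t =
       sessile V0 (Num.sqrt (kappa * cos alpha)) (kappa * sin alpha) (ab.1 t) (ab.2 t) y].
  have [e0|e0] := ltP 0 e; last by exists (cst 0, cst 0).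
  by have [a [b h]] := drop_solution_edges V0_gt0 m0 k0 mE erefl (sol e e0); exists (a, b).
have [ab abP] := choice ex.
pose a_ e := (ab e).1; pose b_ e := (ab e).2.
have em e : 0 < e -> edge_motion V0 (Num.sqrt (kappa * cos alpha)) (kappa * sin alpha)
    (fun y q => q - beta (y / e)) (a_ e) (b_ e) by move=> /abP[].
have a_0 e : 0 < e -> a_ e 0 = a0 by move=> /abP[].
have b_0 e : 0 < e -> b_ e 0 = b0 by move=> /abP[].
have [U [UU subU]] := @ultraFilterLemma R (0 : R)^'+ _.
have [a [b [_ _ emab [aE bE]]]] := ultralimit V0_gt0 m0 k0 osc ab0 em a_0 b_0 UU subU.
exists (fun y t => sessile V0 (Num.sqrt (kappa * cos alpha)) (kappa * sin alpha) (a t) (b t) y).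
split.
  by rewrite -aE -bE; exact: (edges_drop_solution V0_gt0 m0 k0 mE erefl emab).
move=> T eta T0 eta0.
have := profiles_cvg V0_gt0 m0 k0 osc ab0 em a_0 b_0 emab aE bE T eta0.
move=> H; near=> e => x t tT.
have e0 : 0 < e by near: e; exact: nbhs_right_gt.
have [_ _ _ uE] := abP e e0.
rewrite uE; last by case/andP: tT.
by move: x t tT; near: e; exact: H.
Unshelve. all: by end_near. Qed.
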